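(* Let $k\in(0,1)$, and for $m,n\in\mathbb{N}_0$ let $$H^{(f')}_{m,n}=\frac{k^{m+n}\,\Gamma(m+n+3/2)}{\sqrt{(2m+1)(2n+1)}\,(m+n+1)!}\,{}_2F_1\!\left(m+n+\tfrac32,\tfrac12;m+n+2;k^2\right)$$ $$\phantom{H^{(f')}_{m,n}}=\frac{2k^{m+n}}{\sqrt{\pi(2m+1)(2n+1)}}\int_0^1\frac{x^{2m+2n+2}\,dx}{\sqrt{(1-x^2)(1-k^2x^2)}},$$ $$H^{(f'')}_{m,n}=\frac{k^{m+n}\sqrt{(2m+1)(2n+1)}\,\Gamma(m+n+1/2)}{(m+n+1)!}\,{}_2F_1\!\left(m+n+\tfrac12,-\tfrac12;m+n+2;k^2\right)$$ $$\phantom{H^{(f'')}_{m,n}}=\frac{4k^{m+n}\sqrt{(2m+1)(2n+1)}}{\sqrt\pi}\int_0^1x^{2m+2n}\sqrt{(1-x^2)(1-k^2x^2)}\,dx,$$ $$H^{(g')}_{m,n}=\frac{k^{m+n}\sqrt{(m+1)(n+1)}\,\Gamma(m+n+3/2)}{(m+n+2)!}\,{}_2F_1\!\left(m+n+\tfrac32,-\tfrac12;m+n+3;k^2\right)$$ $$\phantom{H^{(g')}_{m,n}}=\frac{4k^{m+n}\sqrt{(m+1)(n+1)}}{\sqrt\pi}\int_0^1x^{2m+2n+2}\sqrt{(1-x^2)(1-k^2x^2)}\,dx.$$ Each of the matrices $H^{(f')}$, $H^{(f'')}$, $H^{(g')}$ represents a positive trace class operator on $\ell^2(\mathbb{N}_0)$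 with simple eigenvalues. Moreover: (i) The eigenvalues of $H^{(f')}$ enumerated in descending order are $$\nu_m^{(f')}=\frac{4K}{\sqrt\pi\,k}\,\frac{q^{m+1/2}}{(2m+1)(1-q^{2m+1})},\quad m\ge0,$$ and for an eigenvector corresponding to $\nu_m^{(f')}$ one can choose the vector $\Psi_m^{(f)}$. (ii) The eigenvalues of $H^{(f'')}$ enumerated in descending order are $$\nu_m^{(f'')}=\frac{2\pi^{3/2}}{kK}\,\frac{(2m+1)q^{m+1/2}}{1-q^{2m+1}},\quad m\ge0,$$ and for an eigenvector corresponding to $\nu_m^{(f'')}$ one can choose the vector $\Psi_m^{(f)}$. (iii) The eigenvalues of $H^{(g')}$ enumerated in descending order are $$\nu_m^{(g')}=\frac{2\pi^{3/2}}{k^2K}\,\frac{mq^m}{1-q^{2m}},\quad m\ge1,$$ and for an eigenvector corresponding to $\nu_m^{(g')}$ one can choose the vector $\Psi_m^{(g)}$. Here the vectors have entries, for $n\in\mathbb{N}_0$, $$(\Psi_m^{(f)})_n=\frac{1}{k^n(2n)!\sqrt{2n+1}}\,f_n\!\left(-\frac{\pi^2(2m+1)^2}{4K^2}\right),\qquad (\Psi_m^{(g)})_n=\frac{1}{k^n(2n+1)!\sqrt{n+1}}\,g_n\!\left(-\frac{\pi^2m^2}{K^2}\right).$$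
   Context: $\mathbb{N}_0=\{0,1,2,\dots\}$. ${}_2F_1(a,b;c;z)$ is the Gauss hypergeometric function. For $k\in(0,1)$: $K=K(k)=\int_0^{\pi/2}\frac{d\theta}{\sqrt{1-k^2\sin^2\theta}}$, $K'(k)=K(\sqrt{1-k^2})$, and $q=\exp(-\pi K'(k)/K(k))\in(0,1)$ is the elliptic nome. The monic Stieltjes-Carlitz polynomials $f_n,g_n$ (depending on $k$) are defined for $n\ge0$ by $$f_{n+1}(x)=\big(x+(k^2+1)(2n+1)^2\big)f_n(x)-k^2(2n-1)(2n)^2(2n+1)f_{n-1}(x),$$ $$g_{n+1}(x)=\big(x+(k^2+1)(2n+2)^2\big)g_n(x)-k^2(2n)(2n+1)^2(2n+2)g_{n-1}(x),$$ with $f_{-1}=g_{-1}=0$ and $f_0=g_0=1$. The enumerated eigenvalues are all the eigenvalues of the respective operator; ''simple'' means multiplicity one. *)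

(* Defs.v *)
From Stdlib Require Import Reals Factorial.
From Coquelicot Require Import Coquelicot.
Open Scope R_scope.

(** * Special functions *)

(* Euler's integral, improper at both ends; meaningful for [0 < z]. *)
Definition Gamma (z : R) : R :=
  RInt_gen (fun t => Rpower t (z - 1) * exp (- t))
           (at_right 0) (Rbar_locally p_infty).

Fixpoint pochhammer (a : R) (n : nat) : R :=
  match n with
  | O => 1
  | S p => pochhammer a p * (a + INR p)
  end.

(* Gauss series; meaningful for [Rabs z < 1] and [c] not in {0, -1, -2, ...}. *)
Definition hyp2F1 (a b c z : R) : R :=
  PSeries (fun n => pochhammer a n * pochhammer b n
                    / (pochhammer c n * INR (fact n))) z.

Definition ellK (k : R) : R :=
  RInt (fun theta => / sqrt (1 - k ^ 2 * sin theta ^ 2)) 0 (PI / 2).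

Definition ellK' (k : R) : R := ellK (sqrt (1 - k ^ 2)).

Definition nome (k : R) : R := exp (- PI * ellK' k / ellK k).

(** * Stieltjes-Carlitz polynomials, as functions of [x] *)

(* The inner [O] branches are the conventions f_{-1} = g_{-1} = 0. *)
Fixpoint sc_f (k : R) (n : nat) (x : R) : R :=
  match n with
  | O => 1
  | S p =>
      (x + (k ^ 2 + 1) * (2 * INR p + 1) ^ 2) * sc_f k p x
      - k ^ 2 * (2 * INR p - 1) * (2 * INR p) ^ 2 * (2 * INR p + 1)
        * match p with O => 0 | S r => sc_f k r x end
  end.

Fixpoint sc_g (k : R) (n : nat) (x : R) : R :=
  match n with
  | O => 1
  | S p =>
      (x + (k ^ 2 + 1) * (2 * INR p + 2) ^ 2) * sc_g k p x
      - k ^ 2 * (2 * INR p) * (2 * INR p + 1) ^ 2 * (2 * INR p + 2)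
        * match p with O => 0 | S r => sc_g k r x end
  end.

(** * The weighted Hankel matrices and their spectral data *)

Definition H_f1 (k : R) (m n : nat) : R :=
  k ^ (m + n) * Gamma (INR (m + n) + 3 / 2)
  / (sqrt ((2 * INR m + 1) * (2 * INR n + 1)) * INR (fact (m + n + 1)))
  * hyp2F1 (INR (m + n) + 3 / 2) (1 / 2) (INR (m + n) + 2) (k ^ 2).

Definition H_f2 (k : R) (m n : nat) : R :=
  k ^ (m + n) * sqrt ((2 * INR m + 1) * (2 * INR n + 1))
  * Gamma (INR (m + n) + 1 / 2) / INR (fact (m + n + 1))
  * hyp2F1 (INR (m + n) + 1 / 2) (- (1 / 2)) (INR (m + n) + 2) (k ^ 2).

Definition H_g1 (k : R) (m n : nat) : R :=
  k ^ (m + n) * sqrt ((INR m + 1) * (INR n + 1))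
  * Gamma (INR (m + n) + 3 / 2) / INR (fact (m + n + 2))
  * hyp2F1 (INR (m + n) + 3 / 2) (- (1 / 2)) (INR (m + n) + 3) (k ^ 2).

Definition nu_f1 (k : R) (m : nat) : R :=
  4 * ellK k / (sqrt PI * k)
  * (Rpower (nome k) (INR m + 1 / 2)
     / ((2 * INR m + 1) * (1 - nome k ^ (2 * m + 1)))).

Definition nu_f2 (k : R) (m : nat) : R :=
  2 * Rpower PI (3 / 2) / (k * ellK k)
  * ((2 * INR m + 1) * Rpower (nome k) (INR m + 1 / 2)
     / (1 - nome k ^ (2 * m + 1))).

(* Only used for [1 <= m]. *)
Definition nu_g1 (k : R) (m : nat) : R :=
  2 * Rpower PI (3 / 2) / (k ^ 2 * ellK k)
  * (INR m * nome k ^ m / (1 - nome k ^ (2 * m))).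

Definition Psi_f (k : R) (m n : nat) : R :=
  1 / (k ^ n * INR (fact (2 * n)) * sqrt (2 * INR n + 1))
  * sc_f k n (- (PI ^ 2 * (2 * INR m + 1) ^ 2 / (4 * ellK k ^ 2))).

Definition Psi_g (k : R) (m n : nat) : R :=
  1 / (k ^ n * INR (fact (2 * n + 1)) * sqrt (INR n + 1))
  * sc_g k n (- (PI ^ 2 * INR m ^ 2 / ellK k ^ 2)).

(** * The complex Hilbert space l^2(N_0) and its operators *)

(* Operators are total functions on all complex sequences; only their values
   on l^2 are ever constrained or used. *)

Definition ell2 (x : nat -> C) : Prop := ex_series (fun n => Cmod (x n) ^ 2).

Definition norm2 (x : nat -> C) : R := sqrt (Series (fun n => Cmod (x n) ^ 2)).

(* Antilinear in the first argument; both series converge absolutely on l^2. *)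
Definition inner (x y : nat -> C) : C :=
  (Series (fun n => Re (Cconj (x n) * y n)%C),
   Series (fun n => Im (Cconj (x n) * y n)%C)).

Definition basis_vec (n : nat) : nat -> C :=
  fun j => if Nat.eqb j n then RtoC 1 else RtoC 0.

Definition operator : Type := (nat -> C) -> (nat -> C).

Definition bounded_op (T : operator) : Prop :=
  (forall x, ell2 x -> ell2 (T x))
  /\ (forall (a : C) (x y : nat -> C), ell2 x -> ell2 y -> forall n,
        T (fun j => (a * x j + y j)%C) n = (a * T x n + T y n)%C)
  /\ (exists M : R, forall x, ell2 x -> norm2 (T x) <= M * norm2 x).

(* Determines a bounded [T] uniquely on l^2. *)
Definition represents (H : nat -> nat -> R) (T : operator) : Prop :=
  forall m n, inner (basis_vec m) (T (basis_vec n)) = RtoC (H m n).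

Definition positive_op (T : operator) : Prop :=
  forall x, ell2 x -> Im (inner x (T x)) = 0 /\ 0 <= Re (inner x (T x)).

(* [A] is |T|, the positive square root of T^* T. *)
Definition is_abs_op (T A : operator) : Prop :=
  bounded_op A /\ positive_op A
  /\ (forall x y, ell2 x -> ell2 y -> inner y (A (A x)) = inner (T y) (T x)).

Definition trace_class (T : operator) : Prop :=
  bounded_op T
  /\ exists A : operator, is_abs_op T A
       /\ ex_series (fun n => Re (inner (basis_vec n) (A (basis_vec n)))).

Definition eigenvector (T : operator) (lambda : C) (v : nat -> C) : Prop :=
  ell2 v /\ (exists n, v n <> RtoC 0)
  /\ (forall n, T v n = (lambda * v n)%C).

Definition eigenvalue (T : operator) (lambda : C) : Prop :=
  exists v, eigenvector T lambda v.

(* Geometric multiplicity one; for the positive (hence self-adjoint) operators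
   considered here it coincides with algebraic multiplicity one. *)
Definition simple_eigenvalue (T : operator) (lambda : C) : Prop :=
  exists v, eigenvector T lambda v
    /\ forall w, eigenvector T lambda w ->
         exists c : C, forall n, w n = (c * v n)%C.

(* As the eigenvalues are simple, descending order means strictly decreasing;
   [lambda] ranges over C, so [nu] exhausts the whole point spectrum. *)
Definition eigenvalues_enumerated (T : operator) (nu : nat -> R) : Prop :=
  (forall m, nu (S m) < nu m)
  /\ (forall lambda : C, eigenvalue T lambda <-> exists m, lambda = RtoC (nu m)).

(* Main.v *)
(* Substituting x = sn u (u in [0, K], dx = cn u dn u du) turns each matrix into a
   Gram matrix of functions e_n on [0, K], for instance
   e_n = k^n sn^(2n+1) / sqrt (2n+1) for H^(f'), so it is enough to find functions S_m with
   sum_n (Psi_m)_n e_n = S_m and <e_n, S_m> = nu_m (Psi_m)_n.  The operator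
   d^2/du^2 acts on powers of sn by a three-term rule.  Read on Taylor coefficients, this
   says that f_n (resp. g_n) are the coefficients of sin (l u) in powers of sn u; read
   through integration by parts, it says that the moments of sn^p against sin (l u) are
   multiples of the same polynomials.  So S_m is a sine or a cosine of frequency
   l_m = pi (2m+1) / (2K) or pi m / K, and nu_m is up to a factor the corresponding
   Fourier coefficient of sn or sn^2.  Trigonometric completeness rules out any other
   eigenvalue.

   The Fourier coefficients are computed without complex analysis.  The function
   atan (k sn(t, k) sc(tau, k')) is harmonic in (t, tau), so
   B(tau) = int_0^K sin (l t) atan (k sn(t, k) sc(tau, k')) dt satisfies B'' = l^2 B with
   B(0) = 0 and B'(0) = k int_0^K sn t sin (l t) dt, while B(tau) tends to pi / (2 l) as tau
   tends to K' because sc blows up.  Hence k int_0^K sn t sin (l t) dt = pi / (2 sinh (l K')).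
   For sn^2 the same is done with ln (1 + k^2 sn(t, k)^2 sc(tau, k')^2). *)

Require Import Defs.
From Stdlib Require Import Reals Factorial Lra Lia Psatz Classical.
From Coquelicot Require Import Coquelicot.
Open Scope R_scope.
Set Bullet Behavior "Strict Subproofs".

(** * Calculus of continuous functions on the line *)

(** The working variable is the amplitude [y] in [0, PI/2], with sn u = sin y and u = [ellF k y].
    The elliptic integral is never inverted, d/du becomes [dn] d/dy, and the integrands in [y]
    extend continuously to the whole line, so the calculus lemmas can ask for continuity everywhere.
    The delicate point is convergence of the expansion in powers of sn up to sn = 1. For general l,
    sin (l u) as a function of sn u branches at sn = 1; when cos (l K) = 0 it is even about u = K
    and the branch point disappears. In the proof this shows up through the moments: they write
    f_n(-l^2), up to a fixed factor, as k^(2n) (2n)! times a bounded moment, the fixed factor being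
    the inverse of the first moment. The Fourier coefficient must therefore be known to be nonzero
    before the expansion can be summed; only then do the partial sums, viewed as solutions of a
    perturbed oscillator equation, converge to the trigonometric function. The polynomials f_n and
    g_n share one argument through their lowest exponent [p0], which is 1 or 2. *)

Lemma ex_RInt_continuous_all (f : R -> R) (a b : R) :
  (forall x, continuous f x) -> ex_RInt f a b.
Proof.
  intros Hf. apply (ex_RInt_continuous (V := R_CompleteNormedModule)). intros z _. apply Hf.
Qed.

Lemma RInt_ext_all (f g : R -> R) (a b : R) :
  (forall x, f x = g x) -> RInt f a b = RInt g a b.
Proof. intros H. apply RInt_ext. intros x _. apply H. Qed.

Lemma RInt_antiderivative (F f : R -> R) (a b : R) :
  (forall x, is_derive F x (f x)) -> (forall x, continuous f x) ->
  RInt f a b = F b - F a.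
Proof.
  intros HF Hf. apply is_RInt_unique.
  apply (is_RInt_derive F f); intros; auto.
Qed.

(* [RInt] returns elements of a Coquelicot structure over [R], which [ring]
   and [field] do not recognise. *)
Ltac onR := match goal with |- @eq _ ?x ?y => change (@eq R x y) end.
Ltac scalR := match goal with |- context [scal ?a ?b] => change (scal a b) with (Rmult a b) end.
(* [auto_derive] leaves [Derive (fun y => f y) x] for an opaque [f]. *)
Ltac subst_Derive H :=
  match type of H with
  | is_derive ?f ?x ?l =>
      replace (Derive (fun y : R => f y) x) with l by (symmetry; apply is_derive_unique, H)
  end.
Ltac rring := onR; apply Rminus_diag_uniq; ring.
Ltac rfield := onR; apply Rminus_diag_uniq; field.

Lemma RInt_scal_all (c : R) (f : R -> R) (a b : R) : (forall x, continuous f x) ->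
  RInt (fun x => c * f x) a b = c * RInt f a b.
Proof.
  intros Hf. apply (RInt_scal (V := R_CompleteNormedModule)).
  now apply ex_RInt_continuous_all.
Qed.

Lemma RInt_plus_all (f g : R -> R) (a b : R) :
  (forall x, continuous f x) -> (forall x, continuous g x) ->
  RInt (fun x => f x + g x) a b = RInt f a b + RInt g a b.
Proof.
  intros Hf Hg. apply (RInt_plus (V := R_CompleteNormedModule));
    now apply ex_RInt_continuous_all.
Qed.

Lemma RInt_minus_all (f g : R -> R) (a b : R) :
  (forall x, continuous f x) -> (forall x, continuous g x) ->
  RInt (fun x => f x - g x) a b = RInt f a b - RInt g a b.
Proof.
  intros Hf Hg. apply (RInt_minus (V := R_CompleteNormedModule));
    now apply ex_RInt_continuous_all.
Qed.

Lemma abs_RInt_le_const_all (f : R -> R) (a b M : R) :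
  a <= b -> (forall x, continuous f x) ->
  (forall x, a <= x <= b -> Rabs (f x) <= M) ->
  Rabs (RInt f a b) <= (b - a) * M.
Proof.
  intros Hab Hf HM. apply abs_RInt_le_const; auto.
  now apply ex_RInt_continuous_all.
Qed.

(** * Weierstrass M-test: continuity and termwise integration of series *)

Section UniformSeries.

Variables (u : nat -> R -> R) (M : nat -> R).
Hypothesis u_continuous : forall n x, continuous (u n) x.
Hypothesis u_le : forall n x, Rabs (u n x) <= M n.
Hypothesis M_summable : ex_series M.

Lemma Mtest_ex_series (x : R) : ex_series (fun n => u n x).
Proof.
  apply (ex_series_le (K := R_AbsRing) (V := R_CompleteNormedModule) _ M); auto.
Qed.

Lemma Mtest_tail (x : R) (N : nat) :
  Rabs (Series (fun n => u n x) - sum_n (fun n => u n x) N)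
  <= Series M - sum_n M N.
Proof.
  rewrite (Series_incr_n (fun n => u n x) (S N)); [| lia | apply Mtest_ex_series].
  rewrite (Series_incr_n M (S N)); [| lia | auto].
  simpl pred. rewrite !sum_n_Reals.
  replace (_ + _ - _) with (Series (fun n => u (S N + n)%nat x)) by ring.
  replace (_ + _ - _) with (Series (fun n => M (S N + n)%nat)) by ring.
  assert (HM : ex_series (fun n => M (S N + n)%nat)).
  { now apply (ex_series_incr_n (K := R_AbsRing) (V := R_NormedModule) M). }
  eapply Rle_trans; [apply Series_Rabs |].
  - apply (ex_series_le (K := R_AbsRing) (V := R_CompleteNormedModule) _
             (fun n => M (S N + n)%nat)); auto.
    intros n. change (Rabs (Rabs (u (S N + n)%nat x)) <= M (S N + n)%nat).
    rewrite Rabs_Rabsolu. apply u_le.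
  - apply Series_le; auto. intros n. split; [apply Rabs_pos | apply u_le].
Qed.

Lemma Mtest_tail_small (eps : posreal) :
  exists N, forall n, (N <= n)%nat -> Series M - sum_n M n < eps.
Proof.
  pose proof (Series_correct M M_summable) as HM.
  unfold is_series in HM.
  apply (filterlim_locally (sum_n M) (Series M)) with (eps := eps) in HM.
  destruct HM as [N HN]. exists N. intros n Hn.
  specialize (HN n Hn). unfold ball in HN; simpl in HN. unfold AbsRing_ball in HN.
  unfold abs, minus, plus, opp in HN; simpl in HN.
  apply Rabs_def2 in HN. lra.
Qed.

Lemma sum_n_continuous (N : nat) (x : R) :
  continuous (fun x => sum_n (fun n => u n x) N) x.
Proof.
  induction N as [|N IH].
  - apply continuous_ext with (u 0%nat); auto.
    intros y. now rewrite sum_O.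
  - apply continuous_ext with (fun x => plus (sum_n (fun n => u n x) N) (u (S N) x)).
    + intros y. now rewrite sum_Sn.
    + apply @continuous_plus; auto.
Qed.

Lemma Mtest_continuous (x : R) : continuous (fun x => Series (fun n => u n x)) x.
Proof.
  apply filterlim_locally. intros eps.
  assert (He : 0 < eps / 3) by (destruct eps; simpl; lra).
  destruct (Mtest_tail_small (mkposreal _ He)) as [N HN].
  specialize (HN N (le_n N)). simpl in HN.
  pose proof (sum_n_continuous N x) as Hc.
  apply (filterlim_locally (fun x => sum_n (fun n => u n x) N)) with (eps := mkposreal _ He) in Hc.
  apply filter_imp with (2 := Hc). intros y Hy.
  unfold ball in Hy |- *; simpl in Hy |- *. unfold AbsRing_ball in *.
  unfold abs, minus, plus, opp in *; simpl in *.
  pose proof (Mtest_tail x N) as H1. pose proof (Mtest_tail y N) as H2.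
  apply Rabs_def2 in Hy. apply Rabs_def1;
  apply Rabs_le_between in H1; apply Rabs_le_between in H2; lra.
Qed.

Lemma RInt_sum_n (a b : R) (N : nat) :
  sum_n (fun n => RInt (u n) a b) N = RInt (fun x => sum_n (fun n => u n x) N) a b.
Proof.
  induction N as [|N IH].
  - rewrite sum_O. apply RInt_ext. intros x _. now rewrite sum_O.
  - rewrite sum_Sn, IH.
    rewrite (RInt_ext (fun x => sum_n (fun n => u n x) (S N))
               (fun x => plus (sum_n (fun n => u n x) N) (u (S N) x))).
    + symmetry. apply (RInt_plus (V := R_CompleteNormedModule)).
      * apply ex_RInt_continuous_all. apply sum_n_continuous.
      * apply ex_RInt_continuous_all. auto.
    + intros x _. now rewrite sum_Sn.
Qed.

Lemma Mtest_RInt (a b : R) : a <= b ->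
  is_series (fun n => RInt (u n) a b) (RInt (fun x => Series (fun n => u n x)) a b).
Proof.
  intros Hab. apply filterlim_locally. intros eps.
  assert (He : 0 < eps / (b - a + 1)).
  { apply Rdiv_lt_0_compat; [apply cond_pos | lra]. }
  destruct (Mtest_tail_small (mkposreal _ He)) as [N HN]. exists N.
  intros n Hn. specialize (HN n Hn). simpl in HN.
  rewrite RInt_sum_n.
  unfold ball; simpl. unfold AbsRing_ball, abs, minus, plus, opp; simpl.
  match goal with |- Rabs (?A + - ?B) < _ => change (Rabs (A - B) < eps) end.
  rewrite Rabs_minus_sym.
  assert (E : forall f g : R -> R, (forall x, continuous f x) -> (forall x, continuous g x) ->
     RInt f a b - RInt g a b = RInt (fun x => f x - g x) a b).
  { intros f g Hf Hg. symmetry.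
    apply (RInt_minus (V := R_CompleteNormedModule)); now apply ex_RInt_continuous_all. }
  rewrite E; [| apply Mtest_continuous | apply sum_n_continuous].
  eapply Rle_lt_trans.
  - apply abs_RInt_le_const_all with (M := Series M - sum_n M n); auto.
    + intros x. apply (continuous_minus (V := R_NormedModule));
        [apply Mtest_continuous | apply sum_n_continuous].
    + intros x _. apply Mtest_tail.
  - apply Rle_lt_trans with ((b - a) * (eps / (b - a + 1))).
    + apply Rmult_le_compat_l; lra.
    + apply Rlt_le_trans with ((b - a + 1) * (eps / (b - a + 1))).
      * apply Rmult_lt_compat_r; lra.
      * right. field. lra.
Qed.

End UniformSeries.

(** * Continuity by syntax, parametric integrals, integration by parts *)

Lemma continuous_ex_derive (f : R -> R) (x : R) : ex_derive f x -> continuous f x.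
Proof. apply (ex_derive_continuous (K := R_AbsRing) (V := R_NormedModule)). Qed.

Lemma continuous_of_is_derive (f : R -> R) (l x : R) : is_derive f x l -> continuous f x.
Proof. intros H. apply continuous_ex_derive. now exists l. Qed.

Lemma Rabs_sin_pow_le (n : nat) (y : R) : Rabs (sin y ^ n) <= 1.
Proof.
  rewrite <- RPow_abs, <- (pow1 n). apply pow_incr. split; [apply Rabs_pos |].
  apply Rabs_le, SIN_bound.
Qed.

Lemma cos_sqr (y : R) : cos y ^ 2 = 1 - sin y ^ 2.
Proof. pose proof (sin2_cos2 y) as E. unfold Rsqr in E. lra. Qed.

(* Delta amplitude, as a function of the amplitude [y]. *)
Definition dn (k y : R) : R := sqrt (1 - k ^ 2 * sin y ^ 2).

Ltac cont1 :=
  match goal with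
  | |- continuous (fun x => ?c) _ => apply continuous_const
  | |- continuous (fun x => x) _ => apply continuous_id
  | |- continuous (fun x => @?f x + @?g x) _ => apply (continuous_plus (V := R_NormedModule) f g); cont1
  | |- continuous (fun x => @?f x - @?g x) _ => apply (continuous_minus (V := R_NormedModule) f g); cont1
  | |- continuous (fun x => - @?f x) _ => apply (continuous_opp (V := R_NormedModule) f); cont1
  | |- continuous (fun x => @?f x * @?g x) _ => apply (continuous_mult (K := R_AbsRing) f g); cont1
  | |- continuous (fun x => @?f x / @?g x) _ =>
      apply (continuous_mult (K := R_AbsRing) f (fun x => / g x)); cont1
  | |- continuous (fun x => / dn _ x) _ => auto
  | |- continuous (fun x => / @?f x) _ => apply (continuous_Rinv_comp f); [cont1 | auto]
  | |- continuous (fun x => atan (@?f x)) _ => apply (continuous_comp f atan);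
      [cont1 | apply continuous_ex_derive;
               eexists; apply is_derive_atan]
  | |- continuous (fun x => @?f x ^ ?n) _ =>
      apply (continuous_comp f (fun y => y ^ n)); [cont1 |
        apply continuous_ex_derive; auto_derive; auto]
  | |- continuous (fun x => exp (@?f x)) _ => apply (continuous_comp f exp);
      [cont1 | apply continuous_exp]
  | |- continuous (fun x => sin (@?f x)) _ => apply (continuous_comp f sin);
      [cont1 | apply continuous_sin]
  | |- continuous (fun x => cos (@?f x)) _ => apply (continuous_comp f cos);
      [cont1 | apply continuous_cos]
  | |- _ => auto
  end.

(** A subterm depending on only one of the two variables is handed to [cont1] before the algebraic
    rules are tried, so only genuinely joint dependence is decomposed here. *)
Ltac cont2 :=
  match goal with
  | |- continuity_2d_pt (fun u v => ?c) _ _ => apply continuity_2d_pt_const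
  | |- continuity_2d_pt (fun u v => @?f v) ?x ?y =>
      apply (continuity_1d_2d_pt_comp f (fun _ v => v) x y);
      [apply continuity_pt_filterlim; change (continuous f y); cont1 | apply continuity_2d_pt_id2]
  | |- continuity_2d_pt (fun u v => @?f u) ?x ?y =>
      apply (continuity_1d_2d_pt_comp f (fun u _ => u) x y);
      [apply continuity_pt_filterlim; change (continuous f x); cont1 | apply continuity_2d_pt_id1]
  | |- continuity_2d_pt (fun u v => @?f u v + @?g u v) _ _ => apply (continuity_2d_pt_plus f g); cont2
  | |- continuity_2d_pt (fun u v => @?f u v - @?g u v) _ _ => apply (continuity_2d_pt_minus f g); cont2
  | |- continuity_2d_pt (fun u v => - @?f u v) _ _ => apply (continuity_2d_pt_opp f); cont2
  | |- continuity_2d_pt (fun u v => @?f u v * @?g u v) _ _ => apply (continuity_2d_pt_mult f g); cont2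
  | |- continuity_2d_pt (fun u v => / @?f u v) _ _ => apply (continuity_2d_pt_inv f); [cont2 | auto]
  | |- continuity_2d_pt (fun u v => @?f u v / @?g u v) _ _ =>
      apply (continuity_2d_pt_mult f (fun u v => / g u v)); cont2
  | |- continuity_2d_pt (fun u v => @?f u v ^ ?n) _ _ =>
      apply (continuity_1d_2d_pt_comp (fun y => y ^ n) f);
      [apply derivable_continuous_pt; apply derivable_pt_pow | cont2]
  | |- continuity_2d_pt (fun u v => ?f (@?g u v)) ?x ?y =>
      apply (continuity_1d_2d_pt_comp f g x y); [auto | cont2]
  | |- _ => auto
  end.

Lemma is_derive_RInt_param_all (f df : R -> R -> R) (a b x : R) :
  (forall w t, is_derive (fun u => f u t) w (df w t)) ->
  (forall t, continuity_2d_pt df x t) ->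
  (forall w t, continuous (f w) t) ->
  is_derive (fun w => RInt (f w) a b) x (RInt (df x) a b).
Proof.
  intros Hd Hc Hf.
  rewrite (RInt_ext (df x) (fun t => Derive (fun u => f u t) x)).
  2:{ intros t _. symmetry. apply is_derive_unique, Hd. }
  apply (is_derive_RInt_param f a b x).
  - apply filter_forall. intros w t _. eexists. apply Hd.
  - intros t _. apply continuity_2d_pt_ext with df; [| apply Hc].
    intros u v. symmetry. apply is_derive_unique, Hd.
  - apply filter_forall. intros w. now apply ex_RInt_continuous_all.
Qed.

Lemma RInt_by_parts_all (f g f' g' : R -> R) (a b : R) :
  (forall x, is_derive f x (f' x)) -> (forall x, is_derive g x (g' x)) ->
  (forall x, continuous f' x) -> (forall x, continuous g' x) ->
  RInt (fun x => f' x * g x) a b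
  = f b * g b - f a * g a - RInt (fun x => f x * g' x) a b.
Proof.
  intros Hf Hg Hf' Hg'.
  assert (cf : forall x, continuous f x).
  { intros x. eapply continuous_of_is_derive, Hf. }
  assert (cg : forall x, continuous g x).
  { intros x. eapply continuous_of_is_derive, Hg. }
  rewrite <- (RInt_antiderivative (fun x => f x * g x)
             (fun x => f' x * g x + f x * g' x) a b).
  - rewrite (RInt_plus_all (fun x => f' x * g x) (fun x => f x * g' x)).
    + rring.
    + intros x. cont1.
    + intros x. cont1.
  - intros x. apply (is_derive_mult (K := R_AbsRing) f g); auto.
    intros n m. apply Rmult_comm.
  - intros x. cont1.
Qed.

Lemma eq_of_derive_zero (f : R -> R) (a b : R) :
  a <= b -> (forall x, a <= x <= b -> is_derive f x 0) -> f a = f b.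
Proof.
  intros [Hab | ->] H; auto. apply (eq_is_derive (V := R_NormedModule)); auto.
Qed.

Lemma continuity_pt_of_continuous (f : R -> R) (x : R) :
  continuous f x -> continuity_pt f x.
Proof. intros H. now apply continuity_pt_filterlim. Qed.

(** * Elliptic integrals as functions of the amplitude *)

Lemma le_of_derive_nonneg (f f' : R -> R) (a b : R) :
  a <= b -> (forall x, a <= x <= b -> is_derive f x (f' x)) ->
  (forall x, a <= x <= b -> 0 <= f' x) -> f a <= f b.
Proof.
  intros [Hab | ->] Hd Hp; [| lra].
  destruct (MVT_gen f a b f') as [c [Hc E]].
  - intros x Hx. rewrite Rmin_left, Rmax_right in Hx by lra. apply Hd; lra.
  - intros x Hx. rewrite Rmin_left, Rmax_right in Hx by lra.
    eapply continuity_pt_of_continuous, continuous_of_is_derive. apply Hd; lra.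
  - rewrite Rmin_left, Rmax_right in Hc by lra.
    specialize (Hp c Hc). assert (0 <= f' c * (b - a)) by (apply Rmult_le_pos; lra). lra.
Qed.

(** A crude Jordan inequality. Monotonicity of sin x - x cos x gives y cos y <= sin y, and y <= 2
    because PI <= 4; splitting y as y cos^2 + y sin^2 then yields the constant 1 + 2. It lets sin (l
    u) be bounded by a multiple of sin y. *)
Lemma le_three_sin (y : R) : 0 <= y <= PI / 2 -> y <= 3 * sin y.
Proof.
  intros Hy. pose proof PI_4.
  assert (Hs : forall x, 0 <= x <= PI / 2 -> 0 <= sin x) by (intros; apply sin_ge_0; lra).
  assert (Hc : forall x, 0 <= x <= PI / 2 -> 0 <= cos x) by (intros; apply cos_ge_0; lra).
  assert (H1 : sin 0 - 0 * cos 0 <= sin y - y * cos y).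
  { apply (le_of_derive_nonneg (fun x => sin x - x * cos x) (fun x => x * sin x)); [lra | |].
    - intros x _. auto_derive; auto. ring.
    - intros x Hx. apply Rmult_le_pos; [lra | apply Hs; lra]. }
  rewrite sin_0 in H1.
  pose proof (Hs y Hy). pose proof (Hc y Hy). pose proof (SIN_bound y). pose proof (COS_bound y).
  pose proof (sin2_cos2 y) as E. unfold Rsqr in E. nra.
Qed.

Lemma atan_le_id (x : R) : 0 <= x -> atan x <= x.
Proof.
  intros Hx.
  assert (0 - atan 0 <= x - atan x); [| rewrite atan_0 in *; lra].
  apply (le_of_derive_nonneg (fun x => x - atan x) (fun x => 1 - / (1 + x ^ 2))); auto.
  - intros y _. auto_derive; auto. unfold Rsqr. field. nra.
  - intros y _. assert (/ (1 + y ^ 2) <= / 1); [apply Rinv_le_contravar; nra | lra].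
Qed.

Lemma PI2_minus_atan_bounds (x : R) : 0 < x -> 0 <= PI / 2 - atan x <= / x.
Proof.
  intros Hx. rewrite <- (atan_inv x Hx). pose proof (Rinv_0_lt_compat x Hx).
  split.
  - rewrite <- atan_0. left. now apply atan_increasing.
  - apply atan_le_id. lra.
Qed.

Definition ellF (k y : R) : R := RInt (fun th => / sqrt (1 - k ^ 2 * sin th ^ 2)) 0 y.

Section EllipticIntegral.

Variable k : R.
Hypothesis hk : 0 < k < 1.

Lemma dn_radicand_pos (y : R) : 0 < 1 - k ^ 2 * sin y ^ 2.
Proof.
  pose proof (sin2_cos2 y) as E. unfold Rsqr in E.
  assert (0 <= sin y ^ 2 <= 1) by (split; nra). assert (0 < k ^ 2 < 1) by (split; nra). nra.
Qed.

Lemma dn_pos (y : R) : 0 < dn k y.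
Proof. apply sqrt_lt_R0, dn_radicand_pos. Qed.

Lemma dn_neq_0 (y : R) : dn k y <> 0.
Proof. pose proof (dn_pos y). lra. Qed.

Lemma dn_sqr (y : R) : dn k y ^ 2 = 1 - k ^ 2 * sin y ^ 2.
Proof. apply pow2_sqrt. left. apply dn_radicand_pos. Qed.

Lemma dn_le_1 (y : R) : dn k y <= 1.
Proof.
  pose proof (dn_sqr y). pose proof (dn_pos y).
  assert (0 <= sin y ^ 2) by nra. assert (0 < k ^ 2) by nra. nra.
Qed.

Lemma Rabs_dn_le_1 (y : R) : Rabs (dn k y) <= 1.
Proof. pose proof (dn_pos y). pose proof (dn_le_1 y). rewrite Rabs_right; lra. Qed.

Lemma is_derive_dn (y : R) : is_derive (dn k) y (- k ^ 2 * sin y * cos y / dn k y).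
Proof.
  unfold dn. pose proof (dn_radicand_pos y). auto_derive; [lra |].
  replace (1 + - (k * (k * 1) * (sin y * (sin y * 1)))) with (1 - k ^ 2 * sin y ^ 2) by ring.
  field. apply (dn_neq_0 y).
Qed.

Lemma continuous_dn (y : R) : continuous (dn k) y.
Proof. eapply continuous_of_is_derive, is_derive_dn. Qed.

Lemma continuous_inv_dn (y : R) : continuous (fun y => / dn k y) y.
Proof.
  apply continuous_of_is_derive with (k ^ 2 * sin y * cos y / dn k y / dn k y ^ 2).
  pose proof (dn_neq_0 y).
  evar_last.
  - apply is_derive_inv; [apply is_derive_dn | auto].
  - unfold Rdiv. ring.
Qed.

Lemma ellF_0 : ellF k 0 = 0.
Proof. apply (RInt_point (V := R_CompleteNormedModule)). Qed.

Lemma is_derive_ellF (y : R) : is_derive (ellF k) y (/ dn k y).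
Proof.
  apply (is_derive_RInt (V := R_NormedModule) (fun th => / sqrt (1 - k ^ 2 * sin th ^ 2)) _ 0).
  - apply filter_forall. intros b.
    apply (RInt_correct (V := R_CompleteNormedModule)).
    apply ex_RInt_continuous_all, continuous_inv_dn.
  - apply continuous_inv_dn.
Qed.

Lemma continuous_ellF (y : R) : continuous (ellF k) y.
Proof. eapply continuous_of_is_derive, is_derive_ellF. Qed.

Lemma ellF_PI2 : ellF k (PI / 2) = ellK k.
Proof. reflexivity. Qed.

(** Since [dn <= 1], even [ellF k y - y] is nondecreasing, which makes the inequality strict. *)
Lemma ellF_increasing (a b : R) : a < b -> ellF k a < ellF k b.
Proof.
  intros Hab.
  assert (ellF k a - a <= ellF k b - b); [| lra].
  apply (le_of_derive_nonneg (fun y => ellF k y - y) (fun y => / dn k y - 1)); [lra | |].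
  - intros y _. apply (is_derive_minus (K := R_AbsRing) (ellF k) (fun y => y)).
    + apply is_derive_ellF.
    + apply @is_derive_id.
  - intros y _. pose proof (dn_le_1 y). pose proof (dn_pos y).
    assert (/ 1 <= / dn k y) by (apply Rinv_le_contravar; lra). lra.
Qed.

Lemma inv_dn_le (y : R) : / dn k y <= / sqrt (1 - k ^ 2).
Proof.
  assert (0 < 1 - k ^ 2) by nra.
  apply Rinv_le_contravar; [now apply sqrt_lt_R0 |].
  apply sqrt_le_1_alt.
  pose proof (sin2_cos2 y) as E. unfold Rsqr in E. assert (0 < k ^ 2) by nra. nra.
Qed.

Lemma ellF_le (a b : R) : a <= b -> ellF k b - ellF k a <= / sqrt (1 - k ^ 2) * (b - a).
Proof.
  intros Hab. set (C := / sqrt (1 - k ^ 2)).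
  assert (C * a - ellF k a <= C * b - ellF k b); [| lra].
  apply (le_of_derive_nonneg (fun y => C * y - ellF k y) (fun y => C - / dn k y)); [lra | |].
  - intros y _. apply (is_derive_minus (K := R_AbsRing) (fun y => C * y) (ellF k)).
    + auto_derive; auto. ring.
    + apply is_derive_ellF.
  - intros y _. pose proof (inv_dn_le y). fold C in H. lra.
Qed.

Lemma ellK_pos : 0 < ellK k.
Proof.
  rewrite <- ellF_PI2. rewrite <- ellF_0 at 1. apply ellF_increasing. pose proof PI_RGT_0. lra.
Qed.

Lemma ellF_bounds (y : R) : 0 <= y <= PI / 2 -> 0 <= ellF k y <= ellK k.
Proof.
  intros [H1 H2].
  assert (E : forall a b, a <= b -> ellF k a <= ellF k b).
  { intros a b [Hab | ->]; [left; now apply ellF_increasing | lra]. }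
  rewrite <- ellF_PI2, <- (ellF_0) at 1. split; now apply E.
Qed.

Lemma is_derive_sin_ellF (l y : R) :
  is_derive (fun y => sin (l * ellF k y)) y (l * cos (l * ellF k y) / dn k y).
Proof.
  evar_last.
  - apply (is_derive_comp (K := R_AbsRing) (V := R_NormedModule) sin (fun y => l * ellF k y)).
    + apply is_derive_sin.
    + apply is_derive_scal, is_derive_ellF.
  - scalR. unfold Rdiv. ring.
Qed.

Lemma is_derive_cos_ellF (l y : R) :
  is_derive (fun y => cos (l * ellF k y)) y (- l * sin (l * ellF k y) / dn k y).
Proof.
  evar_last.
  - apply (is_derive_comp (K := R_AbsRing) (V := R_NormedModule) cos (fun y => l * ellF k y)).
    + apply is_derive_cos.
    + apply is_derive_scal, is_derive_ellF.
  - scalR. unfold Rdiv. ring.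
Qed.

End EllipticIntegral.

#[global] Hint Resolve continuous_dn continuous_inv_dn continuous_ellF dn_neq_0 : core.

(** * Fourier coefficients of sn and of its square *)

(* Jacobi's imaginary transformation: [w] stands for [sc(tau, k')], and
   [modw] for [dw/dtau]. *)
Definition modw (k w : R) : R := sqrt ((1 + w ^ 2) * (1 + k ^ 2 * w ^ 2)).

(** The inverse of w = sc(tau, k'): an amplitude with tangent [w] is [atan w]. As [w] tends to
    infinity, tau tends to K'. *)
Definition ellT (k w : R) : R := ellF (sqrt (1 - k ^ 2)) (atan w).

(** * The imaginary direction and the equation B'' = l^2 B *)

Section ImaginaryDirection.

Variable k : R.
Hypothesis hk : 0 < k < 1.

Lemma compl_modulus_bounds : 0 < sqrt (1 - k ^ 2) < 1.
Proof.
  assert (0 < k ^ 2) by nra. assert (0 < 1 - k ^ 2) by nra. split.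
  - now apply sqrt_lt_R0.
  - rewrite <- sqrt_1 at 2. apply sqrt_lt_1; lra.
Qed.

Lemma compl_modulus_sqr : sqrt (1 - k ^ 2) ^ 2 = 1 - k ^ 2.
Proof. apply pow2_sqrt. nra. Qed.

Lemma modw_radicand_pos (w : R) : 0 < (1 + w ^ 2) * (1 + k ^ 2 * w ^ 2).
Proof. assert (0 <= k ^ 2 * w ^ 2) by nra. apply Rmult_lt_0_compat; nra. Qed.

Lemma modw_pos (w : R) : 0 < modw k w.
Proof. apply sqrt_lt_R0, modw_radicand_pos. Qed.

Lemma modw_sqr (w : R) : modw k w ^ 2 = (1 + w ^ 2) * (1 + k ^ 2 * w ^ 2).
Proof. apply pow2_sqrt. left. apply modw_radicand_pos. Qed.

Lemma modw_0 : modw k 0 = 1.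
Proof. unfold modw. replace (_ * _) with 1 by ring. apply sqrt_1. Qed.

Lemma is_derive_modw (w : R) :
  is_derive (modw k) w ((w * (1 + k ^ 2 * w ^ 2) + k ^ 2 * w * (1 + w ^ 2)) / modw k w).
Proof.
  unfold modw. pose proof (modw_radicand_pos w). auto_derive.
  - replace ((1 + w * (w * 1)) * (1 + k * (k * 1) * (w * (w * 1))))
      with ((1 + w ^ 2) * (1 + k ^ 2 * w ^ 2)) by ring. lra.
  - replace ((1 + w * (w * 1)) * (1 + k * (k * 1) * (w * (w * 1))))
      with ((1 + w ^ 2) * (1 + k ^ 2 * w ^ 2)) by ring. field.
    pose proof (modw_pos w) as Hm. unfold modw in Hm. lra.
Qed.

Lemma is_derive_ellT (w : R) : is_derive (ellT k) w (/ modw k w).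
Proof.
  unfold ellT. evar_last.
  - apply (is_derive_comp (K := R_AbsRing) (V := R_NormedModule) (ellF _) atan).
    + apply is_derive_ellF, compl_modulus_bounds.
    + apply is_derive_atan.
  - scalR.
    assert (Hw : 0 < 1 + w ^ 2) by nra.
    assert (E : dn (sqrt (1 - k ^ 2)) (atan w) = modw k w / (1 + w ^ 2)).
    { assert (Es : sin (atan w) ^ 2 = w ^ 2 / (1 + w ^ 2)).
      { rewrite sin_atan. unfold Rdiv. rewrite Rpow_mult_distr, pow_inv.
        rewrite pow2_sqrt; unfold Rsqr; [field; lra | nra]. }
      pose proof (modw_pos w).
      unfold dn. rewrite compl_modulus_sqr, Es. apply sqrt_lem_1.
      - rewrite <- compl_modulus_sqr, <- Es. left.
        apply dn_radicand_pos, compl_modulus_bounds.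
      - apply Rdiv_le_0_compat; lra.
      - transitivity (modw k w ^ 2 / (1 + w ^ 2) ^ 2); [field; lra |].
        rewrite modw_sqr. field. lra. }
    rewrite E. unfold Rsqr. pose proof (modw_pos w). field. split; nra.
Qed.

Lemma ellT_0 : ellT k 0 = 0.
Proof. unfold ellT. rewrite atan_0. apply ellF_0. Qed.

(** The Lipschitz bound on [ellF] for the complementary modulus converts PI/2 - atan x <= 1/x into
    an error of order 1/n. *)
Lemma ellT_limit : is_lim_seq (fun n => ellT k (INR n + 1)) (ellK' k).
Proof.
  set (C := / sqrt (1 - sqrt (1 - k ^ 2) ^ 2)).
  assert (HC : 0 < C).
  { apply Rinv_0_lt_compat, sqrt_lt_R0. pose proof compl_modulus_sqr. nra. }
  apply is_lim_seq_le_le with (fun n => ellK' k - C * / (INR n + 1)) (fun n => ellK' k).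
  - intros n. assert (Hn : 0 < INR n + 1) by (pose proof (pos_INR n); lra).
    destruct (PI2_minus_atan_bounds _ Hn) as [Hu Hl].
    unfold ellT. change (ellK' k) with (ellF (sqrt (1 - k ^ 2)) (PI / 2)).
    pose proof (ellF_le _ compl_modulus_bounds (atan (INR n + 1)) (PI / 2)) as HL.
    fold C in HL. split.
    + assert (C * (PI / 2 - atan (INR n + 1)) <= C * / (INR n + 1)) by (apply Rmult_le_compat_l; lra).
      lra.
    + left. apply ellF_increasing; [apply compl_modulus_bounds |]. apply atan_bound.
  - replace (ellK' k) with (ellK' k - C * 0) at 1 by ring.
    apply is_lim_seq_minus'; [apply is_lim_seq_const |].
    apply (is_lim_seq_scal_l _ C 0).
    replace (Finite 0) with (Rbar_inv p_infty) by reflexivity.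
    apply is_lim_seq_inv; [| easy].
    apply (is_lim_seq_ext (fun n => INR (S n))); [intros; now rewrite S_INR |].
    apply -> is_lim_seq_incr_1. apply is_lim_seq_INR.
  - apply is_lim_seq_const.
Qed.

(* [B' = B1 / modw] and [B1' = l^2 B / modw] say that [B] solves
   [B'' = l^2 B] with respect to [tau = ellT k w]. *)
Lemma hyperbolic_ode (l w : R) (B B1 : R -> R) :
  (forall x, is_derive B x (B1 x / modw k x)) ->
  (forall x, is_derive B1 x (l ^ 2 * B x / modw k x)) -> 0 <= w ->
  B1 w + l * B w = exp (l * ellT k w) * (B1 0 + l * B 0).
Proof.
  intros HB HB1 Hw.
  (* The operator d^2 - l^2 factors as (d - l)(d + l) in tau, so B1 + l B solves a first-order
     equation and becomes constant after multiplication by exp (- l tau). *)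
  assert (E : (B1 0 + l * B 0) * exp (- l * ellT k 0) = (B1 w + l * B w) * exp (- l * ellT k w)).
  { apply (eq_of_derive_zero (fun x => (B1 x + l * B x) * exp (- l * ellT k x)) 0 w Hw).
    intros x _. pose proof (modw_pos x).
    auto_derive.
    - repeat split; eexists; [apply HB1 | apply HB | apply is_derive_ellT].
    - subst_Derive (HB1 x). subst_Derive (HB x). subst_Derive (is_derive_ellT x).
      field. lra. }
  rewrite ellT_0, Rmult_0_r, exp_0, Rmult_1_r in E. rewrite E.
  replace (exp (l * ellT k w) * _)
    with ((exp (l * ellT k w) * exp (- l * ellT k w)) * (B1 w + l * B w)) by ring.
  rewrite <- exp_plus. replace (l * ellT k w + - l * ellT k w) with 0 by ring.
  rewrite exp_0. ring.
Qed.

(* The equation is invariant under [l := - l]; this adds or subtracts the two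
   resulting identities. *)
Lemma hyperbolic_ode_sinh (l w : R) (B B1 : R -> R) :
  (forall x, is_derive B x (B1 x / modw k x)) ->
  (forall x, is_derive B1 x (l ^ 2 * B x / modw k x)) -> 0 <= w ->
  (B 0 = 0 -> l * B w = B1 0 * sinh (l * ellT k w)) /\
  (B1 0 = 0 -> B1 w = l * B 0 * sinh (l * ellT k w)).
Proof.
  intros HB HB1 Hw.
  pose proof (hyperbolic_ode l w B B1 HB HB1 Hw) as E1.
  assert (E2 : B1 w + - l * B w = exp (- l * ellT k w) * (B1 0 + - l * B 0)).
  { apply hyperbolic_ode; auto. intros x. evar_last; [apply HB1 |].
    unfold Rdiv. ring. }
  unfold sinh. rewrite Ropp_mult_distr_l in *.
  split; intros H0; rewrite H0 in *; lra.
Qed.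

End ImaginaryDirection.

Lemma one_plus_sqr_pos (x : R) : 0 < 1 + x ^ 2.
Proof. nra. Qed.

Lemma one_plus_sqr_neq_0 (x : R) : 1 + x ^ 2 <> 0.
Proof. nra. Qed.

#[global] Hint Resolve one_plus_sqr_neq_0 : core.

(** * The arctangent potential and the Fourier coefficients of sn *)

Section HarmonicFunctions.

Variables k l : R.
Hypothesis hk : 0 < k < 1.

(* [dn] times the [y]-derivative of [atan (k sin y w)]. That its derivative cancels
   the second [tau]-derivative of the arctangent expresses the harmonicity of
   [atan (k sn(t, k) sc(tau, k'))] in [(t, tau)]. *)
Definition atan_flux (w y : R) : R := k * w * cos y * dn k y / (1 + (k * sin y * w) ^ 2).

(** The two polynomial coefficients are [modw] times its derivative and [modw ^ 2]: they come from
    d/dtau = [modw] d/dw applied twice to the arctangent. *)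
Definition atan_flux' (w y : R) : R :=
  - (k * sin y * (w * (1 + k ^ 2 * w ^ 2) + k ^ 2 * w * (1 + w ^ 2)) / (1 + (k * sin y * w) ^ 2)
     - 2 * (1 + w ^ 2) * (1 + k ^ 2 * w ^ 2) * (k * sin y) ^ 3 * w / (1 + (k * sin y * w) ^ 2) ^ 2)
  / dn k y.

Lemma is_derive_atan_flux (w y : R) : is_derive (atan_flux w) y (atan_flux' w y).
Proof.
  unfold atan_flux, atan_flux'.
  pose proof (one_plus_sqr_pos (k * sin y * w)) as Hq. pose proof (dn_pos k hk y) as Hd.
  pose proof (dn_sqr k hk y) as Ed.
  pose proof (cos_sqr y) as Es.
  auto_derive.
  - split; [eexists; apply (is_derive_dn k hk y) | split; [| easy]].
    unfold Rdiv in *. ring_simplify in Hq. nra.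
  - subst_Derive (is_derive_dn k hk y).
    generalize dependent (dn k y). generalize dependent (sin y). generalize dependent (cos y).
    intros c s Hq Ec d Hd Ed.
    transitivity (k * w * (- s * d ^ 2 * (1 + (k * s * w) ^ 2) - k ^ 2 * s * c ^ 2 * (1 + (k * s * w) ^ 2)
                  - 2 * k ^ 2 * s * c ^ 2 * d ^ 2 * w ^ 2) / ((1 + (k * s * w) ^ 2) ^ 2 * d)).
    + field. split; nra.
    + rewrite Ed, Ec. field. split; nra.
Qed.

(** The factor [/ dn] is dt/dy, so integrals against these two weights over [0, PI/2] are integrals
    against sin (l t) and cos (l t) over [0, K]. *)
Definition sn_weight (y : R) : R := sin (l * ellF k y) / dn k y.
Definition cn_weight (y : R) : R := cos (l * ellF k y) / dn k y.

Lemma continuous_sn_weight (y : R) : continuous sn_weight y.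
Proof. unfold sn_weight. cont1. Qed.

Lemma continuous_cn_weight (y : R) : continuous cn_weight y.
Proof. unfold cn_weight. cont1. Qed.

Hint Resolve continuous_sn_weight continuous_cn_weight : core.

Definition atan_int (w : R) : R :=
  RInt (fun y => sn_weight y * atan (k * sin y * w)) 0 (PI / 2).
Definition atan_int1 (w : R) : R :=
  RInt (fun y => sn_weight y * (k * sin y / (1 + (k * sin y * w) ^ 2))) 0 (PI / 2).
Definition atan_int2 (w : R) : R :=
  RInt (fun y => sn_weight y * (- (2 * (k * sin y) ^ 3 * w) / (1 + (k * sin y * w) ^ 2) ^ 2))
    0 (PI / 2).

Lemma is_derive_atan_int (w : R) : is_derive atan_int w (atan_int1 w).
Proof.
  apply (is_derive_RInt_param_all
    (fun w y => sn_weight y * atan (k * sin y * w))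
    (fun w y => sn_weight y * (k * sin y / (1 + (k * sin y * w) ^ 2)))).
  - intros u y. auto_derive; auto. unfold Rsqr. field. pose proof (one_plus_sqr_pos (k * sin y * u)). nra.
  - intros y. cont2.
  - intros u y. cont1.
Qed.

Lemma is_derive_atan_int1 (w : R) : is_derive atan_int1 w (atan_int2 w).
Proof.
  apply (is_derive_RInt_param_all
    (fun w y => sn_weight y * (k * sin y / (1 + (k * sin y * w) ^ 2)))
    (fun w y => sn_weight y * (- (2 * (k * sin y) ^ 3 * w) / (1 + (k * sin y * w) ^ 2) ^ 2))).
  - intros u y. pose proof (one_plus_sqr_pos (k * sin y * u)).
    auto_derive; [|field]; nra.
  - intros y. cont2. now apply pow_nonzero.
  - intros u y. cont1.
Qed.
(** Harmonicity trades the two tau-derivatives for two t-derivatives, and two integrations by parts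
    move these onto sin (l t). No boundary term survives: at t = 0 both the sine and the arctangent
    vanish, and at t = K the flux contains cos (PI/2), while cos (l K) = 0 by hypothesis. *)
Lemma atan_int_equation (w : R) : cos (l * ellK k) = 0 ->
  (w * (1 + k ^ 2 * w ^ 2) + k ^ 2 * w * (1 + w ^ 2)) * atan_int1 w
  + (1 + w ^ 2) * (1 + k ^ 2 * w ^ 2) * atan_int2 w = l ^ 2 * atan_int w.
Proof.
  intros Hl.
  set (G := atan_flux w). set (G' := atan_flux' w).
  set (A' := fun y => k * w * cos y / (1 + (k * sin y * w) ^ 2)).
  assert (HG' : forall y, continuous G' y).
  { intros y. unfold G', atan_flux'. cont1. now apply pow_nonzero. }
  assert (HA' : forall y, continuous A' y) by (intros y; unfold A'; cont1).
  transitivity (- RInt (fun y => G' y * sin (l * ellF k y)) 0 (PI / 2)).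
  { unfold atan_int1, atan_int2.
    rewrite <- !RInt_scal_all, <- RInt_plus_all, <- (RInt_opp (V := R_CompleteNormedModule)).
    - apply RInt_ext_all. intros y. unfold G', atan_flux', sn_weight. unfold opp; simpl.
      pose proof (one_plus_sqr_pos (k * sin y * w)). pose proof (dn_neq_0 k hk y).
      field. split; [nra | auto].
    - apply ex_RInt_continuous_all. intros y. cont1.
    - intros y. cont1.
    - intros y. cont1. now apply pow_nonzero.
    - intros y. cont1. now apply pow_nonzero.
    - intros y. cont1. }
  rewrite (RInt_by_parts_all G (fun y => sin (l * ellF k y)) G'
    (fun y => l * cos (l * ellF k y) / dn k y)); auto.
  2:{ intros y. apply is_derive_atan_flux. }
  2:{ intros y. now apply is_derive_sin_ellF. }
  2:{ intros y. cont1. }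
  rewrite (RInt_ext_all (fun y => G y * (l * cos (l * ellF k y) / dn k y))
     (fun y => l * (A' y * cos (l * ellF k y)))).
  2:{ intros y. unfold G, atan_flux, A'. pose proof (one_plus_sqr_pos (k * sin y * w)). pose proof (dn_neq_0 k hk y).
      field. split; [nra | auto]. }
  rewrite RInt_scal_all by (intros y; cont1).
  rewrite (RInt_by_parts_all (fun y => atan (k * sin y * w)) (fun y => cos (l * ellF k y)) A'
    (fun y => - l * sin (l * ellF k y) / dn k y)); auto.
  2:{ intros y. unfold A'. auto_derive; auto. unfold Rsqr. field.
      pose proof (one_plus_sqr_pos (k * sin y * w)). nra. }
  2:{ intros y. now apply is_derive_cos_ellF. }
  2:{ intros y. cont1. }
  unfold atan_int.
  rewrite (RInt_ext_all (fun y => atan (k * sin y * w) * (- l * sin (l * ellF k y) / dn k y))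
     (fun y => - l * (sn_weight y * atan (k * sin y * w)))).
  2:{ intros y. unfold sn_weight. field. now apply dn_neq_0. }
  rewrite RInt_scal_all by (intros y; cont1).
  unfold G, atan_flux. rewrite ellF_PI2, ellF_0, Hl, cos_PI2, sin_0, !Rmult_0_r, !Rmult_0_l, atan_0, sin_0.
  unfold Rdiv. rring.
Qed.

(** The bound PI/2 - atan x <= 1/x is useless near y = 0, where x = k sin y w is small. A weight of
    size at most C sin y compensates exactly, and the error is of order 1/w uniformly in [y]. *)
Lemma atan_limit_bound (h : R -> R) (C w : R) :
  (forall y, continuous h y) -> (forall y, 0 <= y <= PI / 2 -> Rabs (h y) <= C * sin y) ->
  0 <= C -> 0 < w ->
  Rabs (RInt (fun y => h y * atan (k * sin y * w)) 0 (PI / 2) - PI / 2 * RInt h 0 (PI / 2))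
  <= (PI / 2 - 0) * (C / k * / w).
Proof.
  intros Hh HC HC0 Hw. pose proof PI_RGT_0.
  rewrite <- RInt_scal_all, <- RInt_minus_all; auto; try (intros y; cont1).
  apply abs_RInt_le_const_all; [lra | intros y; cont1 |].
  intros y Hy. specialize (HC y Hy).
  replace (h y * atan (k * sin y * w) - PI / 2 * h y)
    with (- (h y * (PI / 2 - atan (k * sin y * w)))) by ring.
  rewrite Rabs_Ropp, Rabs_mult.
  assert (Hs : 0 <= sin y) by (apply sin_ge_0; lra).
  destruct Hs as [Hs | Hs].
  - assert (Hx : 0 < k * sin y * w) by (repeat apply Rmult_lt_0_compat; lra).
    destruct (PI2_minus_atan_bounds _ Hx) as [H1 H2].
    rewrite (Rabs_right (PI / 2 - _)) by lra.
    apply Rle_trans with (C * sin y * / (k * sin y * w)).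
    + apply Rmult_le_compat; auto. apply Rabs_pos.
    + right. field. lra.
  (* Where sin y = 0, the bound on [h] forces [h y = 0]. *)
  - rewrite <- Hs, Rmult_0_r in HC. pose proof (Rabs_pos (h y)).
    replace (Rabs (h y)) with 0 by lra. rewrite Rmult_0_l.
    apply Rmult_le_pos; [apply Rdiv_le_0_compat; lra |]. left. now apply Rinv_0_lt_compat.
Qed.

End HarmonicFunctions.

#[global] Hint Resolve continuous_sn_weight continuous_cn_weight : core.

Lemma is_lim_seq_inv_succ (C : R) : is_lim_seq (fun n => C * / (INR n + 1)) 0.
Proof.
  replace (Finite 0) with (Rbar_mult C 0) by (simpl; f_equal; ring).
  apply is_lim_seq_scal_l.
  replace (Finite 0) with (Rbar_inv p_infty) by reflexivity.
  apply is_lim_seq_inv; [| easy].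
  apply (is_lim_seq_ext (fun n => INR (S n))); [intros; now rewrite S_INR |].
  apply -> is_lim_seq_incr_1. apply is_lim_seq_INR.
Qed.

Lemma is_lim_seq_of_inv_bound (B : R -> R) (L C : R) :
  (forall w, 0 < w -> Rabs (B w - L) <= C * / w) ->
  is_lim_seq (fun n => B (INR n + 1)) L.
Proof.
  intros H.
  apply is_lim_seq_le_le with (fun n => L - C * / (INR n + 1)) (fun n => L + C * / (INR n + 1)).
  - intros n. specialize (H (INR n + 1)). pose proof (pos_INR n).
    assert (Hn : 0 < INR n + 1) by lra. apply H in Hn. apply Rabs_le_between in Hn. lra.
  - replace (Finite L) with (Finite (L - 0)) by (f_equal; ring).
    apply is_lim_seq_minus'; [apply is_lim_seq_const | apply is_lim_seq_inv_succ].
  - replace (Finite L) with (Finite (L + 0)) by (f_equal; ring).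
    apply is_lim_seq_plus'; [apply is_lim_seq_const | apply is_lim_seq_inv_succ].
Qed.

Lemma Rabs_sin_le (x : R) : 0 <= x -> Rabs (sin x) <= x.
Proof.
  intros [Hx | <-].
  - apply Rabs_le. split; [| left; now apply sin_lt_x].
    assert (0 + sin 0 <= x + sin x); [| rewrite sin_0 in *; lra].
    apply (le_of_derive_nonneg (fun x => x + sin x) (fun x => 1 + cos x)); [lra | |].
    + intros y _. auto_derive; auto. ring.
    + intros y _. pose proof (COS_bound y). lra.
  - rewrite sin_0, Rabs_R0. lra.
Qed.

Section FourierCoefficients.

Variables k l : R.
Hypothesis hk : 0 < k < 1.
Hypothesis hl : 0 < l.

Let C1 : R := / sqrt (1 - k ^ 2).

Lemma inv_sqrt_compl_pos : 0 < C1.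
Proof. apply Rinv_0_lt_compat, sqrt_lt_R0. nra. Qed.

Lemma Rabs_sin_ellF_le (y : R) : 0 <= y <= PI / 2 ->
  Rabs (sin (l * ellF k y)) <= 3 * l * C1 * sin y.
Proof.
  intros Hy. pose proof inv_sqrt_compl_pos.
  pose proof (ellF_bounds k hk y Hy) as [HF _].
  pose proof (ellF_le k hk 0 y (proj1 Hy)) as HF'. fold C1 in HF'.
  rewrite ellF_0, !Rminus_0_r in HF'.
  pose proof (le_three_sin y Hy).
  apply Rle_trans with (l * ellF k y).
  - apply Rabs_sin_le. apply Rmult_le_pos; lra.
  - apply Rle_trans with (l * (C1 * (3 * sin y))); [| right; ring].
    apply Rmult_le_compat_l; [lra |]. apply Rle_trans with (1 := HF').
    apply Rmult_le_compat_l; lra.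
Qed.

Lemma inv_dn_bounds (y : R) : 0 < / dn k y <= C1.
Proof. split; [apply Rinv_0_lt_compat, dn_pos; auto | now apply inv_dn_le]. Qed.

Lemma sn_weight_le (y : R) : 0 <= y <= PI / 2 ->
  Rabs (sn_weight k l y) <= 3 * l * C1 * C1 * sin y.
Proof.
  intros Hy. unfold sn_weight, Rdiv. rewrite Rabs_mult.
  pose proof (inv_dn_bounds y). rewrite (Rabs_right (/ _)) by lra.
  replace (3 * l * C1 * C1 * sin y) with (3 * l * C1 * sin y * C1) by ring.
  apply Rmult_le_compat; try lra; [apply Rabs_pos | now apply Rabs_sin_ellF_le].
Qed.

Lemma RInt_sn_weight :
  RInt (sn_weight k l) 0 (PI / 2) = (1 - cos (l * ellK k)) / l.
Proof.
  rewrite (RInt_antiderivative (fun y => (1 - cos (l * ellF k y)) / l)).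
  - rewrite ellF_PI2, ellF_0, Rmult_0_r, cos_0. onR. field. lra.
  - intros y. pose proof (dn_neq_0 k hk y).
    auto_derive; [eexists; now apply is_derive_ellF |].
    subst_Derive (is_derive_ellF k hk y). unfold sn_weight. field. split; auto; lra.
  - intros y. now apply continuous_sn_weight.
Qed.

Lemma RInt_cn_weight : RInt (cn_weight k l) 0 (PI / 2) = sin (l * ellK k) / l.
Proof.
  rewrite (RInt_antiderivative (fun y => sin (l * ellF k y) / l)).
  - rewrite ellF_PI2, ellF_0, Rmult_0_r, sin_0. onR. field. lra.
  - intros y. pose proof (dn_neq_0 k hk y).
    auto_derive; [eexists; now apply is_derive_ellF |].
    subst_Derive (is_derive_ellF k hk y). unfold cn_weight. field. split; auto; lra.
  - intros y. now apply continuous_cn_weight.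
Qed.

Lemma sn_fourier_coefficient : cos (l * ellK k) = 0 ->
  2 * k * sinh (l * ellK' k) * RInt (fun y => sn_weight k l y * sin y) 0 (PI / 2) = PI.
Proof.
  intros Hl.
  set (M := RInt (fun y => sn_weight k l y * sin y) 0 (PI / 2)).
  assert (E : forall w, 0 <= w -> l * atan_int k l w = k * M * sinh (l * ellT k w)).
  { intros w Hw.
    pose proof (hyperbolic_ode_sinh k hk l w (atan_int k l) (fun w => modw k w * atan_int1 k l w)) as H.
    replace (k * M) with (modw k 0 * atan_int1 k l 0).
    - apply H; auto.
      + intros x. evar_last; [now apply is_derive_atan_int |].
        field. pose proof (modw_pos k x). lra.
      + intros x. pose proof (modw_pos k x). evar_last.
        * apply (is_derive_mult (K := R_AbsRing) (modw k) (atan_int1 k l)).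
          -- apply is_derive_modw.
          -- now apply is_derive_atan_int1.
          -- intros; apply Rmult_comm.
        * rewrite <- (atan_int_equation k l hk x Hl). unfold plus, mult; simpl.
          onR. pose proof (modw_sqr k x) as Em.
          apply Rmult_eq_reg_r with (modw k x); [| lra].
          field_simplify; [| lra | lra]. rewrite Em. ring.
      + unfold atan_int. rewrite (RInt_ext_all _ (fun _ => 0)).
        * rewrite RInt_const. scalR. apply Rmult_0_r.
        * intros y. rewrite Rmult_0_r, atan_0. ring.
    - rewrite modw_0. unfold atan_int1, M. rewrite Rmult_1_l, <- RInt_scal_all by (intros y; cont1).
      apply RInt_ext_all. intros y. field. }
  (* The arctangent tends to PI/2, and the sine integrates to (1 - cos (l K)) / l = 1 / l. *)
  assert (L1 : is_lim_seq (fun n => l * atan_int k l (INR n + 1)) (PI / 2)).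
  { replace (Finite (PI / 2)) with (Rbar_mult l (PI / 2 * ((1 - cos (l * ellK k)) / l))).
    2:{ simpl. f_equal. rewrite Hl. field. lra. }
    apply is_lim_seq_scal_l. rewrite <- RInt_sn_weight.
    apply is_lim_seq_of_inv_bound with ((PI / 2 - 0) * (3 * l * C1 * C1 / k)).
    intros w Hw. rewrite Rmult_assoc. apply atan_limit_bound; auto.
    - apply sn_weight_le.
    - pose proof inv_sqrt_compl_pos. repeat apply Rmult_le_pos; lra. }
  assert (L2 : is_lim_seq (fun n => l * atan_int k l (INR n + 1)) (k * M * sinh (l * ellK' k))).
  { apply is_lim_seq_ext with (fun n => k * M * sinh (l * ellT k (INR n + 1))).
    - intros n. symmetry. apply E. pose proof (pos_INR n). lra.
    - apply (is_lim_seq_continuous (fun T => k * M * sinh (l * T))).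
      + apply continuity_pt_of_continuous. unfold sinh. cont1.
      + now apply ellT_limit. }
  apply is_lim_seq_unique in L1. apply is_lim_seq_unique in L2.
  rewrite L1 in L2. injection L2. intros L. rewrite Rmult_assoc in L. lra.
Qed.

End FourierCoefficients.

(** * The logarithmic potential and the Fourier coefficients of sn^2 *)

Section LogPotential.

Variables k l : R.
Hypothesis hk : 0 < k < 1.
Hypothesis hl : 0 < l.

Lemma ln_radicand_pos (w y : R) : 0 < 1 + (k * sin y * w) ^ 2.
Proof. apply one_plus_sqr_pos. Qed.

(* [dn] times the [y]-derivative of [ln (1 + (k sin y w)^2)], whose Laplacian in
   [(t, tau)] is [2 k^2 (sn(t, k)^2 + sc(tau, k')^2)]. *)
Definition log_flux (w y : R) : R :=
  2 * k ^ 2 * w ^ 2 * sin y * cos y * dn k y / (1 + (k * sin y * w) ^ 2).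

Definition log_flux' (w y : R) : R :=
  (2 * k ^ 2 * sin y ^ 2 + 2 * k ^ 2 * w ^ 2
   - ((w * (1 + k ^ 2 * w ^ 2) + k ^ 2 * w * (1 + w ^ 2))
        * (2 * (k * sin y) ^ 2 * w / (1 + (k * sin y * w) ^ 2))
      + (1 + w ^ 2) * (1 + k ^ 2 * w ^ 2)
        * (2 * (k * sin y) ^ 2 / (1 + (k * sin y * w) ^ 2)
           - 4 * (k * sin y) ^ 4 * w ^ 2 / (1 + (k * sin y * w) ^ 2) ^ 2))) / dn k y.

Lemma is_derive_log_flux (w y : R) : is_derive (log_flux w) y (log_flux' w y).
Proof.
  unfold log_flux, log_flux'.
  pose proof (one_plus_sqr_pos (k * sin y * w)) as Hq. pose proof (dn_pos k hk y) as Hd.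
  pose proof (dn_sqr k hk y) as Ed.
  pose proof (cos_sqr y) as Es.
  auto_derive.
  - split; [eexists; apply (is_derive_dn k hk y) | split; [| easy]].
    unfold Rdiv in *. ring_simplify in Hq. nra.
  - subst_Derive (is_derive_dn k hk y).
    generalize dependent (dn k y). generalize dependent (sin y). generalize dependent (cos y).
    intros c s Hq Ec d Hd Ed.
    transitivity (2 * k ^ 2 * w ^ 2 * ((c ^ 2 - s ^ 2) * d ^ 2 * (1 + (k * s * w) ^ 2)
        - k ^ 2 * s ^ 2 * c ^ 2 * (1 + (k * s * w) ^ 2)
        - 2 * k ^ 2 * w ^ 2 * s ^ 2 * c ^ 2 * d ^ 2) / ((1 + (k * s * w) ^ 2) ^ 2 * d)).
    + field. split; nra.
    + rewrite Ed, Ec. field. split; nra.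
Qed.

Definition log_int (w : R) : R :=
  RInt (fun y => cn_weight k l y * ln (1 + (k * sin y * w) ^ 2)) 0 (PI / 2).
Definition log_int1 (w : R) : R :=
  RInt (fun y => cn_weight k l y * (2 * (k * sin y) ^ 2 * w / (1 + (k * sin y * w) ^ 2))) 0 (PI / 2).
Definition log_int2 (w : R) : R :=
  RInt (fun y => cn_weight k l y * (2 * (k * sin y) ^ 2 / (1 + (k * sin y * w) ^ 2)
              - 4 * (k * sin y) ^ 4 * w ^ 2 / (1 + (k * sin y * w) ^ 2) ^ 2)) 0 (PI / 2).

Lemma continuous_ln_one_plus (w y : R) : continuous (fun y => ln (1 + (k * sin y * w) ^ 2)) y.
Proof.
  pose proof (ln_radicand_pos w y). apply (continuous_comp _ ln); [cont1 |].
  apply continuous_ex_derive.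
  auto_derive. auto.
Qed.
Hint Resolve continuous_ln_one_plus : core.

Lemma is_derive_log_int (w : R) : is_derive log_int w (log_int1 w).
Proof.
  apply (is_derive_RInt_param_all
    (fun w y => cn_weight k l y * ln (1 + (k * sin y * w) ^ 2))
    (fun w y => cn_weight k l y * (2 * (k * sin y) ^ 2 * w / (1 + (k * sin y * w) ^ 2)))).
  - intros u y. pose proof (ln_radicand_pos u y). auto_derive; [nra |]. field. nra.
  - intros y. cont2.
  - intros u y. cont1.
Qed.

Lemma is_derive_log_int1 (w : R) : is_derive log_int1 w (log_int2 w).
Proof.
  apply (is_derive_RInt_param_all
    (fun w y => cn_weight k l y * (2 * (k * sin y) ^ 2 * w / (1 + (k * sin y * w) ^ 2)))
    (fun w y => cn_weight k l y * (2 * (k * sin y) ^ 2 / (1 + (k * sin y * w) ^ 2)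
              - 4 * (k * sin y) ^ 4 * w ^ 2 / (1 + (k * sin y * w) ^ 2) ^ 2))).
  - intros u y. pose proof (ln_radicand_pos u y). auto_derive; [|field]; nra.
  - intros y. cont2. now apply pow_nonzero.
  - intros u y. cont1.
Qed.

(** Green's formula as for the arctangent, now with a source. The part of the source proportional to
    w^2 pairs with cos (l t) to zero because sin (l K) = 0, so what remains does not depend on [w],
    and it carries the coefficient that is sought. *)
Lemma log_int_equation (w : R) : sin (l * ellK k) = 0 ->
  (w * (1 + k ^ 2 * w ^ 2) + k ^ 2 * w * (1 + w ^ 2)) * log_int1 w
  + (1 + w ^ 2) * (1 + k ^ 2 * w ^ 2) * log_int2 w
  = l ^ 2 * log_int w + 2 * k ^ 2 * RInt (fun y => cn_weight k l y * sin y ^ 2) 0 (PI / 2).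
Proof.
  intros Hl.
  set (G := log_flux w). set (G' := log_flux' w).
  set (A' := fun y => 2 * k ^ 2 * w ^ 2 * sin y * cos y / (1 + (k * sin y * w) ^ 2)).
  assert (HG' : forall y, continuous G' y).
  { intros y. unfold G', log_flux'. cont1. now apply pow_nonzero. }
  assert (HA' : forall y, continuous A' y) by (intros y; unfold A'; cont1).
  assert (E : (w * (1 + k ^ 2 * w ^ 2) + k ^ 2 * w * (1 + w ^ 2)) * log_int1 w
    + (1 + w ^ 2) * (1 + k ^ 2 * w ^ 2) * log_int2 w
    = 2 * k ^ 2 * RInt (fun y => cn_weight k l y * sin y ^ 2) 0 (PI / 2)
      + 2 * k ^ 2 * w ^ 2 * RInt (cn_weight k l) 0 (PI / 2)
      - RInt (fun y => G' y * cos (l * ellF k y)) 0 (PI / 2)).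
  { unfold log_int1, log_int2.
    rewrite <- !RInt_scal_all, <- !RInt_plus_all, <- RInt_minus_all;
      auto; try (intros y; cont1; try now apply pow_nonzero).
    apply RInt_ext_all. intros y. unfold G', log_flux', cn_weight.
    pose proof (one_plus_sqr_pos (k * sin y * w)). pose proof (dn_neq_0 k hk y).
    field. split; [nra | auto]. }
  rewrite E, (RInt_cn_weight k l hk hl), Hl.
  rewrite (RInt_by_parts_all G (fun y => cos (l * ellF k y)) G'
    (fun y => - l * sin (l * ellF k y) / dn k y)); auto.
  2:{ intros y. apply is_derive_log_flux. }
  2:{ intros y. now apply is_derive_cos_ellF. }
  2:{ intros y. cont1. }
  rewrite (RInt_ext_all (fun y => G y * (- l * sin (l * ellF k y) / dn k y))
     (fun y => - l * (A' y * sin (l * ellF k y)))).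
  2:{ intros y. unfold G, log_flux, A'. pose proof (one_plus_sqr_pos (k * sin y * w)).
      pose proof (dn_neq_0 k hk y). field. split; [nra | auto]. }
  rewrite RInt_scal_all by (intros y; cont1).
  rewrite (RInt_by_parts_all (fun y => ln (1 + (k * sin y * w) ^ 2)) (fun y => sin (l * ellF k y)) A'
    (fun y => l * cos (l * ellF k y) / dn k y)); auto.
  2:{ intros y. unfold A'. pose proof (one_plus_sqr_pos (k * sin y * w)).
      auto_derive; [nra |]. field. nra. }
  2:{ intros y. now apply is_derive_sin_ellF. }
  2:{ intros y. cont1. }
  unfold log_int.
  rewrite (RInt_ext_all (fun y => ln (1 + (k * sin y * w) ^ 2) * (l * cos (l * ellF k y) / dn k y))
     (fun y => l * (cn_weight k l y * ln (1 + (k * sin y * w) ^ 2)))).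
  2:{ intros y. unfold cn_weight. field. now apply dn_neq_0. }
  rewrite RInt_scal_all by (intros y; cont1).
  unfold G, log_flux. rewrite ellF_PI2, ellF_0, Hl, cos_PI2, sin_0, !Rmult_0_r, sin_0.
  unfold Rdiv. rring.
Qed.

End LogPotential.

Section FourierCoefficientsSquare.

Variables k l : R.
Hypothesis hk : 0 < k < 1.
Hypothesis hl : 0 < l.
Hypothesis Hl : sin (l * ellK k) = 0.

Let C1 : R := / sqrt (1 - k ^ 2).

(* As [w] tends to infinity the kernel [w / (1 + (k sn(t) w)^2)] concentrates at [t = 0]
   with mass [PI / (2 k)]. *)
Definition poisson_int (w : R) : R :=
  RInt (fun y => cn_weight k l y * (w / (1 + (k * sin y * w) ^ 2))) 0 (PI / 2).

(** With x = k sin y, the kernel x^2 w / (1 + x^2 w^2) equals 1/w minus w / (1 + x^2 w^2) divided by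
    w^2; the term constant in [y] integrates to zero against cos (l t) since sin (l K) = 0. *)
Lemma log_int1_poisson (w : R) : 0 < w -> log_int1 k l w = - (2 / w ^ 2) * poisson_int w.
Proof.
  intros Hw. unfold log_int1, poisson_int.
  transitivity (2 / w * RInt (cn_weight k l) 0 (PI / 2) - 2 / w ^ 2 *
    RInt (fun y => cn_weight k l y * (w / (1 + (k * sin y * w) ^ 2))) 0 (PI / 2)).
  - rewrite <- !RInt_scal_all, <- RInt_minus_all; try (intros y; cont1).
    apply RInt_ext_all. intros y. pose proof (one_plus_sqr_pos (k * sin y * w)). field.
    split; nra.
  - rewrite (RInt_cn_weight k l hk hl), Hl. rfield. lra.
Qed.

(** The factor cn dn turns the kernel into an exact derivative: times cos y, the kernel is the
    y-derivative of atan (k sin y w) divided by k. This function takes the value 1 at y = 0 and 0 at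
    PI/2, so the limit picks out the mass at 0. *)
Let cos_cn_dn (y : R) : R := cos (l * ellF k y) * cos y * dn k y.
Let cos_cn_dn' (y : R) : R :=
  - l * sin (l * ellF k y) * cos y
  - cos (l * ellF k y) * (sin y * dn k y + k ^ 2 * sin y * cos y ^ 2 / dn k y).

Lemma is_derive_cos_cn_dn (y : R) : is_derive cos_cn_dn y (cos_cn_dn' y).
Proof.
  unfold cos_cn_dn, cos_cn_dn'. pose proof (dn_neq_0 k hk y). auto_derive.
  - repeat split; auto; eexists; [now apply is_derive_ellF | now apply is_derive_dn].
  - subst_Derive (is_derive_ellF k hk y). subst_Derive (is_derive_dn k hk y). field. auto.
Qed.

Lemma continuous_cos_cn_dn' (y : R) : continuous cos_cn_dn' y.
Proof. unfold cos_cn_dn'. cont1. Qed.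
Hint Resolve continuous_cos_cn_dn' : core.

Lemma cos_cn_dn'_le (y : R) : 0 <= y <= PI / 2 -> Rabs (cos_cn_dn' y) <= (3 * l * l * C1 + 1 + C1) * sin y.
Proof.
  intros Hy. pose proof (Rabs_sin_ellF_le k l hk hl y Hy) as H1. fold C1 in H1.
  assert (Hs : 0 <= sin y) by (apply sin_ge_0; lra).
  pose proof (inv_dn_bounds k hk y) as Hd. fold C1 in Hd.
  pose proof (dn_le_1 k hk y). pose proof (dn_pos k hk y).
  assert (Hc : forall x, Rabs (cos x) <= 1) by (intros; apply Rabs_le, COS_bound).
  pose proof (inv_sqrt_compl_pos k hk) as HC. fold C1 in HC.
  unfold cos_cn_dn'. eapply Rle_trans; [apply Rabs_triang |]. rewrite Rabs_Ropp, !Rabs_mult, Rabs_Ropp.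
  rewrite (Rabs_right l) by lra.
  set (X := sin y * dn k y + k ^ 2 * sin y * cos y ^ 2 / dn k y).
  assert (HX : 0 <= X <= (1 + C1) * sin y).
  { unfold X, Rdiv. assert (0 <= k ^ 2 <= 1) by nra. assert (0 <= cos y ^ 2 <= 1).
    { pose proof (COS_bound y). nra. }
    assert (0 <= k ^ 2 * cos y ^ 2 <= 1) by nra.
    assert (0 <= k ^ 2 * cos y ^ 2 * / dn k y <= C1) by nra.
    replace (k ^ 2 * sin y * cos y ^ 2 * / dn k y) with (sin y * (k ^ 2 * cos y ^ 2 * / dn k y)) by ring.
    split; nra. }
  rewrite (Rabs_right X) by lra.
  pose proof (Hc y) as Hcy. pose proof (Hc (l * ellF k y)) as Hcl.
  pose proof (Rabs_pos (cos y)). pose proof (Rabs_pos (cos (l * ellF k y))).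
  pose proof (Rabs_pos (sin (l * ellF k y))).
  assert (l * Rabs (sin (l * ellF k y)) * Rabs (cos y) <= l * (3 * l * C1 * sin y)).
  { rewrite Rmult_assoc. apply Rmult_le_compat_l; [lra |]. nra. }
  assert (Rabs (cos (l * ellF k y)) * X <= (1 + C1) * sin y) by nra.
  lra.
Qed.

(** Split 1 = cn^2 dn^2 + (1 - cn^2 dn^2). The first part is integrated by parts against the
    arctangent; the derivative of [cos_cn_dn] is of size at most a multiple of sin y and has
    integral -1, which produces PI / (2 k) with error of order 1/w. The second part is of size at
    most 2 sin^2 y and removes the concentration altogether. *)
Lemma poisson_int_bound (w : R) : 0 < w ->
  Rabs (poisson_int w - PI / (2 * k))
  <= (PI / 2 * ((3 * l * l * C1 + 1 + C1) / k) / k + PI / 2 * (2 * C1 / k ^ 2)) * / w.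
Proof.
  intros Hw. pose proof PI_RGT_0. pose proof (inv_sqrt_compl_pos k hk) as HC. fold C1 in HC.
  set (A' := fun y => k * w * cos y / (1 + (k * sin y * w) ^ 2)).
  assert (HA' : forall y, continuous A' y) by (intros y; unfold A'; cont1).
  assert (cont_cn_dn : forall y, continuous cos_cn_dn y) by (intros y; eapply continuous_of_is_derive, is_derive_cos_cn_dn).
  set (R2 := fun y => cn_weight k l y * ((1 - cos y ^ 2 * dn k y ^ 2)
                * (w / (1 + (k * sin y * w) ^ 2)))).
  assert (cR2 : forall y, continuous R2 y) by (intros y; unfold R2; cont1).
  assert (E : poisson_int w = / k * RInt (fun y => A' y * cos_cn_dn y) 0 (PI / 2) + RInt R2 0 (PI / 2)).
  { unfold poisson_int. rewrite <- RInt_scal_all, <- RInt_plus_all; auto; try (intros y; cont1).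
    apply RInt_ext_all. intros y. unfold A', cos_cn_dn, R2, cn_weight.
    pose proof (one_plus_sqr_pos (k * sin y * w)). pose proof (dn_neq_0 k hk y).
    field. repeat split; auto; nra. }
  rewrite (RInt_by_parts_all (fun y => atan (k * sin y * w)) cos_cn_dn A' cos_cn_dn') in E; auto.
  2:{ intros y. unfold A'. auto_derive; auto. unfold Rsqr. field.
      pose proof (one_plus_sqr_pos (k * sin y * w)). nra. }
  2:{ apply is_derive_cos_cn_dn. }
  rewrite (RInt_ext_all (fun y => atan (k * sin y * w) * cos_cn_dn' y)
             (fun y => cos_cn_dn' y * atan (k * sin y * w))) in E by (intros; ring).
  assert (E' : RInt cos_cn_dn' 0 (PI / 2) = -1).
  { rewrite (RInt_antiderivative cos_cn_dn cos_cn_dn' _ _ is_derive_cos_cn_dn continuous_cos_cn_dn').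
    unfold cos_cn_dn, dn. rewrite ellF_0, cos_PI2, !Rmult_0_r, cos_0, sin_0.
    replace (1 - k ^ 2 * 0 ^ 2) with 1 by ring. rewrite sqrt_1. rring. }
  pose proof (atan_limit_bound k hk cos_cn_dn' _ w continuous_cos_cn_dn' cos_cn_dn'_le) as H1.
  rewrite E' in H1.
  assert (H1' : 0 <= 3 * l * l * C1 + 1 + C1).
  { assert (0 <= l * l * C1) by (repeat apply Rmult_le_pos; lra). lra. }
  specialize (H1 H1' Hw).
  assert (H2 : Rabs (RInt R2 0 (PI / 2)) <= (PI / 2 - 0) * (2 * C1 / k ^ 2 * / w)).
  { apply abs_RInt_le_const_all; [lra | auto |]. intros y Hy. unfold R2, cn_weight, Rdiv.
    pose proof (inv_dn_bounds k hk y) as Hd. fold C1 in Hd.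
    pose proof (dn_sqr k hk y) as Ed.
    pose proof (cos_sqr y) as Es.
    assert (Hs : 0 <= sin y ^ 2 <= 1) by (pose proof (SIN_bound y); split; nra).
    rewrite Ed, Es.
    replace (1 - (1 - sin y ^ 2) * (1 - k ^ 2 * sin y ^ 2))
      with (sin y ^ 2 * (1 + k ^ 2 - k ^ 2 * sin y ^ 2)) by ring.
    pose proof (one_plus_sqr_pos (k * sin y * w)) as Hq.
    assert (H3 : 0 <= sin y ^ 2 * (1 + k ^ 2 - k ^ 2 * sin y ^ 2) <= 2 * sin y ^ 2).
    { assert (0 < k ^ 2 < 1) by (split; nra).
      assert (0 <= 1 + k ^ 2 - k ^ 2 * sin y ^ 2 <= 2) by (split; nra). split; nra. }
    (* Dropping the 1 in the denominator cancels sin^2 y. *)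
    assert (H4 : 0 <= sin y ^ 2 * (w * / (1 + (k * sin y * w) ^ 2)) <= / k ^ 2 * / w).
    { split.
      - apply Rmult_le_pos; [lra |]. apply Rmult_le_pos; [lra |]. left. now apply Rinv_0_lt_compat.
      - apply Rmult_le_reg_r with (1 + (k * sin y * w) ^ 2); [lra |].
        apply Rmult_le_reg_r with (k ^ 2 * w); [apply Rmult_lt_0_compat; [nra | lra] |].
        field_simplify; [| lra | lra]. nra. }
    assert (Hv : 0 <= w * / (1 + (k * sin y * w) ^ 2)).
    { apply Rmult_le_pos; [lra |]. left. now apply Rinv_0_lt_compat. }
    rewrite Rabs_mult, (Rabs_mult (cos _)), (Rabs_right (/ dn k y)) by lra.
    rewrite (Rabs_right (_ * (w * _))) by (apply Rle_ge, Rmult_le_pos; lra).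
    assert (Hc : Rabs (cos (l * ellF k y)) <= 1) by apply Rabs_le, COS_bound.
    pose proof (Rabs_pos (cos (l * ellF k y))).
    apply Rle_trans with (1 * C1 * (2 * (/ k ^ 2 * / w))); [| right; field; lra].
    apply Rmult_le_compat; [apply Rmult_le_pos; lra | apply Rmult_le_pos; lra | | ].
    - apply Rmult_le_compat; lra.
    - nra. }
  assert (E3 : poisson_int w - PI / (2 * k) =
     - / k * (RInt (fun y => cos_cn_dn' y * atan (k * sin y * w)) 0 (PI / 2) - PI / 2 * -1) + RInt R2 0 (PI / 2)).
  { rewrite E. unfold cos_cn_dn. rewrite cos_PI2, sin_0, !Rmult_0_r, !Rmult_0_l, atan_0. rfield. lra. }
  rewrite E3. eapply Rle_trans; [apply Rabs_triang |].
  rewrite Rabs_mult, Rabs_Ropp, (Rabs_right (/ k)).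
  2:{ left. apply Rinv_0_lt_compat. lra. }
  assert (H5 : / k * Rabs (RInt (fun y => cos_cn_dn' y * atan (k * sin y * w)) 0 (PI / 2) - PI / 2 * -1)
    <= / k * ((PI / 2 - 0) * ((3 * l * l * C1 + 1 + C1) / k * / w))).
  { apply Rmult_le_compat_l; [| exact H1]. left. apply Rinv_0_lt_compat. lra. }
  eapply Rle_trans; [apply Rplus_le_compat; [exact H5 | exact H2] |].
  right. field. lra.
Qed.

Lemma modw_ratio_limit : is_lim_seq (fun n => modw k (INR n + 1) / (INR n + 1) ^ 2) k.
Proof.
  apply is_lim_seq_ext with
    (fun n => sqrt (((1 * / (INR n + 1)) ^ 2 + 1) * ((1 * / (INR n + 1)) ^ 2 + k ^ 2))).
  - intros n. pose proof (pos_INR n). pose proof (modw_pos k (INR n + 1)).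
    apply sqrt_lem_1.
    + apply Rmult_le_pos; nra.
    + apply Rdiv_le_0_compat; [lra |]. apply pow_lt. lra.
    + transitivity (modw k (INR n + 1) ^ 2 / (INR n + 1) ^ 4); [field; lra |].
      rewrite modw_sqr by auto. field. lra.
  - replace (Finite k) with (Finite (sqrt ((0 ^ 2 + 1) * (0 ^ 2 + k ^ 2)))).
    2:{ f_equal. replace ((0 ^ 2 + 1) * (0 ^ 2 + k ^ 2)) with (k ^ 2) by ring.
        apply sqrt_pow2. lra. }
    apply (is_lim_seq_continuous (fun v => sqrt ((v ^ 2 + 1) * (v ^ 2 + k ^ 2)))).
    + apply continuity_pt_of_continuous.
      apply continuous_ex_derive.
      auto_derive. nra.
    + apply is_lim_seq_inv_succ.
Qed.

(** Adding 2 k^2 N / l^2 to [log_int] absorbs the constant source. The shifted function has zero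
    derivative at w = 0, so its tau-derivative is a multiple of sinh. The comparison at infinity is
    made on this derivative because its limit is explicit: [modw k w] behaves like k w^2 and the
    Poisson integral tends to PI / (2 k), which gives -PI. The limit of [log_int] itself would
    involve the logarithm of sn. *)
Lemma sn_sqr_fourier_coefficient :
  2 * k ^ 2 * sinh (l * ellK' k) * RInt (fun y => cn_weight k l y * sin y ^ 2) 0 (PI / 2)
  = - PI * l.
Proof.
  set (N := RInt (fun y => cn_weight k l y * sin y ^ 2) 0 (PI / 2)).
  assert (E : forall w, 0 <= w ->
    modw k w * log_int1 k l w = 2 * k ^ 2 * N / l * sinh (l * ellT k w)).
  { intros w Hw.
    pose proof (hyperbolic_ode_sinh k hk l w (fun w => log_int k l w + 2 * k ^ 2 * N / l ^ 2)
      (fun w => modw k w * log_int1 k l w)) as H.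
    destruct H as [_ H]; auto.
    - intros x. evar_last.
      + apply (is_derive_plus (K := R_AbsRing) (V := R_NormedModule) (log_int k l) (fun _ => _)).
        * now apply is_derive_log_int.
        * apply @is_derive_const.
      + unfold plus, zero; simpl. onR. field. pose proof (modw_pos k x). lra.
    - intros x. pose proof (modw_pos k x). evar_last.
      + apply (is_derive_mult (K := R_AbsRing) (modw k) (log_int1 k l)).
        * now apply is_derive_modw.
        * now apply is_derive_log_int1.
        * intros; apply Rmult_comm.
      + pose proof (log_int_equation k l hk hl x Hl) as E0. fold N in E0.
        replace (l ^ 2 * (log_int k l x + 2 * k ^ 2 * N / l ^ 2))
          with (l ^ 2 * log_int k l x + 2 * k ^ 2 * N) by (field; lra).
        rewrite <- E0. unfold plus, mult; simpl.
        onR. pose proof (modw_sqr k x) as Em.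
        apply Rmult_eq_reg_r with (modw k x); [| lra].
        field_simplify; [| lra | lra]. rewrite Em. ring.
    - rewrite H.
      + unfold log_int at 1. rewrite (RInt_ext_all _ (fun _ => 0)).
        * rewrite RInt_const. scalR. field. lra.
        * intros y. rewrite Rmult_0_r, pow_i, Rplus_0_r, ln_1 by lia. ring.
      + unfold log_int1. rewrite (RInt_ext_all _ (fun _ => 0)).
        * rewrite RInt_const. scalR. ring.
        * intros y. unfold Rdiv. ring. }
  assert (L1 : is_lim_seq (fun n => modw k (INR n + 1) * log_int1 k l (INR n + 1)) (- PI)).
  { apply is_lim_seq_ext with
      (fun n => - 2 * (modw k (INR n + 1) / (INR n + 1) ^ 2 * poisson_int (INR n + 1))).
    - intros n. pose proof (pos_INR n). rewrite log_int1_poisson by lra. field. lra.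
    - replace (Finite (- PI)) with (Rbar_mult (-2) (k * (PI / (2 * k)))).
      2:{ simpl. f_equal. field. lra. }
      apply is_lim_seq_scal_l. apply is_lim_seq_mult'.
      + apply modw_ratio_limit.
      + eapply is_lim_seq_of_inv_bound. exact poisson_int_bound. }
  assert (L2 : is_lim_seq (fun n => modw k (INR n + 1) * log_int1 k l (INR n + 1))
                 (2 * k ^ 2 * N / l * sinh (l * ellK' k))).
  { apply is_lim_seq_ext with (fun n => 2 * k ^ 2 * N / l * sinh (l * ellT k (INR n + 1))).
    - intros n. symmetry. apply E. pose proof (pos_INR n). lra.
    - apply (is_lim_seq_continuous (fun T => 2 * k ^ 2 * N / l * sinh (l * T))).
      + apply continuity_pt_of_continuous. unfold sinh. cont1.
      + now apply ellT_limit. }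
  apply is_lim_seq_unique in L1. apply is_lim_seq_unique in L2.
  rewrite L1 in L2. injection L2. intros L. rewrite L. field. lra.
Qed.

End FourierCoefficientsSquare.

(** * Stieltjes-Carlitz polynomials *)

Lemma is_derive_sin_pow (p : nat) (y : R) : (1 <= p)%nat ->
  is_derive (fun y => sin y ^ p) y (INR p * sin y ^ (p - 1) * cos y).
Proof.
  intros Hp. auto_derive; auto. replace (Init.Nat.pred p) with (p - 1)%nat by lia. ring.
Qed.

Section SinePowers.

Variable k : R.
Hypothesis hk : 0 < k < 1.

(* [(sn^p)''] for the derivation [d/dt = dn d/dy]; the truncated exponent
   [p - 2] only occurs with coefficient zero. *)
Lemma is_derive_dn_sin_pow (p : nat) (y : R) : (1 <= p)%nat ->
  is_derive (fun y => INR p * sin y ^ (p - 1) * cos y * dn k y) y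
    ((INR p * (INR p - 1) * sin y ^ (p - 2) - (1 + k ^ 2) * INR p ^ 2 * sin y ^ p
      + k ^ 2 * INR p * (INR p + 1) * sin y ^ (p + 2)) / dn k y).
Proof.
  intros Hp. pose proof (dn_pos k hk y) as Hd. pose proof (dn_sqr k hk y) as Ed.
  pose proof (cos_sqr y) as Es.
  destruct p as [|[|r]]; [lia | |].
  - simpl (1 - 1)%nat. simpl (1 - 2)%nat. simpl (1 + 2)%nat. simpl INR.
    auto_derive; [eexists; now apply is_derive_dn |].
    subst_Derive (is_derive_dn k hk y).
    transitivity ((- sin y * dn k y ^ 2 - k ^ 2 * sin y * cos y ^ 2) / dn k y); [field; lra |].
    rewrite Ed, Es. field. lra.
  - replace (S (S r) - 1)%nat with (S r) by lia. replace (S (S r) - 2)%nat with r by lia.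
    replace (S (S r) + 2)%nat with (S (S (S (S r)))) by lia.
    auto_derive; [eexists; now apply is_derive_dn |].
    subst_Derive (is_derive_dn k hk y). simpl pred. rewrite !S_INR.
    simpl pow. generalize (sin y ^ r). intros a.
    transitivity ((INR r + 1 + 1) * a * ((INR r + 1) * cos y ^ 2 * dn k y ^ 2
       - sin y ^ 2 * dn k y ^ 2 - k ^ 2 * sin y ^ 2 * cos y ^ 2) / dn k y).
    + change (match r with O => 1 | S _ => INR r + 1 end) with (INR (S r)). rewrite ?S_INR.
      field. lra.
    + rewrite Ed, Es. field. lra.
Qed.

End SinePowers.

(* [p0 = 1] gives the polynomials f_n and [p0 = 2] gives g_n; the powers of sn
   involved have exponents [2 n + p0]. *)
Definition sc_gen (k : R) (p0 : nat) (x : R) (F : nat -> R) : Prop :=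
  F 0%nat = 1 /\ F 1%nat = x + (k ^ 2 + 1) * INR p0 ^ 2 /\
  forall n, let p := INR (2 * S n + p0) in
    F (S (S n)) = (x + (k ^ 2 + 1) * p ^ 2) * F (S n)
                  - k ^ 2 * (p - 2) * (p - 1) ^ 2 * p * F n.

Lemma sc_gen_f (k x : R) : sc_gen k 1 x (fun n => sc_f k n x).
Proof.
  split; [reflexivity | split].
  - simpl. ring.
  - intros n p. cbn [sc_f]. unfold p. rewrite !S_INR, plus_INR, mult_INR, !S_INR. simpl INR.
    set (A := sc_f k n x). set (B := match n with O => 0 | S r => sc_f k r x end). ring.
Qed.

Lemma sc_gen_g (k x : R) : sc_gen k 2 x (fun n => sc_g k n x).
Proof.
  split; [reflexivity | split].
  - simpl. ring.
  - intros n p. cbn [sc_g]. unfold p. rewrite !S_INR, plus_INR, mult_INR, !S_INR. simpl INR.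
    set (A := sc_g k n x). set (B := match n with O => 0 | S r => sc_g k r x end). ring.
Qed.

Lemma nat_ind2 (P : nat -> Prop) :
  P 0%nat -> P 1%nat -> (forall n, P n -> P (S n) -> P (S (S n))) -> forall n, P n.
Proof.
  intros H0 H1 H. assert (G : forall n, P n /\ P (S n)); [| intros n; apply G].
  induction n as [|n [IH1 IH2]]; auto.
Qed.

(** * Moments of powers of sn against sines and cosines *)

Section Moments.

Variables (k l : R) (p0 : nat) (F : nat -> R) (Cf Cf1 : R -> R).
Hypothesis hk : 0 < k < 1.
Hypothesis hp0 : p0 = 1%nat \/ p0 = 2%nat.
Hypothesis hF : sc_gen k p0 (- l ^ 2) F.
Hypothesis hCf : forall y, is_derive Cf y (Cf1 y / dn k y).
Hypothesis hCf1 : forall y, is_derive Cf1 y (- l ^ 2 * Cf y / dn k y).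
Hypothesis hCf1_PI2 : Cf1 (PI / 2) = 0.
Hypothesis hCf_0 : p0 = 1%nat -> Cf 0 = 0.
Hypothesis hCf_int : p0 = 2%nat -> RInt (fun y => Cf y / dn k y) 0 (PI / 2) = 0.

(** In the application [Cf] is sin (l u) when [p0 = 1] and cos (l u) when [p0 = 2], with [Cf1] its
    derivative in u. *)
Definition moment (p : nat) : R := RInt (fun y => Cf y / dn k y * sin y ^ p) 0 (PI / 2).

Lemma continuous_Cf (y : R) : continuous Cf y.
Proof. eapply continuous_of_is_derive, hCf. Qed.

Lemma continuous_Cf1 (y : R) : continuous Cf1 y.
Proof. eapply continuous_of_is_derive, hCf1. Qed.

Hint Resolve continuous_Cf continuous_Cf1 : core.

(** The second derivative of sn^p is moved onto [Cf] by two integrations by parts. At u = K the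
    boundary terms vanish through cn and [Cf1]; at u = 0 the derivative of sn^p is nonzero only for
    p = 1, and that case occurs only with [p0 = 1], where [Cf 0 = 0]. For p = 1 the truncated
    exponent [p - 2] is harmless, its coefficient being zero. *)
Lemma moment_rec (p : nat) : (p0 <= p)%nat ->
  k ^ 2 * INR p * (INR p + 1) * moment (p + 2)
  = ((1 + k ^ 2) * INR p ^ 2 - l ^ 2) * moment p - INR p * (INR p - 1) * moment (p - 2).
Proof.
  intros Hp. assert (Hp1 : (1 <= p)%nat) by lia.
  set (T := fun y => INR p * sin y ^ (p - 1) * cos y * dn k y).
  set (T' := fun y => (INR p * (INR p - 1) * sin y ^ (p - 2) - (1 + k ^ 2) * INR p ^ 2 * sin y ^ p
      + k ^ 2 * INR p * (INR p + 1) * sin y ^ (p + 2)) / dn k y).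
  set (S' := fun y => INR p * sin y ^ (p - 1) * cos y).
  assert (HT' : forall y, continuous T' y) by (intros y; unfold T'; cont1).
  assert (HS' : forall y, continuous S' y) by (intros y; unfold S'; cont1).
  assert (E : RInt (fun y => T' y * Cf y) 0 (PI / 2) =
    INR p * (INR p - 1) * moment (p - 2) - (1 + k ^ 2) * INR p ^ 2 * moment p
    + k ^ 2 * INR p * (INR p + 1) * moment (p + 2)).
  { unfold moment. rewrite <- !RInt_scal_all, <- RInt_minus_all, <- RInt_plus_all;
      auto; try (intros y; cont1).
    apply RInt_ext_all. intros y. unfold T'. field. now apply dn_neq_0. }
  rewrite (RInt_by_parts_all T Cf T' (fun y => Cf1 y / dn k y)) in E; auto.
  2:{ intros y. now apply is_derive_dn_sin_pow. }
  2:{ intros y. cont1. }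
  rewrite (RInt_ext_all (fun y => T y * (Cf1 y / dn k y)) (fun y => S' y * Cf1 y)) in E.
  2:{ intros y. unfold T, S'. field. now apply dn_neq_0. }
  rewrite (RInt_by_parts_all (fun y => sin y ^ p) Cf1 S' (fun y => - l ^ 2 * Cf y / dn k y)) in E; auto.
  2:{ intros y. now apply is_derive_sin_pow. }
  2:{ intros y. cont1. }
  rewrite (RInt_ext_all (fun y => sin y ^ p * (- l ^ 2 * Cf y / dn k y))
    (fun y => - l ^ 2 * (Cf y / dn k y * sin y ^ p))) in E.
  2:{ intros y. field. now apply dn_neq_0. }
  rewrite RInt_scal_all in E by (intros y; cont1). fold (moment p) in E.
  rewrite hCf1_PI2, sin_0, (pow_i p) in E by lia.
  assert (E0 : T 0 * Cf 0 = 0).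
  { unfold T. rewrite sin_0. destruct (Nat.eq_dec p 1) as [-> | Hp2].
    - rewrite hCf_0 by lia. ring.
    - rewrite pow_i by lia. ring. }
  assert (E1 : T (PI / 2) = 0) by (unfold T; rewrite cos_PI2; ring).
  rewrite E0, E1 in E. lra.
Qed.

Lemma INR_fact_pred (p : nat) : (1 <= p)%nat ->
  INR (fact (p + 1)) = (INR p + 1) * INR p * INR (fact (p - 1)).
Proof.
  intros Hp. replace (p + 1)%nat with (S p) by lia. destruct p as [|q]; [lia |].
  replace (S q - 1)%nat with q by lia.
  rewrite !fact_simpl, !mult_INR, !S_INR. ring.
Qed.

(** The normalisation k^(2n) (2n + p0 - 1)! turns the moment recurrence into the defining recurrence
    of [F], so both sides agree once their first two terms do. *)
Lemma moment_formula (n : nat) :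
  moment (2 * n + p0) * k ^ (2 * n) * INR (fact (2 * n + p0 - 1)) = F n * moment p0.
Proof.
  destruct hF as [F0 [F1 FS]].
  assert (Estep : forall n, moment (2 * S n + p0) * k ^ (2 * S n) * INR (fact (2 * S n + p0 - 1))
    = (k ^ 2 * INR (2 * n + p0) * (INR (2 * n + p0) + 1) * moment (2 * n + p0 + 2))
      * k ^ (2 * n) * INR (fact (2 * n + p0 - 1))).
  { intros m. replace (2 * S m + p0 - 1)%nat with (2 * m + p0 + 1)%nat by lia.
    replace (2 * S m + p0)%nat with (2 * m + p0 + 2)%nat by lia.
    replace (2 * S m)%nat with (S (S (2 * m))) by lia.
    rewrite INR_fact_pred by lia. simpl pow. ring. }
  induction n as [| |n IH1 IH2] using nat_ind2.
  - simpl. rewrite F0. destruct hp0 as [-> | ->]; simpl; ring.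
  - rewrite Estep, moment_rec, F1 by lia. simpl (2 * 0 + p0)%nat. simpl (2 * 0)%nat.
    destruct hp0 as [E | E]; rewrite E.
    + simpl. ring.
    (* For [p0 = 2] the recurrence reaches down to the moment of order 0, the integral of cos (l u),
       which vanishes. *)
    + simpl (2 - 2)%nat. unfold moment at 2.
      rewrite (RInt_ext_all _ (fun y => Cf y / dn k y)) by (intros; simpl; ring).
      rewrite (hCf_int E). simpl. ring.
  - rewrite Estep, moment_rec, (FS n) by lia.
    set (q := INR (2 * S n + p0)) in *.
    replace (2 * S n + p0 - 2)%nat with (2 * n + p0)%nat by lia.
    assert (E : INR (fact (2 * S n + p0 - 1)) = (q - 1) * (q - 2) * INR (fact (2 * n + p0 - 1))).
    { replace (2 * S n + p0 - 1)%nat with (2 * n + p0 + 1)%nat by lia.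
      rewrite INR_fact_pred by lia. unfold q.
      replace (2 * S n + p0)%nat with (S (S (2 * n + p0))) by lia. rewrite !S_INR. ring. }
    replace (k ^ (2 * S n)) with (k ^ 2 * k ^ (2 * n)) in *
      by (rewrite <- pow_add; f_equal; lia).
    transitivity (((1 + k ^ 2) * q ^ 2 - l ^ 2) *
       (moment (2 * S n + p0) * (k ^ 2 * k ^ (2 * n)) * INR (fact (2 * S n + p0 - 1)))
       - k ^ 2 * q * (q - 1) * ((q - 1) * (q - 2)) *
         (moment (2 * n + p0) * k ^ (2 * n) * INR (fact (2 * n + p0 - 1)))).
    + rewrite E. ring.
    + rewrite IH1, IH2. ring.
Qed.

Hypothesis hCf_le : forall y, Rabs (Cf y) <= 1.
Hypothesis hM : moment p0 <> 0.

(** The moments of a bounded function stay bounded, so dividing the moment formula by the nonzero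
    first moment leaves only the explicit growth. The factor k^(2n) is what makes the expansion
    converge even where sin y = 1. *)
Lemma sc_bound : exists B, 0 <= B /\
  forall n, Rabs (F n) <= B * k ^ (2 * n) * INR (fact (2 * n + p0 - 1)).
Proof.
  pose proof PI_RGT_0 as Hpi.
  set (C1 := / sqrt (1 - k ^ 2)).
  pose proof (inv_sqrt_compl_pos k hk) as HC. fold C1 in HC.
  assert (HMp : forall p, Rabs (moment p) <= PI / 2 * C1).
  { intros p. unfold moment. replace (PI / 2) with (PI / 2 - 0) at 2 by ring.
    apply abs_RInt_le_const_all; [lra | intros y; cont1 |].
    intros y Hy. unfold Rdiv. rewrite !Rabs_mult.
    pose proof (inv_dn_bounds k hk y) as Hd. fold C1 in Hd. rewrite (Rabs_right (/ _)) by lra.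
    pose proof (hCf_le y). pose proof (Rabs_pos (Cf y)).
    pose proof (Rabs_sin_pow_le p y).
    pose proof (Rabs_pos (sin y ^ p)).
    assert (0 <= Rabs (Cf y) * / dn k y <= C1) by (split; nra). nra. }
  exists (PI / 2 * C1 / Rabs (moment p0)).
  assert (Hm : 0 < Rabs (moment p0)) by now apply Rabs_pos_lt.
  split.
  - apply Rdiv_le_0_compat; auto. apply Rmult_le_pos; lra.
  - intros n. apply Rmult_le_reg_r with (Rabs (moment p0)); auto.
    rewrite <- Rabs_mult, <- moment_formula, !Rabs_mult.
    assert (H1 : 0 <= k ^ (2 * n)) by (apply pow_le; lra).
    assert (H2 : 0 <= INR (fact (2 * n + p0 - 1))) by apply pos_INR.
    rewrite (Rabs_right (k ^ _)), (Rabs_right (INR _)) by lra.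
    replace (_ / _ * _ * _ * _) with (PI / 2 * C1 * k ^ (2 * n) * INR (fact (2 * n + p0 - 1)))
      by (field; lra).
    apply Rmult_le_compat_r; auto. apply Rmult_le_compat_r; auto.
Qed.

End Moments.

(** * Expansion of trigonometric functions in powers of sn *)

Section Expansion.

Variables (k l : R) (p0 : nat) (F : nat -> R) (Yt Y1t : R -> R) (B : R).
Hypothesis hk : 0 < k < 1.
Hypothesis hl : 0 < l.
Hypothesis hp0 : p0 = 1%nat \/ p0 = 2%nat.
Hypothesis hF : sc_gen k p0 (- l ^ 2) F.
Hypothesis hB0 : 0 <= B.
Hypothesis hB : forall n, Rabs (F n) <= B * k ^ (2 * n) * INR (fact (2 * n + p0 - 1)).
Hypothesis hYt : forall y, is_derive Yt y (Y1t y / dn k y).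
Hypothesis hY1t : forall y, is_derive Y1t y ((- l ^ 2 * Yt y + (INR p0 - 1)) / dn k y).
Hypothesis hYt0 : Yt 0 = 0.
Hypothesis hY1t0 : Y1t 0 = 2 - INR p0.

(** The sum [Yt] to be expanded is sin (l u) / l for [p0 = 1] and (1 - cos (l u)) / l^2 for
    [p0 = 2]. Both solve Y'' = -l^2 Y + (p0 - 1); the constant is the lowest term of (sn^2)'',
    divided by 2!. *)
Let p (n : nat) : nat := (2 * n + p0)%nat.
Let a (n : nat) : R := F n / INR (fact (p n)).
Let Y (N : nat) (y : R) : R := sum_f_R0 (fun n => a n * sin y ^ p n) N.
Let Y1 (N : nat) (y : R) : R :=
  sum_f_R0 (fun n => a n * (INR (p n) * sin y ^ (p n - 1) * cos y * dn k y)) N.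
(** The defect of a partial sum in the differential equation. Cutting the three-term rule at index N
    loses the contribution of index N + 1 to the power [p N] and leaves an uncompensated power
    [p (S N)]; all lower powers cancel. *)
Let rem (N : nat) (y : R) : R :=
  - (a (S N) * INR (p (S N)) * (INR (p (S N)) - 1) * sin y ^ p N)
  + k ^ 2 * a N * INR (p N) * (INR (p N) + 1) * sin y ^ p (S N).

Lemma sc_coef_rec (n : nat) :
  a (S (S n)) * INR (p (S (S n))) * (INR (p (S (S n))) - 1)
  = (- l ^ 2 + (1 + k ^ 2) * INR (p (S n)) ^ 2) * a (S n)
    - k ^ 2 * INR (p n) * (INR (p n) + 1) * a n.
Proof.
  destruct hF as [_ [_ FS]]. unfold a. rewrite (FS n). fold (p (S n)).
  replace (p (S (S n))) with (S (S (p (S n)))) by (unfold p; lia).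
  replace (p (S n)) with (S (S (p n))) by (unfold p; lia).
  rewrite !fact_simpl, !mult_INR, !S_INR. pose proof (INR_fact_neq_0 (p n)).
  pose proof (pos_INR (p n)). field. repeat split; lra.
Qed.

Lemma is_derive_partial_Y (N : nat) (y : R) : is_derive (Y N) y (Y1 N y / dn k y).
Proof.
  pose proof (dn_neq_0 k hk y).
  assert (G : forall n, is_derive (fun y => a n * sin y ^ p n) y
     (a n * (INR (p n) * sin y ^ (p n - 1) * cos y * dn k y) / dn k y)).
  { intros n. evar_last.
    - apply is_derive_scal. apply is_derive_sin_pow. unfold p. lia.
    - field. auto. }
  unfold Y, Y1. induction N as [|N IH].
  - apply G.
  - cbn [sum_f_R0]. unfold Rdiv. rewrite Rmult_plus_distr_r.
    apply (is_derive_plus (K := R_AbsRing) (V := R_NormedModule)); [apply IH | apply G].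
Qed.

Lemma is_derive_partial_Y1 (N : nat) (y : R) :
  is_derive (Y1 N) y ((- l ^ 2 * Y N y + (INR p0 - 1) + rem N y) / dn k y).
Proof.
  pose proof (dn_neq_0 k hk y).
  assert (G : forall n, is_derive
     (fun y => a n * (INR (p n) * sin y ^ (p n - 1) * cos y * dn k y)) y
     (a n * ((INR (p n) * (INR (p n) - 1) * sin y ^ (p n - 2) - (1 + k ^ 2) * INR (p n) ^ 2 * sin y ^ p n
      + k ^ 2 * INR (p n) * (INR (p n) + 1) * sin y ^ (p n + 2)) / dn k y))).
  { intros n. apply is_derive_scal. apply is_derive_dn_sin_pow; auto. unfold p. lia. }
  unfold Y1. induction N as [|N IH].
  - evar_last; [apply G |]. unfold Y, rem. cbn [sum_f_R0].
    assert (E : a 1 * INR (p 1) * (INR (p 1) - 1) = (- l ^ 2 + (k ^ 2 + 1) * INR p0 ^ 2) * a 0).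
    { destruct hF as [F0 [F1 _]]. unfold a. rewrite F0, F1. unfold p.
      destruct hp0 as [-> | ->]; simpl; field. }
    rewrite E. replace (p 1) with (p0 + 2)%nat by (unfold p; lia).
    replace (p 0) with p0 by (unfold p; lia).
    assert (E0 : a 0 * (INR p0 * (INR p0 - 1) * sin y ^ (p0 - 2)) = INR p0 - 1).
    { unfold a. destruct hF as [F0 _]. rewrite F0. unfold p.
      destruct hp0 as [-> | ->]; simpl; field. }
    match goal with |- _ = (?A + (INR p0 - 1) + ?B) / ?D =>
      transitivity ((A + a 0 * (INR p0 * (INR p0 - 1) * sin y ^ (p0 - 2)) + B) / D) end.
    + field. auto.
    + now rewrite E0.
  - cbn [sum_f_R0]. evar_last.
    + apply (is_derive_plus (K := R_AbsRing) (V := R_NormedModule)); [apply IH | apply G].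
    + match goal with |- plus ?A ?B = _ => change (plus A B) with (A + B) end.
      unfold rem, Y. cbn [sum_f_R0]. rewrite sc_coef_rec.
      replace (p (S N) - 2)%nat with (p N) by (unfold p; lia).
      replace (p (S N) + 2)%nat with (p (S (S N))) by (unfold p; lia).
      field. auto.
Qed.

(** Each of the two terms of [rem] is at most half of this: [a n * p n] is bounded by B k^(2n), and
    a further factor of size [p (S N)] comes from the second derivative. *)
Let eps (N : nat) : R := 2 * B * (k ^ (2 * S N) * INR (p (S N))).

Lemma rem_le (N : nat) (y : R) : Rabs (rem N y) <= eps N.
Proof.
  assert (Hk : forall q, 0 < k ^ q) by (intros; apply pow_lt; lra).
  assert (Ep : INR (p (S N)) = INR (p N) + 2).
  { replace (p (S N)) with (S (S (p N))) by (unfold p; lia). rewrite !S_INR. ring. }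
  assert (Hp : 1 <= INR (p N)).
  { apply (le_INR 1). unfold p. lia. }
  assert (Ha : forall n, Rabs (a n * INR (p n)) <= B * k ^ (2 * n)).
  { intros n. unfold a. assert (Hpn : (1 <= p n)%nat) by (unfold p; lia).
    specialize (hB n). fold (p n) in hB. replace (p n) with (S (p n - 1)) at 1 2 by lia.
    rewrite fact_simpl, mult_INR.
    assert (Hf : 0 < INR (fact (p n - 1))) by apply INR_fact_lt_0.
    assert (Hq : 0 < INR (S (p n - 1))) by apply lt_0_INR, Nat.lt_0_succ.
    replace (F n / (INR (S (p n - 1)) * INR (fact (p n - 1))) * INR (S (p n - 1)))
      with (F n * / INR (fact (p n - 1))) by (field; lra).
    rewrite Rabs_mult, (Rabs_right (/ _)).
    2:{ left. now apply Rinv_0_lt_compat. }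
    apply Rmult_le_reg_r with (INR (fact (p n - 1))); auto.
    rewrite Rmult_assoc, Rinv_l by lra. lra. }
  unfold rem. eapply Rle_trans; [apply Rabs_triang |]. rewrite Rabs_Ropp.
  replace (k ^ 2 * a N * INR (p N) * (INR (p N) + 1)) with
    (a N * INR (p N) * (k ^ 2 * (INR (p N) + 1))) by ring.
  rewrite (Rabs_mult (_ * (INR (p (S N)) - 1))), (Rabs_mult _ (INR (p (S N)) - 1)).
  rewrite (Rabs_mult (_ * (k ^ 2 * _))), (Rabs_mult _ (k ^ 2 * _)).
  assert (0 <= INR (p (S N)) - 1) by lra.
  assert (0 < k ^ 2 * (INR (p N) + 1)) by (apply Rmult_lt_0_compat; [apply Hk | lra]).
  rewrite (Rabs_right (INR (p (S N)) - 1)), (Rabs_right (k ^ 2 * _)) by lra.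
  pose proof (Ha N) as A1. pose proof (Ha (S N)) as A2.
  pose proof (Rabs_pos (a N * INR (p N))). pose proof (Rabs_pos (a (S N) * INR (p (S N)))).
  pose proof (Rabs_sin_pow_le (p N) y) as S1. pose proof (Rabs_sin_pow_le (p (S N)) y) as S2.
  pose proof (Rabs_pos (sin y ^ p N)). pose proof (Rabs_pos (sin y ^ p (S N))).
  assert (Ek : k ^ (2 * S N) = k ^ 2 * k ^ (2 * N)).
  { rewrite <- pow_add. f_equal. lia. }
  unfold eps.
  assert (X1 : Rabs (a (S N) * INR (p (S N))) * (INR (p (S N)) - 1) * Rabs (sin y ^ p N)
     <= B * k ^ (2 * S N) * (INR (p (S N)) - 1) * 1).
  { apply Rmult_le_compat; auto; [apply Rmult_le_pos; auto |]. apply Rmult_le_compat_r; auto. }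
  assert (X2 : Rabs (a N * INR (p N)) * (k ^ 2 * (INR (p N) + 1)) * Rabs (sin y ^ p (S N))
     <= B * k ^ (2 * N) * (k ^ 2 * (INR (p N) + 1)) * 1).
  { apply Rmult_le_compat; auto; [apply Rmult_le_pos; lra |]. apply Rmult_le_compat_r; lra. }
  pose proof (Hk (2 * N)%nat). pose proof (Hk 2%nat).
  assert (0 <= B * (k ^ 2 * k ^ (2 * N))) by (repeat apply Rmult_le_pos; lra).
  rewrite Ek in *. nra.
Qed.

Lemma eps_lim : is_lim_seq eps 0.
Proof.
  assert (H : ex_series (fun n => k ^ (2 * S n) * INR (p (S n)))).
  { apply ex_series_Rabs, ex_series_DAlembert with (k ^ 2).
    - nra.
    - intros n. apply Rmult_integral_contrapositive_currified.
      + apply pow_nonzero. lra.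
      + apply not_0_INR. unfold p. lia.
    - apply is_lim_seq_ext with (fun n => k ^ 2 * (1 + 2 / INR (p (S n)))).
      + intros n. replace (p (S (S n))) with (S (S (p (S n)))) by (unfold p; lia).
        replace (2 * S (S n))%nat with (2 + 2 * S n)%nat by lia. rewrite pow_add, !S_INR.
        assert (0 < k ^ (2 * S n)) by (apply pow_lt; lra).
        assert (0 < INR (p (S n))) by (apply lt_0_INR; unfold p; lia).
        assert (0 < k ^ 2) by nra.
        rewrite Rabs_right.
        * field. lra.
        * apply Rle_ge. apply Rdiv_le_0_compat; [| now apply Rmult_lt_0_compat].
          apply Rmult_le_pos; [apply Rmult_le_pos; [apply pow_le |] |]; lra.
      + replace (k ^ 2) with (k ^ 2 * (1 + 0)) at 1 by ring.
        apply (is_lim_seq_scal_l _ (k ^ 2) (1 + 0)).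
        apply is_lim_seq_plus'; [apply is_lim_seq_const |].
        replace 0 with (2 * 0) by ring. apply (is_lim_seq_scal_l _ 2 0).
        replace (Finite 0) with (Rbar_inv p_infty) by reflexivity.
        apply is_lim_seq_inv; [| easy].
        apply is_lim_seq_le_p_loc with INR; [| apply is_lim_seq_INR].
        exists 0%nat. intros n _. apply le_INR. unfold p. lia. }
  apply ex_series_lim_0 in H.
  replace (Finite 0) with (Rbar_mult (2 * B) 0) by (simpl; f_equal; ring).
  apply is_lim_seq_scal_l. exact H.
Qed.

(* Variation of constants for the harmonic oscillator with forcing [rem N]. *)
Lemma partial_Y_error (N : nat) (y : R) : 0 <= y ->
  Rabs (Y1 N y - Y1t y) <= 2 * (y * (/ sqrt (1 - k ^ 2) * eps N)) /\
  l * Rabs (Y N y - Yt y) <= 2 * (y * (/ sqrt (1 - k ^ 2) * eps N)).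
Proof.
  intros Hy. set (C1 := / sqrt (1 - k ^ 2)).
  set (Z := fun y => Y N y - Yt y). set (Z1 := fun y => Y1 N y - Y1t y).
  set (W1 := fun y => Z1 y * sin (l * ellF k y) - l * Z y * cos (l * ellF k y)).
  set (W2 := fun y => Z1 y * cos (l * ellF k y) + l * Z y * sin (l * ellF k y)).
  assert (dZ : forall y, is_derive Z y (Z1 y / dn k y)).
  { intros x. evar_last.
    - apply (is_derive_minus (K := R_AbsRing) (V := R_NormedModule)); [apply is_derive_partial_Y | apply hYt].
    - unfold minus, plus, opp; simpl. unfold Z1, Rdiv. ring. }
  assert (dZ1 : forall y, is_derive Z1 y ((- l ^ 2 * Z y + rem N y) / dn k y)).
  { intros x. evar_last.
    - apply (is_derive_minus (K := R_AbsRing) (V := R_NormedModule)); [apply is_derive_partial_Y1 | apply hY1t].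
    - unfold minus, plus, opp; simpl. unfold Z, Rdiv. ring. }
  assert (HE : 0 <= eps N) by (apply Rle_trans with (2 := rem_le N 0), Rabs_pos).
  assert (Hb : forall (W W' : R -> R), (forall y, is_derive W y (W' y * rem N y / dn k y)) ->
     (forall y, Rabs (W' y) <= 1) -> W 0 = 0 -> Rabs (W y) <= y * (C1 * eps N)).
  { intros W W' dW HW W0.
    assert (G : forall x, Rabs (W' x * rem N x / dn k x) <= C1 * eps N).
    { intros x. unfold Rdiv. rewrite !Rabs_mult.
      pose proof (inv_dn_bounds k hk x) as Hd. fold C1 in Hd. rewrite (Rabs_right (/ _)) by lra.
      pose proof (HW x). pose proof (Rabs_pos (W' x)). pose proof (Rabs_pos (rem N x)).
      pose proof (rem_le N x). assert (Rabs (W' x) * Rabs (rem N x) <= eps N) by nra.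
      assert (0 <= Rabs (W' x) * Rabs (rem N x)) by nra. nra. }
    assert (D1 : W 0 - 0 * (C1 * eps N) >= W y - y * (C1 * eps N)).
    { assert (- (W 0 - 0 * (C1 * eps N)) <= - (W y - y * (C1 * eps N))); [| lra].
      apply (le_of_derive_nonneg (fun y => - (W y - y * (C1 * eps N)))
               (fun y => C1 * eps N - W' y * rem N y / dn k y)); auto.
      - intros x _. auto_derive; [eexists; apply dW |]. subst_Derive (dW x). ring.
      - intros x _. specialize (G x). apply Rabs_le_between in G. lra. }
    assert (D2 : W 0 + 0 * (C1 * eps N) <= W y + y * (C1 * eps N)).
    { apply (le_of_derive_nonneg (fun y => W y + y * (C1 * eps N))
               (fun y => C1 * eps N + W' y * rem N y / dn k y)); auto.
      - intros x _. auto_derive; [eexists; apply dW |]. subst_Derive (dW x). ring.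
      - intros x _. specialize (G x). apply Rabs_le_between in G. lra. }
    rewrite W0 in *. apply Rabs_le. lra. }
  assert (Y00 : Y N 0 = 0).
  { unfold Y. rewrite sum_eq_R0; auto. intros n _. rewrite sin_0, pow_i by (unfold p; lia). ring. }
  assert (Y10 : Y1 N 0 = 2 - INR p0).
  { destruct hF as [F0 _].
    assert (T0 : forall n, a (S n) * (INR (p (S n)) * sin 0 ^ (p (S n) - 1) * cos 0 * dn k 0) = 0).
    { intros n. rewrite sin_0, pow_i by (unfold p; lia). ring. }
    unfold Y1. clear - F0 T0 hp0. induction N as [|N IH].
    - cbn [sum_f_R0]. unfold a, p, dn. rewrite F0, sin_0, cos_0.
      replace (1 - k ^ 2 * 0 ^ 2) with 1 by ring. rewrite sqrt_1.
      destruct hp0 as [-> | ->]; simpl; field.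
    - cbn [sum_f_R0]. rewrite IH, T0. ring. }
  assert (Z00 : Z 0 = 0) by (unfold Z; rewrite Y00, hYt0; ring).
  assert (Z10 : Z1 0 = 0) by (unfold Z1; rewrite Y10, hY1t0; ring).
  assert (H1 : Rabs (W1 y) <= y * (C1 * eps N)).
  { apply (Hb W1 (fun y => sin (l * ellF k y))).
    - intros x. pose proof (dn_neq_0 k hk x). unfold W1. auto_derive.
      + repeat split; auto;
          match goal with
          | |- ex_derive (fun u => Z1 u) _ => exists ((- l ^ 2 * Z x + rem N x) / dn k x); apply dZ1
          | |- ex_derive (fun u => Z u) _ => exists (Z1 x / dn k x); apply dZ
          | |- _ => exists (/ dn k x); now apply is_derive_ellF
          end.
      + subst_Derive (dZ x). subst_Derive (dZ1 x). subst_Derive (is_derive_ellF k hk x).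
        field. auto.
    - intros x. apply Rabs_le, SIN_bound.
    - unfold W1. rewrite Z00, Z10. ring. }
  assert (H2 : Rabs (W2 y) <= y * (C1 * eps N)).
  { apply (Hb W2 (fun y => cos (l * ellF k y))).
    - intros x. pose proof (dn_neq_0 k hk x). unfold W2. auto_derive.
      + repeat split; auto;
          match goal with
          | |- ex_derive (fun u => Z1 u) _ => exists ((- l ^ 2 * Z x + rem N x) / dn k x); apply dZ1
          | |- ex_derive (fun u => Z u) _ => exists (Z1 x / dn k x); apply dZ
          | |- _ => exists (/ dn k x); now apply is_derive_ellF
          end.
      + subst_Derive (dZ x). subst_Derive (dZ1 x). subst_Derive (is_derive_ellF k hk x).
        field. auto.
    - intros x. apply Rabs_le, COS_bound.
    - unfold W2. rewrite Z00, Z10. ring. }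
  pose proof (sin2_cos2 (l * ellF k y)) as E. unfold Rsqr in E.
  pose proof (SIN_bound (l * ellF k y)) as Hs. pose proof (COS_bound (l * ellF k y)) as Hc.
  set (s := sin (l * ellF k y)) in *. set (c := cos (l * ellF k y)) in *.
  assert (Es : Z1 y = W1 y * s + W2 y * c).
  { unfold W1, W2. fold s c. transitivity (Z1 y * (s * s + c * c)); [rewrite E |]; ring. }
  assert (Ec : l * Z y = W2 y * s - W1 y * c).
  { unfold W1, W2. fold s c. transitivity (l * Z y * (s * s + c * c)); [rewrite E |]; ring. }
  change (Y1 N y - Y1t y) with (Z1 y). change (Y N y - Yt y) with (Z y).
  replace (l * Rabs (Z y)) with (Rabs (l * Z y)) by (rewrite Rabs_mult, (Rabs_right l); lra).
  rewrite Es, Ec.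
  set (e := y * (C1 * eps N)) in *.
  assert (Hprod : forall u v, Rabs u <= e -> -1 <= v <= 1 -> Rabs (u * v) <= e).
  { intros u v Hu Hv. rewrite Rabs_mult. assert (Rabs v <= 1) by now apply Rabs_le.
    pose proof (Rabs_pos u). pose proof (Rabs_pos v). nra. }
  split.
  - eapply Rle_trans; [apply Rabs_triang |].
    pose proof (Hprod _ _ H1 Hs). pose proof (Hprod _ _ H2 Hc). lra.
  - unfold Rminus. eapply Rle_trans; [apply Rabs_triang |]. rewrite Rabs_Ropp.
    pose proof (Hprod _ _ H2 Hs). pose proof (Hprod _ _ H1 Hc). lra.
Qed.

Lemma is_series_of_error (u : nat -> R) (s C : R) :
  (forall N, Rabs (sum_f_R0 u N - s) <= C * eps N) -> is_series u s.
Proof.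
  intros H. change (is_lim_seq (sum_n u) s).
  apply is_lim_seq_ext with (fun N => s + (sum_f_R0 u N - s)).
  - intros N. rewrite sum_n_Reals. ring.
  - replace (Finite s) with (Finite (s + 0)) by (f_equal; ring).
    apply (is_lim_seq_plus' _ _ s 0); [apply is_lim_seq_const |].
    apply is_lim_seq_abs_0. apply is_lim_seq_le_le with (fun _ => 0) (fun N => C * eps N).
    + intros N. split; [apply Rabs_pos | apply H].
    + apply is_lim_seq_const.
    + replace (Finite 0) with (Rbar_mult C 0) by (simpl; f_equal; ring).
      apply is_lim_seq_scal_l, eps_lim.
Qed.

Lemma sc_series (y : R) : 0 <= y ->
  is_series (fun n => F n / INR (fact (2 * n + p0)) * sin y ^ (2 * n + p0)) (Yt y).
Proof.
  intros Hy. apply is_series_of_error with (2 * (y * / sqrt (1 - k ^ 2)) / l).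
  intros N. destruct (partial_Y_error N y Hy) as [_ H]. unfold Y, a, p in H.
  apply Rmult_le_reg_l with l; auto. eapply Rle_trans; [apply H |]. right.
  generalize (/ sqrt (1 - k ^ 2)). intros X. field. lra.
Qed.

Lemma sc_series_derive (y : R) : 0 <= y ->
  is_series (fun n => F n / INR (fact (2 * n + p0 - 1)) * sin y ^ (2 * n + p0 - 1) * cos y * dn k y)
    (Y1t y).
Proof.
  intros Hy. apply is_series_of_error with (2 * (y * / sqrt (1 - k ^ 2))).
  intros N. destruct (partial_Y_error N y Hy) as [H _]. unfold Y1 in H.
  rewrite (sum_eq _ (fun n => a n * (INR (p n) * sin y ^ (p n - 1) * cos y * dn k y))).
  - eapply Rle_trans; [apply H |]. right. ring.
  - intros n _. unfold a, p. replace (2 * n + p0)%nat with (S (2 * n + p0 - 1)) at 3 4 by lia.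
    rewrite fact_simpl, mult_INR. field. split; [apply INR_fact_neq_0 | apply not_0_INR; lia].
Qed.

End Expansion.

(** * Completeness of trigonometric functions of the elliptic integral *)

Lemma RInt_ge_const (f : R -> R) (a b m : R) : a <= b -> (forall x, continuous f x) ->
  (forall x, a <= x <= b -> m <= f x) -> (b - a) * m <= RInt f a b.
Proof.
  intros Hab Hf Hm. rewrite <- (RInt_const (V := R_CompleteNormedModule) a b m : _ = (b - a) * m).
  apply RInt_le; auto.
  - apply ex_RInt_const.
  - now apply ex_RInt_continuous_all.
  - intros x Hx. apply Hm. lra.
Qed.

Lemma continuous_bounded (f : R -> R) (a b : R) : a <= b -> (forall x, continuous f x) ->
  exists M, 0 <= M /\ forall x, a <= x <= b -> Rabs (f x) <= M.
Proof.
  intros Hab Hf.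
  destruct (continuity_ab_maj (fun x => Rabs (f x)) a b Hab) as [m [Hm _]].
  - intros c _. apply (continuity_pt_comp f Rabs); [| apply Rcontinuity_abs].
    now apply continuity_pt_of_continuous.
  - exists (Rabs (f m)). split; [apply Rabs_pos | auto].
Qed.

Lemma continuous_eps (f : R -> R) (x e : R) : continuous f x -> 0 < e ->
  exists d, 0 < d /\ forall y, Rabs (y - x) < d -> Rabs (f y - f x) < e.
Proof.
  intros Hf He. apply (filterlim_locally f (f x)) with (eps := mkposreal e He) in Hf.
  destruct Hf as [d Hd]. exists d. split; [apply cond_pos |]. intros y Hy. apply (Hd y Hy).
Qed.

Section Completeness.

Variables (h z : R -> R) (a b : R).
Hypothesis h_cont : forall x, continuous h x.
Hypothesis z_cont : forall x, continuous z x.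
Hypothesis z_decr : forall x y, a <= x -> x < y -> y <= b -> z y < z x.
Hypothesis z_le : forall x, Rabs (z x) <= 1.
Hypothesis h_moments : forall j : nat, RInt (fun x => h x * z x ^ j) a b = 0.

Lemma quadratic_power_moments (A B C : R) (N : nat) : forall j : nat,
  RInt (fun x => h x * z x ^ j * (A + B * z x + C * z x ^ 2) ^ N) a b = 0.
Proof.
  induction N as [|N IH]; intros j.
  - rewrite <- (h_moments j). apply RInt_ext_all. intros x. simpl. ring.
  - rewrite (RInt_ext_all _ (fun x => A * (h x * z x ^ j * (A + B * z x + C * z x ^ 2) ^ N)
      + B * (h x * z x ^ (S j) * (A + B * z x + C * z x ^ 2) ^ N)
      + C * (h x * z x ^ (S (S j)) * (A + B * z x + C * z x ^ 2) ^ N))).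
    2:{ intros x. simpl. ring. }
    rewrite !RInt_plus_all, !RInt_scal_all, !IH; try (intros x; cont1). rring.
Qed.

(* The powers of the peak polynomial [Q = 1 + e - (z - z y0)^2 / 4] blow up
   near [y0] and stay in [0, 1] away from it. *)
Lemma moments_zero_not_pos (y0 : R) : a < y0 < b -> ~ 0 < h y0.
Proof.
  intros Hy0 Hpos.
  destruct (continuous_eps h y0 (h y0 / 2) (h_cont y0)) as [d1 [Hd1 H1]]; [lra |].
  set (de := Rmin (d1 / 2) (Rmin ((y0 - a) / 2) ((b - y0) / 2))).
  assert (Hde : 0 < de /\ de <= d1 / 2 /\ de <= (y0 - a) / 2 /\ de <= (b - y0) / 2).
  { unfold de. repeat split.
    - repeat apply Rmin_glb_lt; lra.
    - apply Rmin_l.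
    - eapply Rle_trans; [apply Rmin_r | apply Rmin_l].
    - eapply Rle_trans; [apply Rmin_r | apply Rmin_r]. }
  assert (Hh : forall y, Rabs (y - y0) <= de -> h y0 / 2 <= h y).
  { intros y Hy. assert (Hy' : Rabs (y - y0) < d1) by lra. apply H1 in Hy'.
    apply Rabs_def2 in Hy'. lra. }
  set (d := Rmin (z (y0 - de) - z y0) (z y0 - z (y0 + de))).
  assert (Hd : 0 < d).
  { assert (z y0 < z (y0 - de)) by (apply z_decr; lra).
    assert (z (y0 + de) < z y0) by (apply z_decr; lra).
    unfold d. apply Rmin_glb_lt; lra. }
  assert (Hout : forall y, a <= y <= b -> de < Rabs (y - y0) -> d <= Rabs (z y - z y0)).
  { intros y Hy Hyd. destruct (Rle_lt_dec y y0) as [L | L].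
    - rewrite Rabs_left1 in Hyd by lra.
      assert (z (y0 - de) < z y) by (apply z_decr; lra).
      apply Rle_trans with (z (y0 - de) - z y0); [apply Rmin_l |].
      apply Rle_trans with (z y - z y0); [lra | apply Rle_abs].
    - rewrite Rabs_right in Hyd by lra.
      assert (z y < z (y0 + de)) by (apply z_decr; lra).
      apply Rle_trans with (z y0 - z (y0 + de)); [apply Rmin_r |].
      rewrite Rabs_minus_sym.
      apply Rle_trans with (z y0 - z y); [lra | apply Rle_abs]. }
  destruct (continuous_eps z y0 (d / 2) (z_cont y0)) as [d2 [Hd2 H2]]; [lra |].
  set (et := Rmin de (d2 / 2)).
  assert (Het : 0 < et /\ et <= de /\ et <= d2 / 2).
  { unfold et. repeat split; [apply Rmin_glb_lt; lra | apply Rmin_l | apply Rmin_r]. }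
  destruct (continuous_bounded h a b) as [M [HM0 HM]]; [lra | auto |].
  (* With this choice Q <= 1 where |z - z y0| >= d, and Q >= 1 + e/2 where |z - z y0| <= d/2. Since
     |z - z y0| never exceeds 2, Q stays positive everywhere. *)
  set (e := d ^ 2 / 4). assert (He : 0 < e) by (unfold e; nra).
  set (Q := fun y => 1 + e - (z y - z y0) ^ 2 / 4).
  assert (cQ : forall y, continuous Q y) by (intros y; unfold Q; cont1; lra).
  assert (HQ : forall y, e <= Q y).
  { intros y. unfold Q. pose proof (z_le y) as A1. pose proof (z_le y0) as A2.
    apply Rabs_le_between in A1. apply Rabs_le_between in A2.
    assert ((z y - z y0) ^ 2 <= 4) by nra. lra. }
  assert (Hlow : forall N y, a <= y <= b -> - M <= h y * Q y ^ N).
  { intros N y Hy. pose proof (HQ y) as Hq. assert (Hp : 0 <= Q y ^ N) by (apply pow_le; lra).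
    destruct (Rle_lt_dec (Rabs (y - y0)) de) as [L | L].
    - specialize (Hh y L). assert (0 <= h y * Q y ^ N) by (apply Rmult_le_pos; lra). lra.
    - assert (HQ1 : Q y <= 1).
      { specialize (Hout y Hy L). pose proof (Rabs_pos (z y - z y0)).
        assert (d ^ 2 <= (z y - z y0) ^ 2) by (rewrite <- (pow2_abs (z y - z y0)); nra).
        unfold Q, e. lra. }
      assert (Hp1 : Q y ^ N <= 1).
      { rewrite <- (pow1 N). apply pow_incr. lra. }
      specialize (HM y Hy). apply Rabs_le_between in HM. nra. }
  assert (Hmid : forall N y, y0 - et <= y <= y0 + et ->
     h y0 / 2 * (1 + INR N * (e / 2)) <= h y * Q y ^ N).
  { intros N y Hy.
    assert (Hy1 : Rabs (y - y0) <= et) by (apply Rabs_le; lra).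
    assert (Hy2 : Rabs (y - y0) < d2) by lra. apply H2 in Hy2.
    assert (HQ2 : 1 + e / 2 <= Q y).
    { unfold Q, e. rewrite <- (pow2_abs (z y - z y0)). pose proof (Rabs_pos (z y - z y0)).
      assert (Rabs (z y - z y0) ^ 2 <= (d / 2) ^ 2) by (apply pow_incr; lra). nra. }
    assert (Hhy : h y0 / 2 <= h y) by (apply Hh; lra).
    pose proof (poly N (e / 2)) as Hb.
    assert (Hb' : 1 + INR N * (e / 2) <= (1 + e / 2) ^ N) by (apply Hb; lra).
    assert ((1 + e / 2) ^ N <= Q y ^ N) by (apply pow_incr; lra).
    pose proof (pos_INR N).
    apply Rmult_le_compat; try lra. assert (0 <= INR N * (e / 2)) by nra. lra. }
  assert (Hzero : forall N, RInt (fun y => h y * Q y ^ N) a b = 0).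
  { intros N. rewrite <- (quadratic_power_moments (1 + e - z y0 ^ 2 / 4) (z y0 / 2) (- / 4) N 0).
    apply RInt_ext_all. intros y. unfold Q. rewrite pow_O, Rmult_1_r. f_equal. f_equal. field. }
  (* By Bernoulli's inequality the middle interval contributes an amount growing linearly in N.
     Elsewhere the integrand is at least -M, and the whole integral is zero, so N cannot be
     arbitrarily large. *)
  assert (Hbound : forall N, (y0 + et - (y0 - et)) * (h y0 / 2 * (1 + INR N * (e / 2))) <= M * (b - a)).
  { intros N. specialize (Hzero N).
    assert (cf : forall y, continuous (fun y => h y * Q y ^ N) y) by (intros; cont1).
    rewrite <- (RInt_Chasles (V := R_CompleteNormedModule) _ a (y0 - et) b) in Hzero
      by now apply ex_RInt_continuous_all.
    rewrite <- (RInt_Chasles (V := R_CompleteNormedModule) _ (y0 - et) (y0 + et) b) in Hzero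
      by now apply ex_RInt_continuous_all.
    unfold plus in Hzero; simpl in Hzero.
    assert (I1 : (y0 - et - a) * - M <= RInt (fun y => h y * Q y ^ N) a (y0 - et)).
    { apply RInt_ge_const; auto; [lra |]. intros y Hy. apply Hlow. lra. }
    assert (I2 : (y0 + et - (y0 - et)) * (h y0 / 2 * (1 + INR N * (e / 2)))
        <= RInt (fun y => h y * Q y ^ N) (y0 - et) (y0 + et)).
    { apply RInt_ge_const; auto; lra. }
    assert (I3 : (b - (y0 + et)) * - M <= RInt (fun y => h y * Q y ^ N) (y0 + et) b).
    { apply RInt_ge_const; auto; [lra |]. intros y Hy. apply Hlow. lra. }
    assert (0 <= et * M) by (apply Rmult_le_pos; lra).
    cut ((y0 + et - (y0 - et)) * (h y0 / 2 * (1 + INR N * (e / 2)))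
       + (y0 - et - a) * - M + (b - (y0 + et)) * - M <= 0); [nra |].
    rewrite <- Hzero. lra. }
  set (c := et * h y0 * (e / 2)).
  assert (Hc : 0 < c) by (unfold c; repeat apply Rmult_lt_0_compat; lra).
  destruct (INR_unbounded (M * (b - a) / c)) as [N HN].
  specialize (Hbound N).
  assert (c * (M * (b - a) / c) < c * INR N) by (apply Rmult_lt_compat_l; lra).
  replace (c * (M * (b - a) / c)) with (M * (b - a)) in H by (field; lra).
  assert (0 < et * h y0) by (apply Rmult_lt_0_compat; lra).
  unfold c in H. nra.
Qed.

End Completeness.

Lemma moments_zero (h z : R -> R) (a b : R) :
  (forall x, continuous h x) -> (forall x, continuous z x) ->
  (forall x y, a <= x -> x < y -> y <= b -> z y < z x) -> (forall x, Rabs (z x) <= 1) ->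
  (forall j : nat, RInt (fun x => h x * z x ^ j) a b = 0) ->
  forall y, a < y < b -> h y = 0.
Proof.
  intros Hh Hz Hd Hl Hm y Hy.
  destruct (Rtotal_order (h y) 0) as [L | [E | L]]; auto; exfalso.
  - apply (moments_zero_not_pos (fun x => - h x) z a b) with y; auto; try lra.
    + intros x. cont1.
    + intros j. rewrite (RInt_ext_all _ (fun x => -1 * (h x * z x ^ j))) by (intros; ring).
      rewrite RInt_scal_all by (intros x; cont1). rewrite Hm. rring.
  - apply (moments_zero_not_pos h z a b) with y; auto.
Qed.

(* By the recurrence, multiplication by [z] preserves the span of the family, so
   [V S_0 w] is orthogonal to all powers of [z]. *)
Lemma chebyshev_complete (V z w : R -> R) (S : nat -> R -> R) (c a b : R) :
  a < b -> (forall x, continuous V x) -> (forall x, continuous z x) -> (forall x, continuous w x) ->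
  (forall m x, continuous (S m) x) ->
  (forall x y, a <= x -> x < y -> y <= b -> z y < z x) -> (forall x, Rabs (z x) <= 1) ->
  (forall x, S 1%nat x = (2 * z x + c) * S 0%nat x) ->
  (forall m x, S (m + 2)%nat x = 2 * z x * S (m + 1)%nat x - S m x) ->
  (forall x, a < x < b -> S 0%nat x * w x <> 0) ->
  (forall m, RInt (fun x => V x * S m x * w x) a b = 0) ->
  forall x, a <= x <= b -> V x = 0.
Proof.
  intros Hab cV cz cw cS Hd Hl HS1 HS H0 Hm.
  assert (Hj : forall j m, RInt (fun x => V x * S m x * w x * z x ^ j) a b = 0).
  { induction j as [|j IH]; intros m.
    - rewrite <- (Hm m). apply RInt_ext_all. intros x. simpl. ring.
    - destruct m as [|m].
      + rewrite (RInt_ext_all _ (fun x => / 2 * (V x * S 1%nat x * w x * z x ^ j)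
            + - c / 2 * (V x * S 0%nat x * w x * z x ^ j))).
        2:{ intros x. rewrite HS1. simpl. field. }
        rewrite RInt_plus_all, !RInt_scal_all, !IH by (intros x; cont1). rring.
      + rewrite (RInt_ext_all _ (fun x => / 2 * (V x * S (m + 2)%nat x * w x * z x ^ j)
            + / 2 * (V x * S m x * w x * z x ^ j))).
        2:{ intros x. rewrite HS, Nat.add_1_r. simpl. field. }
        rewrite RInt_plus_all, !RInt_scal_all, !IH by (intros x; cont1). rring. }
  assert (Hin : forall x, a < x < b -> V x = 0).
  { intros x Hx. specialize (H0 x Hx).
    pose proof (moments_zero (fun x => V x * S 0%nat x * w x) z a b) as G.
    assert (E : V x * S 0%nat x * w x = 0).
    { apply G; auto. intros y. cont1. }
    rewrite Rmult_assoc in E. apply Rmult_integral in E. tauto. }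
  (* The endpoints, where [S 0 * w] may vanish, are recovered from the interior by continuity of
     [V]. *)
  intros x Hx. destruct (Req_dec (V x) 0) as [E | NE]; auto. exfalso.
  assert (He : 0 < Rabs (V x)) by now apply Rabs_pos_lt.
  destruct (continuous_eps V x (Rabs (V x)) (cV x) He) as [d [Hd0 Hdd]].
  assert (Hy : exists y, a < y < b /\ Rabs (y - x) < d).
  { set (r := Rmin (d / 2) ((b - a) / 4)).
    assert (Hr : 0 < r) by (apply Rmin_glb_lt; lra).
    assert (Hr1 : r <= d / 2) by apply Rmin_l. assert (Hr2 : r <= (b - a) / 4) by apply Rmin_r.
    destruct (Rle_lt_dec x ((a + b) / 2)); [exists (x + r) | exists (x - r)]; (split; [lra |]);
      [rewrite Rabs_right | rewrite Rabs_left]; lra. }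
  destruct Hy as [y [Hy1 Hy2]]. apply Hdd in Hy2. rewrite (Hin y Hy1) in Hy2.
  unfold Rminus in Hy2. rewrite Rplus_0_l, Rabs_Ropp in Hy2. lra.
Qed.

(** * Gram operators on l^2 *)

Definition rell2 (v : nat -> R) : Prop := ex_series (fun n => v n ^ 2).

Definition dot (v w : nat -> R) : R := Series (fun n => v n * w n).

Lemma ex_series_le_R (u v : nat -> R) :
  (forall n, Rabs (u n) <= v n) -> ex_series v -> ex_series u.
Proof.
  intros H Hv. apply (ex_series_le (K := R_AbsRing) (V := R_CompleteNormedModule) u v); auto.
Qed.

Lemma ex_series_scal_R (c : R) (u : nat -> R) :
  ex_series u -> ex_series (fun n => c * u n).
Proof. apply (ex_series_scal (K := R_AbsRing) (V := R_NormedModule)). Qed.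

Lemma ex_series_plus_R (u v : nat -> R) :
  ex_series u -> ex_series v -> ex_series (fun n => u n + v n).
Proof. apply (ex_series_plus (K := R_AbsRing) (V := R_NormedModule)). Qed.

Lemma ex_series_minus_R (u v : nat -> R) :
  ex_series u -> ex_series v -> ex_series (fun n => u n - v n).
Proof. apply (ex_series_minus (K := R_AbsRing) (V := R_NormedModule)). Qed.

Lemma Series_nonneg (u : nat -> R) : (forall n, 0 <= u n) -> ex_series u -> 0 <= Series u.
Proof.
  intros Hu Hex. rewrite <- (Rmult_0_l (Series u)), <- Series_scal_l.
  apply Series_le; auto. intros n. specialize (Hu n). lra.
Qed.

Lemma ex_series_abs_mult (v w : nat -> R) :
  rell2 v -> rell2 w -> ex_series (fun n => Rabs (v n) * Rabs (w n)).
Proof.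
  intros Hv Hw. apply ex_series_le_R with (fun n => v n ^ 2 + w n ^ 2).
  - intros n. rewrite Rabs_mult, !Rabs_Rabsolu, <- (pow2_abs (v n)), <- (pow2_abs (w n)). nra.
  - now apply ex_series_plus_R.
Qed.

Lemma ex_series_mult (v w : nat -> R) :
  rell2 v -> rell2 w -> ex_series (fun n => v n * w n).
Proof.
  intros Hv Hw. apply ex_series_Rabs.
  apply ex_series_ext with (fun n => Rabs (v n) * Rabs (w n)).
  - intros n. now rewrite Rabs_mult.
  - now apply ex_series_abs_mult.
Qed.

(** The quadratic t^2 P - 2 t S + Q is a sum of squares for every t; its value at t = S / P is the
    inequality. *)
Lemma series_cauchy_schwarz (v w : nat -> R) : rell2 v -> rell2 w ->
  Series (fun n => Rabs (v n) * Rabs (w n)) ^ 2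
  <= Series (fun n => v n ^ 2) * Series (fun n => w n ^ 2).
Proof.
  intros Hv Hw. set (S := Series (fun n => Rabs (v n) * Rabs (w n))).
  set (P := Series (fun n => v n ^ 2)). set (Q := Series (fun n => w n ^ 2)).
  pose proof (ex_series_abs_mult v w Hv Hw) as Hvw.
  assert (G : forall t, 0 <= t ^ 2 * P - 2 * t * S + Q).
  { intros t. unfold P, Q, S.
    rewrite <- !Series_scal_l, <- Series_minus, <- Series_plus;
      auto using ex_series_scal_R, ex_series_minus_R.
    apply Series_nonneg.
    - intros n. rewrite <- (pow2_abs (v n)), <- (pow2_abs (w n)).
      replace (_ - _ + _) with ((t * Rabs (v n) - Rabs (w n)) ^ 2) by ring. apply pow2_ge_0.
    - apply ex_series_plus_R; auto. apply ex_series_minus_R; now apply ex_series_scal_R. }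
  assert (HP : 0 <= P) by (apply Series_nonneg; auto; intros; apply pow2_ge_0).
  destruct HP as [HP | HP].
  - specialize (G (S / P)). replace (_ - _ + Q) with (Q - S ^ 2 / P) in G by (field; lra).
    apply Rmult_le_reg_r with (/ P); [now apply Rinv_0_lt_compat |].
    replace (P * Q * / P) with Q by (field; lra). unfold Rdiv in G. lra.
  - rewrite <- HP in *. assert (HS : S = 0); [| rewrite HS; lra].
    (* With P = 0 the quadratic is affine in t, and at this point it would equal -1 if S were
       nonzero. *)
    pose proof (G ((Q + 1) / (2 * S))) as G1.
    destruct (Req_dec S 0) as [E | NE]; auto.
    replace (2 * ((Q + 1) / (2 * S)) * S) with (Q + 1) in G1 by (field; auto). lra.
Qed.

Lemma is_series_single (f : nat -> R) (m : nat) :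
  is_series (fun j => if Nat.eqb j m then f j else 0) (f m).
Proof.
  change (is_lim_seq (sum_n (fun j => if Nat.eqb j m then f j else 0)) (f m)).
  apply is_lim_seq_ext_loc with (fun _ => f m); [| apply is_lim_seq_const].
  exists m. intros n Hn. induction Hn as [|n Hn IH].
  - destruct m as [|m].
    + now rewrite sum_O.
    + rewrite sum_Sn, Nat.eqb_refl, sum_n_Reals, sum_eq_R0.
      * unfold plus; simpl. ring.
      * intros j Hj. destruct (Nat.eqb_spec j (S m)); [lia | auto].
  - rewrite sum_Sn, <- IH. destruct (Nat.eqb_spec (S n) m); [lia |].
    unfold plus; simpl. ring.
Qed.

Lemma rell2_lin (c : R) (v w : nat -> R) : rell2 v -> rell2 w -> rell2 (fun n => c * v n + w n).
Proof.
  intros Hv Hw. apply ex_series_le_R with (fun n => 2 * (c ^ 2 * v n ^ 2 + w n ^ 2)).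
  - intros n. rewrite Rabs_right by (apply Rle_ge, pow2_ge_0).
    pose proof (pow2_ge_0 (c * v n - w n)). nra.
  - apply ex_series_scal_R, ex_series_plus_R; auto. now apply ex_series_scal_R.
Qed.

Lemma Cmod_sqr (z : C) : Cmod z ^ 2 = Re z ^ 2 + Im z ^ 2.
Proof.
  unfold Cmod, Re, Im. apply pow2_sqrt. apply Rplus_le_le_0_compat; apply pow2_ge_0.
Qed.

Lemma ell2_parts (x : nat -> C) :
  ell2 x <-> rell2 (fun n => Re (x n)) /\ rell2 (fun n => Im (x n)).
Proof.
  unfold ell2, rell2. split.
  - intros H. split; apply ex_series_le_R with (2 := H); intros n; rewrite Cmod_sqr;
      pose proof (pow2_ge_0 (Re (x n))); pose proof (pow2_ge_0 (Im (x n)));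
      rewrite Rabs_right; lra.
  - intros [H1 H2].
    apply ex_series_ext with (fun n => Re (x n) ^ 2 + Im (x n) ^ 2).
    + intros n. now rewrite Cmod_sqr.
    + now apply ex_series_plus_R.
Qed.

Lemma norm2_sqr (x : nat -> C) : ell2 x ->
  norm2 x ^ 2 = Series (fun n => Re (x n) ^ 2) + Series (fun n => Im (x n) ^ 2).
Proof.
  intros H. apply ell2_parts in H as [H1 H2]. unfold norm2. rewrite pow2_sqrt.
  - rewrite <- Series_plus; auto. apply Series_ext. intros n. apply Cmod_sqr.
  - rewrite (Series_ext _ (fun n => Re (x n) ^ 2 + Im (x n) ^ 2)) by (intros; apply Cmod_sqr).
    apply Series_nonneg; [| now apply ex_series_plus_R].
    intros n. apply Rplus_le_le_0_compat; apply pow2_ge_0.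
Qed.

(** * The operator of a Gram matrix with weight *)

Section GramOperator.

Variables (e : nat -> R -> R) (b : nat -> R) (rho : R -> R) (a0 b0 R0 : R)
  (H : nat -> nat -> R).
Hypothesis hab : a0 < b0.
Hypothesis e_cont : forall n x, continuous (e n) x.
Hypothesis rho_cont : forall x, continuous rho x.
Hypothesis e_le : forall n x, Rabs (e n x) <= b n.
Hypothesis rho_bounds : forall x, 0 <= rho x <= R0.
Hypothesis b_l2 : rell2 b.
Hypothesis hH : forall m n, H m n = RInt (fun x => e m x * e n x * rho x) a0 b0.

(** The synthesis map A from l^2 to functions on the interval. The operator of the matrix is A* A,
    with A* taken for the weight [rho], and all its properties are read off from this
    factorisation. *)
Definition synth (v : nat -> R) (x : R) : R := Series (fun n => v n * e n x).

Definition gram (v : nat -> R) (m : nat) : R := Series (fun n => H m n * v n).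

(** The matrix is real, so the operator acts separately on real and imaginary parts, and the
    analysis stays with real sequences. *)
Definition gram_op : operator :=
  fun x n => (gram (fun j => Re (x j)) n, gram (fun j => Im (x j)) n).

Lemma b_nonneg (n : nat) : 0 <= b n.
Proof. apply Rle_trans with (2 := e_le n 0), Rabs_pos. Qed.

Lemma ex_series_abs_b (v : nat -> R) : rell2 v -> ex_series (fun n => Rabs (v n) * b n).
Proof.
  intros Hv. apply ex_series_ext with (fun n => Rabs (v n) * Rabs (b n)).
  - intros n. now rewrite (Rabs_right (b n)) by apply Rle_ge, b_nonneg.
  - now apply ex_series_abs_mult.
Qed.

Lemma synth_term_le (v : nat -> R) (n : nat) (x : R) : Rabs (v n * e n x) <= Rabs (v n) * b n.
Proof. rewrite Rabs_mult. apply Rmult_le_compat_l; [apply Rabs_pos | apply e_le]. Qed.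

Lemma synth_cont (v : nat -> R) : rell2 v -> forall x, continuous (synth v) x.
Proof.
  intros Hv x. apply (Mtest_continuous (fun n x => v n * e n x) (fun n => Rabs (v n) * b n)).
  - intros n y. cont1.
  - apply synth_term_le.
  - now apply ex_series_abs_b.
Qed.

Lemma synth_le (v : nat -> R) (x : R) : rell2 v ->
  Rabs (synth v x) <= Series (fun n => Rabs (v n) * b n).
Proof.
  intros Hv. unfold synth.
  assert (Hex : ex_series (fun n => Rabs (v n * e n x))).
  { apply ex_series_le_R with (fun n => Rabs (v n) * b n); [| now apply ex_series_abs_b].
    intros n. rewrite Rabs_Rabsolu. apply synth_term_le. }
  eapply Rle_trans; [now apply Series_Rabs |].
  apply Series_le; [| now apply ex_series_abs_b].
  intros n. split; [apply Rabs_pos | apply synth_term_le].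
Qed.

Lemma R0_nonneg : 0 <= R0.
Proof. pose proof (rho_bounds 0). lra. Qed.

(** The adjoint relation between A and A*. The terms are dominated by |v n| b n, summable by
    Cauchy-Schwarz, so the M-test allows termwise integration. It is applied with [W] equal to some
    [e m], to another synthesised function, and to the trigonometric functions. *)
Lemma is_series_synth (v : nat -> R) (W : R -> R) (CW : R) : rell2 v ->
  (forall x, continuous W x) -> (forall x, Rabs (W x) <= CW) ->
  is_series (fun n => v n * RInt (fun x => e n x * W x * rho x) a0 b0)
    (RInt (fun x => synth v x * W x * rho x) a0 b0).
Proof.
  intros Hv cW HW.
  pose proof (Mtest_RInt (fun n x => W x * rho x * (v n * e n x))
    (fun n => CW * R0 * (Rabs (v n) * b n))) as G.
  assert (HG : is_series (fun n => RInt (fun x => W x * rho x * (v n * e n x)) a0 b0)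
             (RInt (fun x => Series (fun n => W x * rho x * (v n * e n x))) a0 b0)).
  { apply G; try lra.
    - intros n x. cont1.
    - intros n x. rewrite !(Rabs_mult (W x * rho x)), (Rabs_mult (W x)), (Rabs_right (rho x)).
      2:{ apply Rle_ge, rho_bounds. }
      pose proof (HW x). pose proof (rho_bounds x). pose proof (Rabs_pos (W x)).
      apply Rmult_le_compat; [apply Rmult_le_pos; lra | apply Rabs_pos | | apply synth_term_le].
      apply Rmult_le_compat; lra.
    - now apply ex_series_scal_R, ex_series_abs_b. }
  rewrite (RInt_ext_all (fun x => synth v x * W x * rho x)
     (fun x => Series (fun n => W x * rho x * (v n * e n x)))).
  - apply is_series_ext with (2 := HG). intros n.
    rewrite <- RInt_scal_all by (intros x; cont1).
    apply RInt_ext_all. intros x. ring.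
  - intros x. rewrite Series_scal_l. unfold synth. ring.
Qed.

Lemma gram_eq (v : nat -> R) (m : nat) : rell2 v ->
  gram v m = RInt (fun x => e m x * synth v x * rho x) a0 b0.
Proof.
  intros Hv.
  rewrite (RInt_ext_all _ (fun x => synth v x * e m x * rho x)) by (intros; ring).
  apply is_series_unique.
  apply is_series_ext with (2 := is_series_synth v (e m) (b m) Hv (e_cont m) (e_le m)).
  intros n. rewrite hH, Rmult_comm. f_equal. apply RInt_ext_all. intros x. ring.
Qed.

(** This is <v, A* A w> = <A v, A w>; symmetry and positivity are immediate from the right-hand
    side. *)
Lemma is_series_gram (v w : nat -> R) : rell2 v -> rell2 w ->
  is_series (fun n => v n * gram w n) (RInt (fun x => synth v x * synth w x * rho x) a0 b0).
Proof.
  intros Hv Hw.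
  apply is_series_ext with (fun n => v n * RInt (fun x => e n x * synth w x * rho x) a0 b0).
  - intros n. now rewrite gram_eq.
  - eapply is_series_synth; auto; [now apply synth_cont |].
    intros x. now apply synth_le.
Qed.

Lemma dot_gram_sym (v w : nat -> R) : rell2 v -> rell2 w -> dot v (gram w) = dot w (gram v).
Proof.
  intros Hv Hw. unfold dot.
  rewrite (is_series_unique _ _ (is_series_gram v w Hv Hw)).
  rewrite (is_series_unique _ _ (is_series_gram w v Hw Hv)).
  apply RInt_ext_all. intros x. ring.
Qed.

Lemma dot_gram_nonneg (v : nat -> R) : rell2 v -> 0 <= dot v (gram v).
Proof.
  intros Hv. unfold dot. rewrite (is_series_unique _ _ (is_series_gram v v Hv Hv)).
  replace 0 with ((b0 - a0) * 0) by ring. apply RInt_ge_const; [lra | |].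
  - intros x. cont1; now apply synth_cont.
  - intros x _. pose proof (rho_bounds x). apply Rmult_le_pos; [nra | lra].
Qed.

Lemma gram_le (v : nat -> R) (m : nat) : rell2 v ->
  Rabs (gram v m) <= (b0 - a0) * R0 * Series (fun n => Rabs (v n) * b n) * b m.
Proof.
  intros Hv. rewrite gram_eq by auto.
  eapply Rle_trans.
  - apply (abs_RInt_le_const_all _ a0 b0 (b m * Series (fun n => Rabs (v n) * b n) * R0)); [lra | |].
    + intros x. cont1; now apply synth_cont.
    + intros x _. rewrite !Rabs_mult, (Rabs_right (rho x)) by apply Rle_ge, rho_bounds.
      pose proof (rho_bounds x). pose proof (synth_le v x Hv). pose proof (e_le m x).
      apply Rmult_le_compat; [apply Rmult_le_pos; apply Rabs_pos | lra | | lra].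
      apply Rmult_le_compat; auto; apply Rabs_pos.
  - right. ring.
Qed.

Lemma gram_sqr_le (v : nat -> R) (m : nat) : rell2 v ->
  gram v m ^ 2 <= ((b0 - a0) * R0) ^ 2 * Series (fun n => b n ^ 2) * Series (fun n => v n ^ 2)
     * b m ^ 2.
Proof.
  intros Hv. rewrite <- pow2_abs.
  apply Rle_trans with (((b0 - a0) * R0 * Series (fun n => Rabs (v n) * b n) * b m) ^ 2).
  - apply pow_incr. split; [apply Rabs_pos | now apply gram_le].
  - rewrite !Rpow_mult_distr. apply Rmult_le_compat_r; [apply pow2_ge_0 |].
    rewrite (Rmult_assoc ((b0 - a0) ^ 2 * R0 ^ 2)). apply Rmult_le_compat_l.
    { apply Rmult_le_pos; apply pow2_ge_0. }
    rewrite (Series_ext (fun n => Rabs (v n) * b n) (fun n => Rabs (v n) * Rabs (b n))).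
    + rewrite Rmult_comm. now apply series_cauchy_schwarz.
    + intros n. now rewrite (Rabs_right (b n)) by apply Rle_ge, b_nonneg.
Qed.

Lemma gram_rell2 (v : nat -> R) : rell2 v -> rell2 (gram v).
Proof.
  intros Hv. eapply ex_series_le_R.
  - intros n. rewrite Rabs_right by (apply Rle_ge, pow2_ge_0). now apply gram_sqr_le.
  - apply ex_series_scal_R. exact b_l2.
Qed.

Lemma gram_norm_le (v : nat -> R) : rell2 v ->
  Series (fun n => gram v n ^ 2)
  <= ((b0 - a0) * R0 * Series (fun n => b n ^ 2)) ^ 2 * Series (fun n => v n ^ 2).
Proof.
  intros Hv. eapply Rle_trans.
  - apply Series_le; [| apply ex_series_scal_R; exact b_l2].
    intros n. split; [apply pow2_ge_0 | now apply gram_sqr_le].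
  - rewrite Series_scal_l. right. ring.
Qed.

Lemma ex_series_H (v : nat -> R) (m : nat) : rell2 v -> ex_series (fun n => H m n * v n).
Proof.
  intros Hv. eexists.
  apply is_series_ext with (2 := is_series_synth v (e m) (b m) Hv (e_cont m) (e_le m)).
  intros n. rewrite hH, Rmult_comm. f_equal. apply RInt_ext_all. intros x. ring.
Qed.

Lemma gram_lin (c : R) (v w : nat -> R) (m : nat) : rell2 v -> rell2 w ->
  gram (fun n => c * v n + w n) m = c * gram v m + gram w m.
Proof.
  intros Hv Hw. unfold gram. rewrite <- Series_scal_l, <- Series_plus.
  - apply Series_ext. intros n. ring.
  - apply ex_series_scal_R. now apply ex_series_H.
  - now apply ex_series_H.
Qed.

Lemma gram_ext (v w : nat -> R) (m : nat) : (forall n, v n = w n) -> gram v m = gram w m.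
Proof. intros E. apply Series_ext. intros n. now rewrite E. Qed.

Hint Resolve gram_rell2 : core.

Lemma gram_op_ell2 (x : nat -> C) : ell2 x -> ell2 (gram_op x).
Proof.
  intros Hx. apply ell2_parts in Hx as [Hr Hi]. apply ell2_parts.
  split; unfold gram_op; simpl; now apply gram_rell2.
Qed.

Lemma gram_op_bounded : bounded_op gram_op.
Proof.
  split; [exact gram_op_ell2 | split].
  - intros c x y Hx Hy n. apply ell2_parts in Hx as [Hxr Hxi]. apply ell2_parts in Hy as [Hyr Hyi].
    unfold gram_op. destruct c as [cr ci].
    assert (Hz : rell2 (fun j => ci * Re (x j) + Im (y j))) by now apply rell2_lin.
    assert (Hz' : rell2 (fun j => - ci * Im (x j) + Re (y j))) by now apply rell2_lin.
    rewrite (gram_ext (fun j => Re _) (fun j => cr * Re (x j) + (- ci * Im (x j) + Re (y j))))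
      by (intros j; unfold Re, Im; simpl; ring).
    rewrite (gram_ext (fun j => Im _) (fun j => cr * Im (x j) + (ci * Re (x j) + Im (y j))))
      by (intros j; unfold Re, Im; simpl; ring).
    rewrite !gram_lin by auto.
    apply injective_projections; simpl; ring.
  - set (N := (b0 - a0) * R0 * Series (fun n => b n ^ 2)).
    assert (HN : 0 <= N).
    { pose proof R0_nonneg. apply Rmult_le_pos; [apply Rmult_le_pos; lra |].
      apply Series_nonneg; auto. intros n. apply pow2_ge_0. }
    exists N. intros x Hx. pose proof (gram_op_ell2 x Hx) as HTx.
    apply Rsqr_incr_0_var.
    + rewrite !Rsqr_pow2, Rpow_mult_distr, !norm2_sqr by auto.
      apply ell2_parts in Hx as [Hr Hi]. unfold gram_op; simpl Re; simpl Im.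
      pose proof (gram_norm_le _ Hr). pose proof (gram_norm_le _ Hi). fold N in H0, H1. lra.
    + apply Rmult_le_pos; auto. apply sqrt_pos.
Qed.

Lemma gram_op_represents : represents H gram_op.
Proof.
  intros m n. unfold inner, gram_op, basis_vec.
  assert (Hr : forall j, gram (fun j => Re (if Nat.eqb j n then RtoC 1 else RtoC 0)) j = H j n).
  { intros j. unfold gram. rewrite <- (is_series_unique _ _ (is_series_single (H j) n)).
    apply Series_ext. intros i. destruct (Nat.eqb i n); simpl; ring. }
  assert (Hi : forall j, gram (fun j => Im (if Nat.eqb j n then RtoC 1 else RtoC 0)) j = 0).
  { intros j. unfold gram. rewrite (Series_ext _ (fun i => 0 * 0)).
    - rewrite Series_scal_l. ring.
    - intros i. destruct (Nat.eqb i n); simpl; ring. }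
  apply injective_projections; cbn [fst snd RtoC].
  - rewrite <- (is_series_unique _ _ (is_series_single (fun j => H j n) m)).
    apply Series_ext. intros j. rewrite Hr, Hi. destruct (Nat.eqb j m); simpl; ring.
  - rewrite (Series_ext _ (fun i => 0 * 0)).
    + rewrite Series_scal_l. ring.
    + intros j. rewrite Hr, Hi. destruct (Nat.eqb j m); simpl; ring.
Qed.

Lemma inner_parts (x y : nat -> C) : ell2 x -> ell2 y ->
  inner x y = (dot (fun n => Re (x n)) (fun n => Re (y n)) + dot (fun n => Im (x n)) (fun n => Im (y n)),
               dot (fun n => Re (x n)) (fun n => Im (y n)) - dot (fun n => Im (x n)) (fun n => Re (y n))).
Proof.
  intros Hx Hy. apply ell2_parts in Hx as [Hxr Hxi]. apply ell2_parts in Hy as [Hyr Hyi].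
  unfold inner, dot. apply injective_projections; cbn [fst snd].
  - rewrite <- Series_plus by now apply ex_series_mult.
    apply Series_ext. intros n. unfold Re, Im; simpl. ring.
  - rewrite <- Series_minus by now apply ex_series_mult.
    apply Series_ext. intros n. unfold Re, Im; simpl. ring.
Qed.

Lemma dot_comm (v w : nat -> R) : dot v w = dot w v.
Proof. apply Series_ext. intros n. ring. Qed.

Lemma inner_gram_op (x y : nat -> C) : ell2 x -> ell2 y ->
  inner x (gram_op y)
  = (dot (fun n => Re (x n)) (gram (fun n => Re (y n)))
       + dot (fun n => Im (x n)) (gram (fun n => Im (y n))),
     dot (fun n => Re (x n)) (gram (fun n => Im (y n)))
       - dot (fun n => Im (x n)) (gram (fun n => Re (y n)))).
Proof. intros Hx Hy. exact (inner_parts x (gram_op y) Hx (gram_op_ell2 y Hy)). Qed.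

Lemma gram_op_positive : positive_op gram_op.
Proof.
  intros x Hx. rewrite inner_gram_op by auto.
  apply ell2_parts in Hx as [Hr Hi]. simpl. split.
  - rewrite (dot_gram_sym _ _ Hr Hi). ring.
  - apply Rplus_le_le_0_compat; now apply dot_gram_nonneg.
Qed.

Lemma H_diag_le (n : nat) : Rabs (H n n) <= (b0 - a0) * R0 * b n ^ 2.
Proof.
  rewrite hH. eapply Rle_trans.
  - apply (abs_RInt_le_const_all _ a0 b0 (b n * b n * R0)); [lra | intros x; cont1 |].
    intros x _. rewrite !Rabs_mult, (Rabs_right (rho x)) by apply Rle_ge, rho_bounds.
    pose proof (rho_bounds x). pose proof (e_le n x).
    apply Rmult_le_compat; [apply Rmult_le_pos; apply Rabs_pos | lra | | lra].
    apply Rmult_le_compat; auto; apply Rabs_pos.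
  - right. ring.
Qed.

(** A positive symmetric operator is its own absolute value, and its diagonal entries are integrals
    of [e n ^ 2 * rho], hence at most a constant times [b n ^ 2]. *)
Lemma gram_op_trace_class : trace_class gram_op.
Proof.
  split; [exact gram_op_bounded |]. exists gram_op. split.
  - split; [exact gram_op_bounded | split; [exact gram_op_positive |]].
    intros x y Hx Hy. rewrite !inner_gram_op by auto using gram_op_ell2.
    apply ell2_parts in Hx as [Hxr Hxi]. apply ell2_parts in Hy as [Hyr Hyi].
    change (fun n => Re (gram_op x n)) with (gram (fun n => Re (x n))).
    change (fun n => Im (gram_op x n)) with (gram (fun n => Im (x n))).
    change (fun n => Re (gram_op y n)) with (gram (fun n => Re (y n))).
    change (fun n => Im (gram_op y n)) with (gram (fun n => Im (y n))).
    assert (E : forall v w, rell2 v -> rell2 w -> dot v (gram (gram w)) = dot (gram v) (gram w)).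
    { intros v w Hv Hw. rewrite dot_gram_sym by auto. apply dot_comm. }
    rewrite !E by auto. reflexivity.
  - apply ex_series_le_R with (fun n => (b0 - a0) * R0 * b n ^ 2).
    + intros n. rewrite (gram_op_represents n n). simpl. apply H_diag_le.
    + apply ex_series_scal_R. exact b_l2.
Qed.

(** * Spectrum of A* A from a complete family of functions *)

Section Spectrum.

Variables (nu : nat -> R) (Psi : nat -> nat -> R) (S : nat -> R -> R) (CS : nat -> R).
Hypothesis nu_pos : forall m, 0 < nu m.
Hypothesis nu_decr : forall m, nu (m + 1)%nat < nu m.
Hypothesis S_cont : forall m x, continuous (S m) x.
Hypothesis S_le : forall m x, Rabs (S m x) <= CS m.
Hypothesis Psi_synth : forall m x, a0 <= x <= b0 -> is_series (fun n => Psi m n * e n x) (S m x).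
Hypothesis S_coef : forall m n, RInt (fun x => e n x * S m x * rho x) a0 b0 = nu m * Psi m n.
Hypothesis S_complete : forall V : R -> R, (forall x, continuous V x) ->
  (forall m, RInt (fun x => V x * S m x * rho x) a0 b0 = 0) ->
  forall x, a0 <= x <= b0 -> V x = 0.
Hypothesis e_indep : forall v, rell2 v ->
  (forall x, a0 <= x <= b0 -> synth v x = 0) -> forall n, v n = 0.
Hypothesis Psi_nonzero : forall m, exists n, Psi m n <> 0.

(** Square summability comes from the integral side: by [S_coef], [Psi m n] is an integral of [e n]
    against a bounded function divided by [nu m], so it is dominated by a multiple of [b n]. *)
Lemma Psi_rell2 (m : nat) : rell2 (Psi m).
Proof.
  pose proof (nu_pos m) as Hnu.
  apply ex_series_le_R with (fun n => ((b0 - a0) * R0 * CS m / nu m) ^ 2 * b n ^ 2).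
  - intros n. rewrite Rabs_right by (apply Rle_ge, pow2_ge_0).
    rewrite <- (pow2_abs (Psi m n)), <- Rpow_mult_distr. apply pow_incr.
    split; [apply Rabs_pos |].
    apply Rmult_le_reg_r with (nu m); auto.
    replace (Rabs (Psi m n) * nu m) with (Rabs (nu m * Psi m n)).
    2:{ rewrite Rabs_mult, (Rabs_right (nu m)) by lra. ring. }
    rewrite <- S_coef. eapply Rle_trans.
    + apply (abs_RInt_le_const_all _ a0 b0 (b n * CS m * R0)); [lra | intros x; cont1 |].
      intros x _. rewrite !Rabs_mult, (Rabs_right (rho x)) by apply Rle_ge, rho_bounds.
      pose proof (rho_bounds x). pose proof (e_le n x). pose proof (S_le m x).
      apply Rmult_le_compat; [apply Rmult_le_pos; apply Rabs_pos | lra | | lra].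
      apply Rmult_le_compat; auto; apply Rabs_pos.
    + right. field. lra.
  - apply ex_series_scal_R. exact b_l2.
Qed.
Hint Resolve Psi_rell2 : core.

Lemma gram_Psi (m n : nat) : gram (Psi m) n = nu m * Psi m n.
Proof.
  rewrite gram_eq, <- S_coef by auto. apply RInt_ext. intros x Hx.
  rewrite Rmin_left, Rmax_right in Hx by lra.
  unfold synth. rewrite (is_series_unique _ (S m x)); auto. apply Psi_synth. lra.
Qed.

Lemma dot_scal_r (c : R) (v w : nat -> R) : dot v (fun n => c * w n) = c * dot v w.
Proof. unfold dot. rewrite <- Series_scal_l. apply Series_ext. intros n. ring. Qed.

Lemma dot_lin_r (v w z : nat -> R) (c : R) : rell2 v -> rell2 w -> rell2 z ->
  dot v (fun n => c * w n + z n) = c * dot v w + dot v z.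
Proof.
  intros Hv Hw Hz. unfold dot. rewrite <- Series_scal_l, <- Series_plus.
  - apply Series_ext. intros n. ring.
  - apply ex_series_scal_R. now apply ex_series_mult.
  - now apply ex_series_mult.
Qed.

(** Completeness is transported from functions to sequences. By the adjoint relation, the integral
    of A v against [S m] is [nu m] times the dot product of [Psi m] with [v]; if all of these vanish
    then A v = 0 by completeness, and v = 0 by injectivity of A. *)
Lemma orthogonal_to_Psi (v : nat -> R) : rell2 v -> (forall m, dot (Psi m) v = 0) ->
  forall n, v n = 0.
Proof.
  intros Hv H0. apply e_indep; auto. apply S_complete; [now apply synth_cont |].
  intros m.
  rewrite <- (is_series_unique _ _ (is_series_synth v (S m) (CS m) Hv (S_cont m) (S_le m))).
  transitivity (nu m * dot (Psi m) v); [| rewrite H0; rring].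
  unfold dot. rewrite <- Series_scal_l. apply Series_ext. intros n. rewrite S_coef. ring.
Qed.

Lemma nu_injective (i j : nat) : i <> j -> nu i <> nu j.
Proof.
  assert (G : forall i d, nu (i + d + 1)%nat < nu i).
  { intros p d. induction d as [|d IH].
    - rewrite Nat.add_0_r. apply nu_decr.
    - apply Rlt_trans with (2 := IH). replace (p + Datatypes.S d + 1)%nat with ((p + d + 1) + 1)%nat by lia.
      apply nu_decr. }
  intros Hij. destruct (Nat.lt_total i j) as [L | [E | L]]; [| contradiction |].
  - specialize (G i (j - i - 1)%nat). replace (i + (j - i - 1) + 1)%nat with j in G by lia. lra.
  - specialize (G j (i - j - 1)%nat). replace (j + (i - j - 1) + 1)%nat with i in G by lia. lra.
Qed.

Lemma dot_Psi_orth (i j : nat) : i <> j -> dot (Psi i) (Psi j) = 0.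
Proof.
  intros Hij. pose proof (dot_gram_sym (Psi i) (Psi j) (Psi_rell2 i) (Psi_rell2 j)) as E.
  unfold dot in E. rewrite (Series_ext _ (fun n => nu j * (Psi i n * Psi j n))) in E
    by (intros; rewrite gram_Psi; ring).
  rewrite (Series_ext (fun n => Psi j n * _) (fun n => nu i * (Psi i n * Psi j n))) in E
    by (intros; rewrite gram_Psi; ring).
  rewrite !Series_scal_l in E. fold (dot (Psi i) (Psi j)) in E.
  pose proof (nu_injective i j Hij).
  apply Rmult_eq_reg_l with (nu i - nu j); lra.
Qed.

Lemma dot_Psi_pos (m : nat) : 0 < dot (Psi m) (Psi m).
Proof.
  destruct (Psi_nonzero m) as [n Hn].
  assert (Hex : ex_series (fun j => Psi m j * Psi m j)) by now apply ex_series_mult.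
  apply Rlt_le_trans with (Psi m n * Psi m n).
  - assert (0 < Psi m n ^ 2) by (apply pow2_gt_0; auto). nra.
  - unfold dot. rewrite <- (is_series_unique _ _ (is_series_single (fun j => Psi m j * Psi m j) n)).
    apply Series_le; auto. intros j. assert (0 <= Psi m j * Psi m j) by nra.
    destruct (Nat.eqb j n); lra.
Qed.

Lemma eigenvector_Psi (m : nat) :
  eigenvector gram_op (RtoC (nu m)) (fun n => RtoC (Psi m n)).
Proof.
  split; [| split].
  - apply ell2_parts. split; simpl; auto.
    unfold rell2. apply ex_series_ext with (fun n => 0 * b n ^ 2); [intros; simpl; rring |].
    apply ex_series_scal_R. exact b_l2.
  - destruct (Psi_nonzero m) as [n Hn]. exists n. intros E. apply Hn.
    apply (f_equal fst) in E. exact E.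
  - intros n. unfold gram_op.
    rewrite (gram_ext (fun j => Re _) (Psi m)) by reflexivity. rewrite gram_Psi.
    rewrite (gram_ext (fun j => Im _) (fun j => 0 * b j + 0)) by (intros; simpl; ring).
    replace (gram (fun j => 0 * b j + 0) n) with 0.
    + apply injective_projections; simpl; ring.
    + unfold gram. rewrite (Series_ext _ (fun _ => 0 * 0)) by (intros; ring).
      rewrite Series_scal_l. ring.
Qed.

(* Taking the inner product of [T w = lambda w] with the real vector [Psi m]. *)
Lemma eigenvector_orth (lambda : C) (w : nat -> C) (m : nat) :
  eigenvector gram_op lambda w -> lambda <> RtoC (nu m) ->
  dot (Psi m) (fun n => Re (w n)) = 0 /\ dot (Psi m) (fun n => Im (w n)) = 0.
Proof.
  intros [Hw [_ Hev]] Hl. apply ell2_parts in Hw as [Hr Hi].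
  destruct lambda as [al be].
  set (p := dot (Psi m) (fun n => Re (w n))). set (q := dot (Psi m) (fun n => Im (w n))).
  assert (E : forall v, rell2 v -> dot (Psi m) (gram v) = nu m * dot (Psi m) v).
  { intros v Hv. rewrite dot_gram_sym by auto. rewrite (dot_comm (Psi m) v).
    rewrite <- dot_scal_r. unfold dot. apply Series_ext. intros n. now rewrite gram_Psi. }
  assert (E1 : nu m * p = al * p + - be * q).
  { unfold p at 1. rewrite <- E by auto. unfold p, q. rewrite <- (dot_scal_r (- be)), <- dot_lin_r; auto.
    - unfold dot. apply Series_ext. intros n. f_equal.
      specialize (Hev n). apply (f_equal fst) in Hev. simpl in Hev. rewrite Hev. unfold Re, Im. onR. ring.
    - apply ex_series_ext with (fun n => (- be) ^ 2 * Im (w n) ^ 2); [intros; rring |].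
      now apply ex_series_scal_R. }
  assert (E2 : nu m * q = al * q + be * p).
  { unfold q at 1. rewrite <- E by auto. unfold p, q. rewrite <- (dot_scal_r be), <- dot_lin_r; auto.
    - unfold dot. apply Series_ext. intros n. f_equal.
      specialize (Hev n). apply (f_equal snd) in Hev. simpl in Hev. rewrite Hev. unfold Re, Im. onR. ring.
    - apply ex_series_ext with (fun n => be ^ 2 * Re (w n) ^ 2); [intros; rring |].
      now apply ex_series_scal_R. }
  (* The pair (p, q) solves a homogeneous linear system with this determinant, the squared modulus
     of lambda - nu m. *)
  assert (Hne : (al - nu m) ^ 2 + be ^ 2 <> 0).
  { intros E0. apply Hl. pose proof (pow2_ge_0 (al - nu m)). pose proof (pow2_ge_0 be).
    assert (A1 : al - nu m = 0) by (apply Rsqr_0_uniq; unfold Rsqr; lra).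
    assert (A2 : be = 0) by (apply Rsqr_0_uniq; unfold Rsqr; lra).
    apply injective_projections; simpl; lra. }
  assert (P1 : ((al - nu m) ^ 2 + be ^ 2) * p = 0).
  { transitivity ((al - nu m) * (al * p + - be * q - nu m * p) + be * (al * q + be * p - nu m * q)); [ring |].
    rewrite <- E1, <- E2. ring. }
  assert (P2 : ((al - nu m) ^ 2 + be ^ 2) * q = 0).
  { transitivity ((al - nu m) * (al * q + be * p - nu m * q) - be * (al * p + - be * q - nu m * p)); [ring |].
    rewrite <- E1, <- E2. ring. }
  apply Rmult_integral in P1. apply Rmult_integral in P2. tauto.
Qed.

Lemma eigenvalue_iff (lambda : C) :
  eigenvalue gram_op lambda <-> exists m, lambda = RtoC (nu m).
Proof.
  split.
  - intros [w Hw]. apply NNPP. intros Hno.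
    pose proof Hw as [Hl [[n Hn] _]]. apply ell2_parts in Hl as [Hr Hi].
    assert (G : forall m, dot (Psi m) (fun n => Re (w n)) = 0 /\ dot (Psi m) (fun n => Im (w n)) = 0).
    { intros m. apply (eigenvector_orth lambda); auto. intros E. apply Hno. now exists m. }
    apply Hn. apply injective_projections; simpl.
    + apply (orthogonal_to_Psi (fun n => Re (w n))); auto. apply G.
    + apply (orthogonal_to_Psi (fun n => Im (w n))); auto. apply G.
  - intros [m ->]. eexists. apply eigenvector_Psi.
Qed.

(** Subtracting from an eigenvector its projection onto [Psi m] leaves a vector orthogonal to every
    [Psi j], hence zero; real and imaginary parts are treated separately. *)
Lemma eigenvalue_simple (lambda : C) :
  eigenvalue gram_op lambda -> simple_eigenvalue gram_op lambda.
Proof.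
  intros Hl. apply eigenvalue_iff in Hl as [m ->].
  exists (fun n => RtoC (Psi m n)). split; [apply eigenvector_Psi |].
  intros w Hw. pose proof Hw as [Hl _]. apply ell2_parts in Hl as [Hr Hi].
  pose proof (dot_Psi_pos m) as HP. set (P := dot (Psi m) (Psi m)) in *.
  assert (G : forall v, rell2 v -> (forall j, j <> m -> dot (Psi j) v = 0) ->
     forall n, - (dot (Psi m) v / P) * Psi m n + v n = 0).
  { intros v Hv Hj. apply (orthogonal_to_Psi (fun n => - (dot (Psi m) v / P) * Psi m n + v n)).
    - now apply rell2_lin.
    - intros j. rewrite dot_lin_r by auto. destruct (Nat.eq_dec j m) as [-> | NE].
      + fold P. field. lra.
      + rewrite (dot_Psi_orth j m), (Hj j) by auto. ring. }
  assert (Ho : forall j, j <> m ->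
    dot (Psi j) (fun n => Re (w n)) = 0 /\ dot (Psi j) (fun n => Im (w n)) = 0).
  { intros j NE. apply (eigenvector_orth (RtoC (nu m))); auto. intros E.
    apply (nu_injective j m NE). apply (f_equal fst) in E. simpl in E. auto. }
  exists (dot (Psi m) (fun n => Re (w n)) / P, dot (Psi m) (fun n => Im (w n)) / P).
  intros n.
  pose proof (G _ Hr (fun j NE => proj1 (Ho j NE)) n) as G1.
  pose proof (G _ Hi (fun j NE => proj2 (Ho j NE)) n) as G2. cbv beta in G1, G2.
  unfold Re in G1 at 2. unfold Im in G2 at 2.
  apply injective_projections; cbn [fst snd Cmult RtoC]; lra.
Qed.

Lemma gram_spectral_theorem :
  exists T : operator,
    represents H T /\ positive_op T /\ trace_class T
    /\ (forall lambda : C, eigenvalue T lambda -> simple_eigenvalue T lambda)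
    /\ eigenvalues_enumerated T nu
    /\ (forall m : nat, eigenvector T (RtoC (nu m)) (fun n => RtoC (Psi m n))).
Proof.
  exists gram_op. split; [apply gram_op_represents |].
  split; [apply gram_op_positive |]. split; [apply gram_op_trace_class |].
  split; [apply eigenvalue_simple |]. split; [| apply eigenvector_Psi].
  split; [| apply eigenvalue_iff].
  intros m. rewrite <- Nat.add_1_r. apply nu_decr.
Qed.

End Spectrum.

End GramOperator.

(** * Gamma function and hypergeometric integrals *)

(** Serves two improper integrals: Euler's integral with [D] the positive half-line, and the
    elliptic integral singular at 1 with [D] the interval (-1, 1). At the ends only limits of the
    antiderivative are required. *)
Lemma is_RInt_gen_antiderivative (Fa Fb : (R -> Prop) -> Prop) {FFa : Filter Fa} {FFb : Filter Fb}
  (f Phi : R -> R) (D : R -> Prop) (la lb : R) :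
  (forall x, D x -> is_derive Phi x (f x)) -> (forall x, D x -> continuous f x) ->
  (forall a b x, D a -> D b -> Rmin a b <= x <= Rmax a b -> D x) ->
  Fa D -> Fb D -> filterlim Phi Fa (locally la) -> filterlim Phi Fb (locally lb) ->
  is_RInt_gen f Fa Fb (lb - la).
Proof.
  intros Hd Hc HD Da Db La Lb P [eps HP].
  assert (He : 0 < eps / 2) by (destruct eps; simpl; lra).
  pose proof (proj1 (filterlim_locally Phi la) La (mkposreal _ He)) as A1.
  pose proof (proj1 (filterlim_locally Phi lb) Lb (mkposreal _ He)) as A2.
  apply Filter_prod with (fun x => D x /\ ball la (mkposreal _ He) (Phi x))
                         (fun x => D x /\ ball lb (mkposreal _ He) (Phi x)).
  - now apply filter_and.
  - now apply filter_and.
  - intros a b [D1 B1] [D2 B2]. exists (Phi b - Phi a). split.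
    + apply (is_RInt_derive (V := R_CompleteNormedModule) Phi f).
      * intros x Hx. apply Hd. now apply (HD a b).
      * intros x Hx. apply Hc. now apply (HD a b).
    + apply HP. unfold ball in *; simpl in *. unfold AbsRing_ball, abs, minus, plus, opp in *.
      simpl in *. apply Rabs_def2 in B1. apply Rabs_def2 in B2. apply Rabs_def1; lra.
Qed.

(** * The Gaussian integral and Gamma at half-integers *)

Definition gauss_erf (x : R) : R := RInt (fun t => exp (- t ^ 2)) 0 x.

Lemma is_derive_gauss_erf (x : R) : is_derive gauss_erf x (exp (- x ^ 2)).
Proof.
  assert (Hc : forall y, continuous (fun t => exp (- t ^ 2)) y) by (intros y; cont1).
  apply (is_derive_RInt (V := R_NormedModule) (fun t => exp (- t ^ 2)) _ 0); [| apply Hc].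
  apply filter_forall. intros b. apply (RInt_correct (V := R_CompleteNormedModule)).
  now apply ex_RInt_continuous_all.
Qed.

Lemma gauss_erf_nonneg (x : R) : 0 <= x -> 0 <= gauss_erf x.
Proof.
  intros Hx. replace 0 with ((x - 0) * 0) by ring. apply RInt_ge_const; auto.
  - intros y. cont1.
  - intros y _. left. apply exp_pos.
Qed.

(* Chosen so that [gauss_erf ^ 2 + gauss_aux] has zero derivative. *)
Definition gauss_aux (x : R) : R := RInt (fun t => exp (- x ^ 2 * (1 + t ^ 2)) / (1 + t ^ 2)) 0 1.

Lemma is_derive_gauss_aux (x : R) :
  is_derive gauss_aux x (- (2 * exp (- x ^ 2) * gauss_erf x)).
Proof.
  evar_last.
  - apply (is_derive_RInt_param_all (fun x t => exp (- x ^ 2 * (1 + t ^ 2)) / (1 + t ^ 2))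
      (fun x t => - 2 * x * exp (- x ^ 2 * (1 + t ^ 2)))).
    + intros u t. pose proof (one_plus_sqr_pos t). auto_derive; auto.
      match goal with |- context [exp ?v] => replace v with (- u ^ 2 * (1 + t ^ 2)) by ring end.
      field. nra.
    + intros t. cont2. apply continuity_pt_of_continuous, continuous_exp.
    + intros u t. cont1.
  (* The summand [+ 0] puts the integrand in the affine form expected by linear substitution. *)
  - rewrite (RInt_ext_all _ (fun t => - 2 * exp (- x ^ 2) * (x * exp (- (x * t + 0) ^ 2)))).
    + rewrite RInt_scal_all by (intros t; cont1).
      assert (E : RInt (fun t => x * exp (- (x * t + 0) ^ 2)) 0 1
                  = RInt (fun t => exp (- t ^ 2)) (x * 0 + 0) (x * 1 + 0)).
      { apply (RInt_comp_lin (V := R_CompleteNormedModule) (fun t => exp (- t ^ 2)) x 0 0 1).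
        apply ex_RInt_continuous_all. intros t. cont1. }
      rewrite E, Rmult_0_r, Rmult_1_r, !Rplus_0_r. unfold gauss_erf. rring.
    + intros t. replace (- x ^ 2 * (1 + t ^ 2)) with (- x ^ 2 + - (x * t + 0) ^ 2) by ring.
      rewrite exp_plus. ring.
Qed.

Lemma gauss_erf_sqr (x : R) : 0 <= x -> gauss_erf x ^ 2 + gauss_aux x = PI / 4.
Proof.
  intros Hx.
  assert (E : gauss_erf 0 ^ 2 + gauss_aux 0 = gauss_erf x ^ 2 + gauss_aux x).
  { apply (eq_of_derive_zero (fun x => gauss_erf x ^ 2 + gauss_aux x)); auto.
    intros y _. auto_derive.
    - split; [eexists; apply is_derive_gauss_erf | split; [eexists; apply is_derive_gauss_aux | easy]].
    - subst_Derive (is_derive_gauss_erf y). subst_Derive (is_derive_gauss_aux y). ring. }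
  rewrite <- E. unfold gauss_erf, gauss_aux.
  rewrite (RInt_point (V := R_CompleteNormedModule)).
  rewrite (RInt_ext_all _ (fun t => / (1 + t ^ 2))).
  - rewrite (RInt_antiderivative atan).
    + rewrite atan_1, atan_0. unfold zero; simpl. ring.
    + intros t. auto_derive; auto. unfold Rsqr. field. nra.
    + intros t. cont1.
  - intros t. replace (- 0 ^ 2 * (1 + t ^ 2)) with 0 by ring. rewrite exp_0. unfold Rdiv. ring.
Qed.

Lemma gauss_aux_bounds (x : R) : 0 < x -> 0 <= gauss_aux x <= / x.
Proof.
  intros Hx.
  assert (Hc : forall t, continuous (fun t => exp (- x ^ 2 * (1 + t ^ 2)) / (1 + t ^ 2)) t)
    by (intros t; cont1).
  assert (Hp : forall t, 0 <= exp (- x ^ 2 * (1 + t ^ 2)) / (1 + t ^ 2)).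
  { intros t. pose proof (one_plus_sqr_pos t). pose proof (exp_pos (- x ^ 2 * (1 + t ^ 2))).
    apply Rdiv_le_0_compat; lra. }
  split.
  - replace 0 with ((1 - 0) * 0) by ring. apply RInt_ge_const; auto. lra.
  - eapply Rle_trans; [apply Rle_abs |]. replace (/ x) with ((1 - 0) * / x) by ring.
    apply abs_RInt_le_const_all; auto; [lra |]. intros t _. rewrite Rabs_right by (apply Rle_ge, Hp).
    pose proof (one_plus_sqr_pos t) as Ht.
    assert (E1 : exp (- x ^ 2 * (1 + t ^ 2)) <= / x).
    { rewrite Ropp_mult_distr_l_reverse, exp_Ropp. apply Rinv_le_contravar; auto.
      pose proof (exp_ineq1_le (x ^ 2 * (1 + t ^ 2))). nra. }
    apply Rle_trans with (2 := E1). unfold Rdiv.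
    rewrite <- (Rmult_1_r (exp _)) at 2. apply Rmult_le_compat_l; [left; apply exp_pos |].
    rewrite <- Rinv_1. apply Rinv_le_contravar; nra.
Qed.

Lemma gauss_erf_limit : is_lim gauss_erf p_infty (sqrt PI / 2).
Proof.
  pose proof PI_RGT_0.
  assert (L : is_lim gauss_aux p_infty 0).
  { apply (is_lim_le_le_loc (fun _ => 0) Rinv).
    - exists 0. intros x Hx. now apply gauss_aux_bounds.
    - apply is_lim_const.
    - apply (is_lim_inv (fun x => x) p_infty p_infty); [apply is_lim_id | easy]. }
  apply is_lim_ext_loc with (fun x => sqrt (PI / 4 - gauss_aux x)).
  - exists 0. intros x Hx. rewrite <- (gauss_erf_sqr x) by lra.
    replace (_ + _ - _) with (gauss_erf x ^ 2) by ring. apply sqrt_pow2. apply gauss_erf_nonneg. lra.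
  - replace (sqrt PI / 2) with (sqrt (PI / 4 - 0)).
    + apply (filterlim_comp R R R (fun x => PI / 4 - gauss_aux x) sqrt _ (locally (PI / 4 - 0))).
      * change (is_lim (fun x => PI / 4 - gauss_aux x) p_infty (PI / 4 - 0)).
        apply (is_lim_minus (fun _ => PI / 4) gauss_aux p_infty (PI / 4) 0);
          [apply is_lim_const | exact L | reflexivity].
      * apply continuous_sqrt.
    + rewrite Rminus_0_r, sqrt_div_alt by lra. replace 4 with (2 ^ 2) by ring.
      rewrite sqrt_pow2 by lra. reflexivity.
Qed.

Lemma exp_nondecreasing (x y : R) : x <= y -> exp x <= exp y.
Proof. intros [H | ->]; [left; now apply exp_increasing | lra]. Qed.

Lemma Rpower_lim_0 (a : R) : 0 < a ->
  filterlim (fun t => Rpower t a * exp (- t)) (at_right 0) (locally 0).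
Proof.
  intros Ha. apply filterlim_locally. intros eps.
  pose proof (exp_pos (/ a * ln eps)) as Hd.
  exists (mkposreal _ Hd). intros t Ht Ht0. unfold ball in *; simpl in *.
  unfold AbsRing_ball, abs, minus, plus, opp in *; simpl in *.
  rewrite Ropp_0, Rplus_0_r in *. rewrite Rabs_right in Ht by lra.
  assert (H1 : 0 < Rpower t a) by apply exp_pos. pose proof (exp_pos (- t)).
  rewrite Rabs_right by nra.
  assert (H2 : Rpower t a < eps).
  { rewrite <- (exp_ln eps (cond_pos eps)). unfold Rpower. apply exp_increasing.
    apply ln_increasing in Ht; auto. rewrite ln_exp in Ht.
    apply Rmult_lt_reg_l with (/ a); [now apply Rinv_0_lt_compat |].
    rewrite <- Rmult_assoc, Rinv_l by lra. lra. }
  assert (exp (- t) < exp 0) by (apply exp_increasing; lra). rewrite exp_0 in *. nra.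
Qed.

Lemma ln_le_sub_1 (x : R) : 0 < x -> ln x <= x - 1.
Proof. intros Hx. pose proof (exp_ineq1_le (ln x)). rewrite exp_ln in *; lra. Qed.

Lemma Rpower_exp_lim_p (a : R) : 0 < a ->
  is_lim (fun t => Rpower t a * exp (- t)) p_infty 0.
Proof.
  (* [C] is the maximum of t^b exp (- t), attained at t = b; the surplus power of t becomes the
     decay 1/t. *)
  intros Ha. set (b := a + 1). set (C := exp (b * ln b - b)).
  apply (is_lim_le_le_loc (fun _ => 0) (fun t => C * / t)).
  - exists 0. intros t Ht. split.
    + left. apply Rmult_lt_0_compat; apply exp_pos.
    + apply Rmult_le_reg_r with t; auto. replace (C * / t * t) with C by (field; lra).
      replace (Rpower t a * exp (- t) * t) with (exp (a * ln t + - t + ln t))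
        by (rewrite !exp_plus, exp_ln by auto; reflexivity).
      apply exp_nondecreasing.
      assert (Hb : 0 < b) by (unfold b; lra).
      pose proof (ln_le_sub_1 (t / b) (Rdiv_lt_0_compat _ _ Ht Hb)) as H.
      rewrite ln_div in H by auto.
      assert (b * (ln t - ln b) <= b * (t / b - 1)) by (apply Rmult_le_compat_l; lra).
      replace (b * (t / b - 1)) with (t - b) in * by (field; lra).
      replace (a * ln t + - t + ln t) with (b * ln t - t) by (unfold b; ring). lra.
  - apply is_lim_const.
  - replace (Finite 0) with (Rbar_mult C (Rbar_inv p_infty)) by (simpl; f_equal; ring).
    apply is_lim_scal_l. apply (is_lim_inv (fun t => t)); [apply is_lim_id | easy].
Qed.

(** The functional equation of Gamma at the level of antiderivatives: integration by parts sends Phi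
    to -t^a exp (- t) + a Phi, and the substitution s = sqrt t gives the starting one. The limits at
    both ends are carried along, so convergence of Euler's integral comes out together with its
    value. *)
Lemma gamma_antiderivative (n : nat) : exists Phi : R -> R,
  (forall t, 0 < t -> is_derive Phi t (Rpower t (INR n + 1 / 2 - 1) * exp (- t))) /\
  filterlim Phi (at_right 0) (locally 0) /\
  is_lim Phi p_infty (sqrt PI * pochhammer (1 / 2) n).
Proof.
  induction n as [|n [Phi [Hd [H0 Hp]]]].
  - exists (fun t => 2 * gauss_erf (sqrt t)). split; [| split].
    + intros t Ht. assert (Hs : 0 < sqrt t) by now apply sqrt_lt_R0.
      replace (Rpower t (INR 0 + 1 / 2 - 1)) with (/ sqrt t).
      2:{ rewrite <- (Rpower_sqrt t Ht), <- Rpower_Ropp. f_equal. simpl. field. }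
      auto_derive.
      * split; [eexists; apply is_derive_gauss_erf | auto].
      * subst_Derive (is_derive_gauss_erf (sqrt t)). rewrite pow2_sqrt by lra. field. lra.
    + replace 0 with (2 * gauss_erf (sqrt 0)) at 2.
      2:{ rewrite sqrt_0. unfold gauss_erf. rewrite (RInt_point (V := R_CompleteNormedModule)).
          unfold zero; simpl. ring. }
      intros P HP. apply filter_le_within. revert P HP.
      {  change (continuous (fun t => 2 * gauss_erf (sqrt t)) 0).
        apply (continuous_mult (K := R_AbsRing) (fun _ => 2)); [apply continuous_const |].
        apply (continuous_comp sqrt gauss_erf); [apply continuous_sqrt |].
        eapply continuous_of_is_derive, is_derive_gauss_erf. }
    + replace (Finite (sqrt PI * pochhammer (1 / 2) 0)) with (Rbar_mult 2 (sqrt PI / 2))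
        by (simpl; f_equal; field).
      apply is_lim_scal_l.
      apply (filterlim_comp R R R sqrt gauss_erf _ (Rbar_locally' p_infty)).
      * apply filterlim_sqrt_p.
      * apply gauss_erf_limit.
  - set (a := INR n + 1 / 2) in *. assert (Ha : 0 < a) by (unfold a; pose proof (pos_INR n); lra).
    exists (fun t => - (Rpower t a * exp (- t)) + a * Phi t).
    replace (INR (S n) + 1 / 2 - 1) with a by (rewrite S_INR; unfold a; ring).
    split; [| split].
    + intros t Ht. specialize (Hd t Ht).
      assert (E : Rpower t a = Rpower t (a - 1) * t).
      { rewrite <- (Rpower_1 t Ht) at 3. rewrite <- Rpower_plus. f_equal. ring. }
      assert (D : is_derive (fun t => Rpower t a) t (a * Rpower t (a - 1))).
      { apply is_derive_Reals. now apply derivable_pt_lim_power. }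
      auto_derive.
      * split; [eexists; apply D | split; [eexists; apply Hd | easy]].
      * subst_Derive Hd.
        replace (Derive (fun x => Rpower x a) t) with (a * Rpower t (a - 1))
          by (symmetry; now apply is_derive_unique).
        rewrite E. ring.
    + replace 0 with (- 0 + a * 0) at 2 by ring.
      apply (filterlim_comp_2 (fun t => - (Rpower t a * exp (- t))) (fun t => a * Phi t) Rplus
               (G := locally (- 0)) (H := locally (a * 0))).
      * apply (filterlim_comp R R R _ Ropp _ (locally 0)); [now apply Rpower_lim_0 |].
        apply (filterlim_opp (V := R_NormedModule)).
      * apply (filterlim_comp R R R Phi (fun u => a * u) _ (locally 0)); [exact H0 |].
        apply (filterlim_scal_r (V := R_NormedModule) a 0).
      * apply (filterlim_plus (V := R_NormedModule)).
    + replace (Finite (sqrt PI * pochhammer (1 / 2) (S n)))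
        with (Finite (- 0 + a * (sqrt PI * pochhammer (1 / 2) n)))
        by (simpl; f_equal; unfold a; ring).
      apply (is_lim_plus (fun t => - (Rpower t a * exp (- t))) (fun t => a * Phi t) p_infty
               (Finite (- 0)) (Finite (a * (sqrt PI * pochhammer (1 / 2) n)))); [| | reflexivity].
      * apply (is_lim_opp _ p_infty 0). now apply Rpower_exp_lim_p.
      * apply (is_lim_scal_l Phi a p_infty (Finite (sqrt PI * pochhammer (1 / 2) n))). exact Hp.
Qed.

Lemma Gamma_half (n : nat) : Gamma (INR n + 1 / 2) = sqrt PI * pochhammer (1 / 2) n.
Proof.
  destruct (gamma_antiderivative n) as [Phi [Hd [H0 Hp]]].
  unfold Gamma. apply is_RInt_gen_unique.
  rewrite <- (Rminus_0_r (sqrt PI * _)).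
  apply (is_RInt_gen_antiderivative (at_right 0) (Rbar_locally p_infty) _ Phi (fun t => 0 < t)); auto.
  - intros t Ht. apply continuous_ex_derive.
    unfold Rpower. auto_derive. auto.
  - intros a b x Ha Hb [Hx _]. apply Rlt_le_trans with (2 := Hx). now apply Rmin_glb_lt.
  - exists (mkposreal 1 Rlt_0_1). intros y _ Hy. exact Hy.
  - exists 0. auto.
Qed.

(** * Pochhammer symbols and the binomial series *)

Lemma pochhammer_add (a : R) (p n : nat) :
  pochhammer a (p + n) = pochhammer a p * pochhammer (a + INR p) n.
Proof.
  induction n as [|n IH].
  - rewrite Nat.add_0_r. simpl. ring.
  - rewrite Nat.add_succ_r. simpl. rewrite IH, plus_INR. ring.
Qed.

Lemma fact_add (p n : nat) :
  INR (fact (p + n)) = INR (fact p) * pochhammer (INR p + 1) n.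
Proof.
  induction n as [|n IH].
  - rewrite Nat.add_0_r. simpl. ring.
  - rewrite Nat.add_succ_r, fact_simpl, mult_INR, IH, S_INR, plus_INR. simpl. ring.
Qed.

Lemma pochhammer_pos (a : R) (n : nat) : 0 < a -> 0 < pochhammer a n.
Proof.
  intros Ha. induction n as [|n IH]; simpl; [lra |].
  apply Rmult_lt_0_compat; auto. pose proof (pos_INR n). lra.
Qed.

(** The Taylor coefficients of (1 - z)^(-a). *)
Definition binom_coef (a : R) (n : nat) : R := pochhammer a n / INR (fact n).

Lemma binom_coef_succ (a : R) (n : nat) :
  INR (S n) * binom_coef a (S n) = (a + INR n) * binom_coef a n.
Proof.
  unfold binom_coef. rewrite fact_simpl, mult_INR. cbn [pochhammer].
  field. split; [apply INR_fact_neq_0 | apply not_0_INR; lia].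
Qed.

Lemma binom_coef_le (a : R) (n : nat) : Rabs a <= 1 -> Rabs (binom_coef a n) <= 1.
Proof.
  intros Ha. apply Rabs_le_between in Ha. induction n as [|n IH].
  - unfold binom_coef. simpl. rewrite Rdiv_1_r, Rabs_R1. lra.
  - assert (Hn : 0 < INR (S n)) by (apply lt_0_INR; lia).
    apply Rmult_le_reg_l with (INR (S n)); auto.
    rewrite <- (Rabs_right (INR (S n))) at 1 by lra.
    rewrite <- Rabs_mult, binom_coef_succ, Rabs_mult.
    rewrite S_INR in *. pose proof (pos_INR n).
    assert (Rabs (a + INR n) <= INR n + 1) by (apply Rabs_le; lra).
    pose proof (Rabs_pos (a + INR n)). pose proof (Rabs_pos (binom_coef a n)). nra.
Qed.

Lemma CV_radius_ge_1 (a : nat -> R) (M : R) : (forall n, Rabs (a n) <= M) ->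
  Rbar_le 1 (CV_radius a).
Proof.
  intros Ha. apply (CV_radius_bounded a). exists M. intros n. now rewrite pow1, Rmult_1_r.
Qed.

(** The two-term recurrence of the coefficients says (1 - x) f' = a f, so f times (1 - x)^a is
    constant. For |a| <= 1 the coefficients are bounded by 1, which settles the radius of
    convergence. *)
Lemma binomial_series (a z : R) : Rabs a <= 1 -> 0 <= z < 1 ->
  PSeries (binom_coef a) z = Rpower (1 - z) (- a).
Proof.
  intros Ha Hz. set (f := PSeries (binom_coef a)).
  assert (Hr : forall x, 0 <= x <= z -> Rbar_lt (Rabs x) (CV_radius (binom_coef a))).
  { intros x Hx. apply Rbar_lt_le_trans with 1.
    - simpl. rewrite Rabs_right; lra.
    - apply (CV_radius_ge_1 _ 1). intros n. now apply binom_coef_le. }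
  assert (Hd : forall x, 0 <= x <= z -> is_derive f x (PSeries (PS_derive (binom_coef a)) x)).
  { intros x Hx. apply is_derive_PSeries. now apply Hr. }
  assert (Hode : forall x, 0 <= x <= z ->
     (1 - x) * PSeries (PS_derive (binom_coef a)) x = a * f x).
  { intros x Hx.
    assert (Hex : ex_pseries (PS_derive (binom_coef a)) x).
    { apply CV_radius_inside. rewrite CV_radius_derive. now apply Hr. }
    assert (Hex0 : ex_pseries (binom_coef a) x) by (apply CV_radius_inside; now apply Hr).
    rewrite Rmult_minus_distr_r, Rmult_1_l, <- PSeries_incr_1.
    unfold f. rewrite <- PSeries_scal.
    rewrite <- PSeries_minus; auto.
    - apply PSeries_ext. intros n. unfold PS_minus, PS_plus, PS_opp, PS_scal, PS_incr_1, PS_derive.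
      unfold plus, opp, scal; simpl. unfold mult; simpl.
      destruct n as [|n].
      + pose proof (binom_coef_succ a 0) as E. simpl in E. unfold zero; simpl. lra.
      + pose proof (binom_coef_succ a (S n)) as E. simpl INR in *.
        change (match n with O => 1 | S _ => INR n + 1 end) with (INR (S n)) in *. lra.
    - now apply ex_pseries_incr_1. }
  assert (E : f 0 * exp (a * ln (1 - 0)) = f z * exp (a * ln (1 - z))).
  { apply (eq_of_derive_zero (fun x => f x * exp (a * ln (1 - x)))); [lra |].
    intros x Hx. auto_derive.
    - split; [eexists; now apply Hd | split; [lra | easy]].
    - subst_Derive (Hd x Hx). specialize (Hode x Hx).
      replace (1 + - x) with (1 - x) by ring.
      replace (PSeries (PS_derive (binom_coef a)) x) with (a * f x / (1 - x)).
      + field. lra.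
      + rewrite <- Hode. field. lra. }
  rewrite Rminus_0_r, ln_1, Rmult_0_r, exp_0, Rmult_1_r in E.
  assert (E0 : f 0 = 1).
  { unfold f. rewrite PSeries_0. unfold binom_coef. simpl. field. }
  rewrite E0 in E. unfold Rpower. rewrite Ropp_mult_distr_l_reverse, exp_Ropp.
  apply Rmult_eq_reg_r with (exp (a * ln (1 - z))); [| apply Rgt_not_eq, exp_pos].
  rewrite Rinv_l by apply Rgt_not_eq, exp_pos. auto.
Qed.

Lemma wallis (n : nat) :
  RInt (fun y => sin y ^ (2 * n)) 0 (PI / 2) = PI / 2 * (pochhammer (1 / 2) n / INR (fact n)).
Proof.
  induction n as [|n IH].
  - rewrite (RInt_ext_all _ (fun _ => 1)) by (intros; reflexivity).
    rewrite RInt_const. scalR. simpl. onR. field.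
  - assert (E : RInt (fun y => (2 * INR n + 1) * sin y ^ (2 * n) - (2 * INR n + 2) * sin y ^ (2 * S n))
                  0 (PI / 2) = 0).
    { rewrite (RInt_antiderivative (fun y => sin y ^ (2 * n + 1) * cos y)).
      - rewrite cos_PI2, sin_0, pow_i by lia. rring.
      - intros y. pose proof (is_derive_sin_pow (2 * n + 1) y ltac:(lia)) as D.
        evar_last.
        { apply (is_derive_mult (K := R_AbsRing) (fun y => sin y ^ (2 * n + 1)) cos);
            [exact D | apply is_derive_cos | intros; apply Rmult_comm]. }
        match goal with |- plus (mult ?A ?B) (mult ?C ?E) = _ =>
          change (A * B + C * E = (2 * INR n + 1) * sin y ^ (2 * n) - (2 * INR n + 2) * sin y ^ (2 * S n)) end.
        replace (2 * n + 1 - 1)%nat with (2 * n)%nat by lia.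
        replace (2 * S n)%nat with (2 * n + 2)%nat by lia.
        rewrite !pow_add, plus_INR, mult_INR. simpl INR.
        pose proof (sin2_cos2 y) as E. unfold Rsqr in E.
        transitivity (sin y ^ (2 * n) * ((2 * INR n + 1) * (cos y * cos y) - sin y ^ 2)); [simpl; ring |].
        replace (cos y * cos y) with (1 - sin y ^ 2) by lra. ring.
      - intros y. cont1. }
    rewrite RInt_minus_all, !RInt_scal_all, IH in E by (intros y; cont1).
    rewrite fact_simpl, mult_INR, S_INR. simpl pochhammer. pose proof (pos_INR n).
    pose proof (INR_fact_neq_0 n).
    apply Rmult_eq_reg_l with (2 * INR n + 2); [| lra].
    match type of E with ?A - ?B = 0 => change (B = (2 * INR n + 2) *
      (PI / 2 * (pochhammer (1 / 2) n * (1 / 2 + INR n) / ((INR n + 1) * INR (fact n))))) ;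
      transitivity A; [lra |] end.
    field. split; lra.
Qed.

Lemma wallis_cos (n : nat) :
  RInt (fun y => sin y ^ (2 * n) * cos y ^ 2) 0 (PI / 2)
  = PI / 4 * (pochhammer (1 / 2) n / INR (fact (n + 1))).
Proof.
  rewrite (RInt_ext_all _ (fun y => sin y ^ (2 * n) - sin y ^ (2 * S n))).
  - rewrite RInt_minus_all, !wallis by (intros y; cont1).
    replace (n + 1)%nat with (S n) by lia. rewrite fact_simpl, mult_INR, S_INR. simpl pochhammer.
    pose proof (pos_INR n). pose proof (INR_fact_neq_0 n). onR. field. lra.
  - intros y. replace (2 * S n)%nat with (2 * n + 2)%nat by lia. rewrite pow_add.
    rewrite cos_sqr. ring.
Qed.

(** * Hypergeometric values as elliptic integrals *)

Section HypergeometricIntegral.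

Variable k : R.
Hypothesis hk : 0 < k < 1.

Lemma dn_binomial (y : R) :
  Series (fun j => binom_coef (1 / 2) j * (k ^ 2 * sin y ^ 2) ^ j) = / dn k y /\
  Series (fun j => binom_coef (- (1 / 2)) j * (k ^ 2 * sin y ^ 2) ^ j) = dn k y.
Proof.
  pose proof (dn_radicand_pos k hk y) as Hd.
  assert (Hz : 0 <= k ^ 2 * sin y ^ 2 < 1).
  { split; [apply Rmult_le_pos; apply pow2_ge_0 | lra]. }
  assert (A1 : Rabs (1 / 2) <= 1) by (rewrite Rabs_right; lra).
  assert (A2 : Rabs (- (1 / 2)) <= 1) by (rewrite Rabs_left; lra).
  split.
  - change (PSeries (binom_coef (1 / 2)) (k ^ 2 * sin y ^ 2) = / dn k y).
    rewrite binomial_series, Rpower_Ropp by auto.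
    replace (1 / 2) with (/ 2) by field. now rewrite Rpower_sqrt.
  - change (PSeries (binom_coef (- (1 / 2))) (k ^ 2 * sin y ^ 2) = dn k y).
    rewrite binomial_series, Ropp_involutive by auto.
    replace (1 / 2) with (/ 2) by field. now rewrite Rpower_sqrt.
Qed.

Lemma binomial_RInt (a : R) (h : R -> R) (N : nat) : Rabs a <= 1 ->
  (forall y, continuous h y) -> (forall y, Rabs (h y) <= 1) ->
  is_series (fun j => binom_coef a j * k ^ (2 * j) * RInt (fun y => sin y ^ (2 * (N + j)) * h y) 0 (PI / 2))
    (RInt (fun y => sin y ^ (2 * N) * h y
        * Series (fun j => binom_coef a j * (k ^ 2 * sin y ^ 2) ^ j)) 0 (PI / 2)).
Proof.
  intros Ha ch Hh.
  rewrite (RInt_ext_all (fun y => _ * Series _)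
    (fun y => Series (fun j => binom_coef a j * k ^ (2 * j) * (sin y ^ (2 * (N + j)) * h y)))).
  - apply is_series_ext with
      (fun j => RInt (fun y => binom_coef a j * k ^ (2 * j) * (sin y ^ (2 * (N + j)) * h y)) 0 (PI / 2)).
    { intros j. rewrite RInt_scal_all by (intros y; cont1). reflexivity. }
    apply (Mtest_RInt (fun j y => binom_coef a j * k ^ (2 * j) * (sin y ^ (2 * (N + j)) * h y))
       (fun j => (k ^ 2) ^ j)).
    + intros j y. cont1.
    + intros j y. rewrite <- pow_mult, !Rabs_mult.
      assert (H1 : 0 <= k ^ (2 * j)) by (apply pow_le; lra).
      rewrite (Rabs_right (k ^ _)) by lra.
      pose proof (binom_coef_le a j Ha). pose proof (Rabs_pos (binom_coef a j)).
      pose proof (Rabs_sin_pow_le (2 * (N + j)) y). pose proof (Rabs_pos (sin y ^ (2 * (N + j)))).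
      pose proof (Hh y). pose proof (Rabs_pos (h y)).
      assert (Rabs (sin y ^ (2 * (N + j))) * Rabs (h y) <= 1) by nra.
      assert (0 <= Rabs (sin y ^ (2 * (N + j))) * Rabs (h y)) by nra.
      assert (Rabs (binom_coef a j) * k ^ (2 * j) <= k ^ (2 * j)) by nra.
      assert (0 <= Rabs (binom_coef a j) * k ^ (2 * j)) by nra. nra.
    + apply ex_series_geom. rewrite Rabs_right; nra.
    + pose proof PI_RGT_0. lra.
  - intros y. rewrite <- Series_scal_l. apply Series_ext. intros j.
    rewrite Rpow_mult_distr, <- !pow_mult, Nat.mul_add_distr_l, pow_add. ring.
Qed.

(** Expand 1/dn by the binomial series and integrate termwise with Wallis' formula. Shifting the
    Pochhammer symbol and the factorial past N + 1 extracts the prefactor and leaves the parameters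
    N + 3/2 and N + 2. *)
Lemma hyp2F1_f1 (N : nat) :
  RInt (fun y => sin y ^ (2 * (N + 1)) / dn k y) 0 (PI / 2)
  = PI / 2 * (pochhammer (1 / 2) (N + 1) / INR (fact (N + 1)))
    * hyp2F1 (INR N + 3 / 2) (1 / 2) (INR N + 2) (k ^ 2).
Proof.
  rewrite (RInt_ext_all _ (fun y => sin y ^ (2 * (N + 1)) * 1
        * Series (fun j => binom_coef (1 / 2) j * (k ^ 2 * sin y ^ 2) ^ j))).
  2:{ intros y. rewrite (proj1 (dn_binomial y)). unfold Rdiv. ring. }
  erewrite <- (is_series_unique _ _ (binomial_RInt (1 / 2) (fun _ => 1) (N + 1) _ _ _)).
  unfold hyp2F1, PSeries. rewrite <- Series_scal_l. apply Series_ext. intros j.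
  rewrite (RInt_ext_all _ (fun y => sin y ^ (2 * (N + 1 + j)))) by (intros; ring).
  rewrite wallis, pochhammer_add, fact_add, pow_mult. unfold binom_coef.
  replace (1 / 2 + INR (N + 1)) with (INR N + 3 / 2) by (rewrite plus_INR; simpl; field).
  replace (INR (N + 1) + 1) with (INR N + 2) by (rewrite plus_INR; simpl; ring).
  pose proof (INR_fact_neq_0 j). pose proof (INR_fact_neq_0 (N + 1)).
  pose proof (pos_INR N). pose proof (pochhammer_pos (INR N + 2) j ltac:(lra)).
  field. repeat split; auto; lra.
  Unshelve.
  - rewrite Rabs_right; lra.
  - intros y. apply continuous_const.
  - intros y. cbv beta. rewrite Rabs_R1. lra.
Qed.

Lemma hyp2F1_f2 (N : nat) :
  RInt (fun y => sin y ^ (2 * N) * cos y ^ 2 * dn k y) 0 (PI / 2)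
  = PI / 4 * (pochhammer (1 / 2) N / INR (fact (N + 1)))
    * hyp2F1 (INR N + 1 / 2) (- (1 / 2)) (INR N + 2) (k ^ 2).
Proof.
  rewrite (RInt_ext_all _ (fun y => sin y ^ (2 * N) * cos y ^ 2
        * Series (fun j => binom_coef (- (1 / 2)) j * (k ^ 2 * sin y ^ 2) ^ j))).
  2:{ intros y. now rewrite (proj2 (dn_binomial y)). }
  erewrite <- (is_series_unique _ _ (binomial_RInt (- (1 / 2)) (fun y => cos y ^ 2) N _ _ _)).
  unfold hyp2F1, PSeries. rewrite <- Series_scal_l. apply Series_ext. intros j.
  rewrite wallis_cos. replace (N + j + 1)%nat with (N + 1 + j)%nat by lia.
  rewrite pochhammer_add, fact_add, pow_mult. unfold binom_coef.
  replace (1 / 2 + INR N) with (INR N + 1 / 2) by ring.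
  replace (INR (N + 1) + 1) with (INR N + 2) by (rewrite plus_INR; simpl; ring).
  pose proof (INR_fact_neq_0 j). pose proof (INR_fact_neq_0 (N + 1)).
  pose proof (pos_INR N). pose proof (pochhammer_pos (INR N + 2) j ltac:(lra)).
  field. repeat split; auto; lra.
  Unshelve.
  - rewrite Rabs_left; lra.
  - intros y. cont1.
  - intros y. cbv beta. pose proof (COS_bound y). rewrite Rabs_right; [nra | apply Rle_ge, pow2_ge_0].
Qed.

End HypergeometricIntegral.

(** * Matrix entries and the substitution x = sin y *)

Lemma is_derive_asin (x : R) : -1 < x < 1 -> is_derive asin x (/ sqrt (1 - x ^ 2)).
Proof.
  intros Hx. apply is_derive_Reals.
  replace (/ sqrt (1 - x ^ 2)) with (derive_pt asin x (derivable_pt_asin x Hx)).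
  - apply (derive_pt_eq_1 asin x _ (derivable_pt_asin x Hx)). reflexivity.
  - rewrite derive_pt_asin, Rsqr_pow2. unfold Rdiv. ring.
Qed.

Lemma asin_at_left_1 : filterlim asin (at_left 1) (locally (PI / 2)).
Proof.
  apply filterlim_locally. intros eps. pose proof PI_RGT_0.
  set (e := Rmin (eps / 2) (PI / 2)).
  assert (He : 0 < e) by (apply Rmin_glb_lt; [destruct eps; simpl; lra | lra]).
  assert (He1 : e <= eps / 2) by apply Rmin_l. assert (He2 : e <= PI / 2) by apply Rmin_r.
  assert (Hs : sin (PI / 2 - e) < 1).
  { rewrite <- sin_PI2. apply sin_increasing_1; lra. }
  assert (Hs0 : 0 <= sin (PI / 2 - e)) by (apply sin_ge_0; lra).
  assert (Hd : 0 < 1 - sin (PI / 2 - e)) by lra.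
  exists (mkposreal _ Hd). intros x Hx Hx1. unfold ball in *; simpl in *.
  unfold AbsRing_ball, abs, minus, plus, opp in *; simpl in *.
  rewrite Rabs_left in Hx by lra.
  pose proof (asin_bound x).
  assert (PI / 2 - e < asin x).
  { apply sin_increasing_0; try lra. rewrite sin_asin by lra. lra. }
  pose proof (cond_pos eps). apply Rabs_def1; lra.
Qed.

Section MatrixEntries.

Variable k : R.
Hypothesis hk : 0 < k < 1.

Lemma k_sqr_bounds : 0 < k ^ 2 < 1.
Proof. split; nra. Qed.

Lemma elliptic_RInt_gen (N : nat) :
  is_RInt_gen (fun x : R => x ^ (2 * (N + 1)) / sqrt ((1 - x ^ 2) * (1 - k ^ 2 * x ^ 2)))
    (at_point 0) (at_left 1) (RInt (fun y => sin y ^ (2 * (N + 1)) / dn k y) 0 (PI / 2)).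
Proof.
  set (g := fun y => sin y ^ (2 * (N + 1)) / dn k y).
  assert (cg : forall y, continuous g y) by (intros y; unfold g; cont1).
  set (G := fun y => RInt g 0 y : R).
  assert (dG : forall y, is_derive G y (g y)).
  { intros y. apply (is_derive_RInt (V := R_NormedModule) g _ 0); [| apply cg].
    apply filter_forall. intros b. apply (RInt_correct (V := R_CompleteNormedModule)).
    now apply ex_RInt_continuous_all. }
  assert (E0 : G (asin 0) = 0).
  { rewrite asin_0. apply (RInt_point (V := R_CompleteNormedModule)). }
  pose proof k_sqr_bounds as Hk2.
  assert (Hpos : forall x, -1 < x < 1 -> 0 < 1 - x ^ 2 /\ 0 < 1 - k ^ 2 * x ^ 2).
  { intros x Hx. assert (0 <= x ^ 2 < 1) by (split; nra). split; nra. }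
  change (RInt g 0 (PI / 2)) with (G (PI / 2)). rewrite <- (Rminus_0_r (G (PI / 2))).
  (* [G (asin x)] is an antiderivative on (-1, 1); at x = 1 the arcsine is not differentiable, and
     its limit from the left is used. *)
  apply (is_RInt_gen_antiderivative (at_point 0) (at_left 1) _ (fun x => G (asin x))
           (fun x => -1 < x < 1) 0 (G (PI / 2))).
  - intros x Hx. destruct (Hpos x Hx) as [P1 P2]. evar_last.
    + apply (is_derive_comp (K := R_AbsRing) (V := R_NormedModule) G asin).
      * apply dG.
      * now apply is_derive_asin.
    + scalR. unfold g, dn. rewrite sin_asin, sqrt_mult by lra.
      assert (0 < sqrt (1 - x ^ 2)) by now apply sqrt_lt_R0.
      assert (0 < sqrt (1 - k ^ 2 * x ^ 2)) by now apply sqrt_lt_R0.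
      field. lra.
  - intros x Hx. destruct (Hpos x Hx) as [P1 P2].
    apply (continuous_mult (K := R_AbsRing) (fun x => x ^ (2 * (N + 1)))); [cont1 |].
    apply (continuous_Rinv_comp (fun x => sqrt ((1 - x ^ 2) * (1 - k ^ 2 * x ^ 2)))).
    + apply (continuous_comp (fun x => (1 - x ^ 2) * (1 - k ^ 2 * x ^ 2)) sqrt);
        [cont1 | apply continuous_sqrt].
    + apply Rgt_not_eq, sqrt_lt_R0. now apply Rmult_lt_0_compat.
  - intros a b x Ha Hb [H1 H2]. split.
    + apply Rlt_le_trans with (2 := H1). apply Rmin_glb_lt; lra.
    + apply Rle_lt_trans with (1 := H2). apply Rmax_lub_lt; lra.
  - unfold at_point. lra.
  - exists (mkposreal 1 Rlt_0_1). intros y Hy Hy1. unfold ball in Hy; simpl in Hy.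
    unfold AbsRing_ball, abs, minus, plus, opp in Hy; simpl in Hy. apply Rabs_def2 in Hy. lra.
  - intros P HP. unfold filtermap, at_point. rewrite E0. now apply locally_singleton.
  - apply (filterlim_comp R R R asin G _ (locally (PI / 2))); [apply asin_at_left_1 |].
    apply (continuous_of_is_derive G _ _ (dG (PI / 2))).
Qed.

Lemma elliptic_RInt_sqrt (N : nat) :
  RInt (fun x : R => x ^ (2 * N) * sqrt ((1 - x ^ 2) * (1 - k ^ 2 * x ^ 2))) 0 1
  = RInt (fun y => sin y ^ (2 * N) * cos y ^ 2 * dn k y) 0 (PI / 2).
Proof.
  set (f := fun x : R => x ^ (2 * N) * sqrt ((1 - x ^ 2) * (1 - k ^ 2 * x ^ 2))).
  assert (cf : forall x, continuous f x).
  { intros x. apply (continuous_mult (K := R_AbsRing) (fun x => x ^ (2 * N))); [cont1 |].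
    apply (continuous_comp (fun x => (1 - x ^ 2) * (1 - k ^ 2 * x ^ 2)) sqrt);
      [cont1 | apply continuous_sqrt]. }
  transitivity (RInt f (sin 0) (sin (PI / 2))); [now rewrite sin_0, sin_PI2 |].
  rewrite <- (RInt_comp (V := R_CompleteNormedModule) f sin cos).
  - apply RInt_ext. intros y Hy. pose proof PI_RGT_0.
    rewrite Rmin_left, Rmax_right in Hy by lra. scalR. unfold f.
    assert (Hc : 0 <= cos y) by (apply cos_ge_0; lra).
    rewrite <- cos_sqr.
    pose proof (dn_radicand_pos k hk y).
    rewrite sqrt_mult by (try apply pow2_ge_0; lra).
    rewrite sqrt_pow2 by auto. unfold dn. onR. ring.
  - intros x _. apply cf.
  - intros x _. split; [apply is_derive_sin | apply continuous_cos].
Qed.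

Lemma H_f1_RInt (m n : nat) :
  H_f1 k m n = 2 * k ^ (m + n) / sqrt (PI * (2 * INR m + 1) * (2 * INR n + 1))
    * RInt (fun y => sin y ^ (2 * (m + n + 1)) / dn k y) 0 (PI / 2).
Proof.
  unfold H_f1. rewrite hyp2F1_f1 by auto.
  replace (INR (m + n) + 3 / 2) with (INR (m + n + 1) + 1 / 2) at 1
    by (rewrite (plus_INR (m + n)); simpl; field).
  rewrite Gamma_half. pose proof PI_RGT_0.
  pose proof (pos_INR m). pose proof (pos_INR n).
  rewrite (Rmult_assoc PI), (sqrt_mult PI) by nra.
  assert (0 < sqrt PI) by now apply sqrt_lt_R0.
  assert (0 < sqrt ((2 * INR m + 1) * (2 * INR n + 1))) by (apply sqrt_lt_R0; nra).
  pose proof (INR_fact_neq_0 (m + n + 1)).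
  rewrite <- (pow2_sqrt PI) at 3 by lra. field. repeat split; auto; lra.
Qed.

Lemma H_f2_RInt (m n : nat) :
  H_f2 k m n = 4 * k ^ (m + n) * sqrt ((2 * INR m + 1) * (2 * INR n + 1)) / sqrt PI
    * RInt (fun y => sin y ^ (2 * (m + n)) * cos y ^ 2 * dn k y) 0 (PI / 2).
Proof.
  unfold H_f2. rewrite hyp2F1_f2, Gamma_half by auto. pose proof PI_RGT_0.
  assert (0 < sqrt PI) by now apply sqrt_lt_R0.
  pose proof (INR_fact_neq_0 (m + n + 1)).
  rewrite <- (pow2_sqrt PI) at 3 by lra. field. repeat split; auto; lra.
Qed.

Lemma H_g1_RInt (m n : nat) :
  H_g1 k m n = 4 * k ^ (m + n) * sqrt ((INR m + 1) * (INR n + 1)) / sqrt PI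
    * RInt (fun y => sin y ^ (2 * (m + n + 1)) * cos y ^ 2 * dn k y) 0 (PI / 2).
Proof.
  unfold H_g1. rewrite hyp2F1_f2 by auto.
  replace (INR (m + n) + 3 / 2) with (INR (m + n + 1) + 1 / 2)
    by (rewrite (plus_INR (m + n)); simpl; field).
  replace (INR (m + n) + 3) with (INR (m + n + 1) + 2)
    by (rewrite (plus_INR (m + n)); simpl; ring).
  rewrite Gamma_half. pose proof PI_RGT_0.
  assert (0 < sqrt PI) by now apply sqrt_lt_R0.
  replace (m + n + 1 + 1)%nat with (m + n + 2)%nat by lia.
  pose proof (INR_fact_neq_0 (m + n + 2)).
  rewrite <- (pow2_sqrt PI) at 3 by lra. field. repeat split; auto; lra.
Qed.

End MatrixEntries.

(** * Spectral data *)

Lemma le_Series_term (u : nat -> R) (n : nat) :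
  (forall j, 0 <= u j) -> ex_series u -> u n <= Series u.
Proof.
  intros Hu Hex. rewrite <- (is_series_unique _ _ (is_series_single u n)).
  apply Series_le; auto. intros j. specialize (Hu j). destruct (Nat.eqb j n); lra.
Qed.

(** The sum is known only for 0 < z < 1, so the constant term is found as a limit along a sequence
    tending to 0; dividing the remaining series by z shifts the coefficients and continues the
    induction. *)
Lemma power_series_zero (C : R) (n : nat) : forall a : nat -> R,
  (forall j, Rabs (a j) <= C) ->
  (forall z, 0 < z < 1 -> Series (fun j => a j * z ^ j) = 0) -> a n = 0.
Proof.
  assert (H0 : forall a : nat -> R, (forall j, Rabs (a j) <= C) ->
    (forall z, 0 < z < 1 -> Series (fun j => a j * z ^ j) = 0) -> a 0%nat = 0).
  { intros a Ha Hz. rewrite <- (PSeries_0 a).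
    assert (L : is_lim_seq (fun n => PSeries a (/ 2 * / (INR n + 1))) (PSeries a 0)).
    { apply (is_lim_seq_continuous (PSeries a)); [| apply is_lim_seq_inv_succ].
      apply PSeries_continuity. apply Rbar_lt_le_trans with 1.
      - simpl. rewrite Rabs_R0. lra.
      - now apply CV_radius_ge_1 with C. }
    assert (L0 : is_lim_seq (fun n => PSeries a (/ 2 * / (INR n + 1))) 0).
    { apply is_lim_seq_ext with (fun _ => 0); [| apply is_lim_seq_const].
      intros j. symmetry. apply Hz. pose proof (pos_INR j).
      assert (0 < / (INR j + 1)) by (apply Rinv_0_lt_compat; lra).
      assert (/ (INR j + 1) <= / 1) by (apply Rinv_le_contravar; lra). lra. }
    apply is_lim_seq_unique in L. apply is_lim_seq_unique in L0.
    rewrite L in L0. now injection L0. }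
  induction n as [|n IH]; intros a Ha Hz; [now apply H0 |].
  apply (IH (fun j => a (S j))); auto.
  intros z Hz1. pose proof (Hz z Hz1) as E. pose proof (H0 a Ha Hz) as E0.
  assert (Hex : ex_series (fun j => a j * z ^ j)).
  { apply ex_series_le_R with (fun j => C * z ^ j).
    - intros j. rewrite Rabs_mult. assert (0 <= z ^ j) by (apply pow_le; lra).
      rewrite (Rabs_right (z ^ j)) by lra. apply Rmult_le_compat_r; auto.
    - apply ex_series_scal_R, ex_series_geom. rewrite Rabs_right; lra. }
  rewrite Series_incr_1, E0 in E by auto.
  rewrite (Series_ext _ (fun j => z * (a (S j) * z ^ j))) in E by (intros; simpl; ring).
  rewrite Series_scal_l in E. nra.
Qed.

(** With z = sin^2 y and the common factor [h] divided out, the synthesised function is a power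
    series in z with bounded coefficients. This is the injectivity of A for all three matrices. *)
Lemma synth_independent (e : nat -> R -> R) (c b : nat -> R) (h : R -> R) (v : nat -> R) :
  (forall n y, e n y = c n * sin y ^ (2 * n) * h y) ->
  (forall n, c n <> 0) -> (forall n, Rabs (c n) <= b n) ->
  (forall y, 0 < y < PI / 2 -> h y <> 0) ->
  ex_series (fun n => Rabs (v n) * b n) ->
  (forall y, 0 <= y <= PI / 2 -> synth e v y = 0) -> forall n, v n = 0.
Proof.
  intros He Hc Hcb Hh Hv H0 n. pose proof PI_RGT_0.
  assert (E : v n * c n = 0).
  { apply (power_series_zero (Series (fun n => Rabs (v n) * b n)) n (fun n => v n * c n)).
    - intros j. apply Rle_trans with (Rabs (v j) * b j).
      + rewrite Rabs_mult. apply Rmult_le_compat_l; [apply Rabs_pos | auto].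
      + apply (le_Series_term (fun j => Rabs (v j) * b j)); auto.
        intros i. apply Rmult_le_pos; [apply Rabs_pos |]. apply Rle_trans with (2 := Hcb i), Rabs_pos.
    - intros z Hz. set (y := asin (sqrt z)).
      assert (Hs : 0 < sqrt z < 1).
      { split; [apply sqrt_lt_R0; lra |]. rewrite <- sqrt_1. apply sqrt_lt_1; lra. }
      assert (Esin : sin y = sqrt z) by (apply sin_asin; lra).
      assert (Hy : 0 < y < PI / 2).
      { unfold y. pose proof (asin_bound_lt (sqrt z) ltac:(lra)). split; [| lra].
        apply sin_increasing_0; try lra. rewrite sin_0. fold y. lra. }
      assert (Es : synth e v y = h y * Series (fun j => v j * c j * z ^ j)).
      { unfold synth. rewrite <- Series_scal_l. apply Series_ext. intros j.
        rewrite He, pow_mult, Esin, pow2_sqrt by lra. ring. }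
      rewrite H0 in Es by lra. symmetry in Es. apply Rmult_integral in Es.
      destruct Es as [Es | Es]; auto. now apply Hh in Es. }
  apply Rmult_integral in E. destruct E as [E | E]; auto. now apply Hc in E.
Qed.

Lemma ex_series_pow_linear (k : R) : 0 < k < 1 ->
  ex_series (fun n => k ^ (2 * n) * (2 * INR n + 1)).
Proof.
  intros hk. assert (Hk2 : 0 < k ^ 2 < 1) by (split; nra).
  apply ex_series_Rabs, ex_series_DAlembert with (k ^ 2); [lra | |].
  - intros n. apply Rmult_integral_contrapositive_currified.
    + apply pow_nonzero. lra.
    + pose proof (pos_INR n). lra.
  - apply is_lim_seq_ext with (fun n => k ^ 2 * (1 + 2 * / (2 * INR n + 1))).
    + intros n. replace (2 * S n)%nat with (2 + 2 * n)%nat by lia. rewrite pow_add, S_INR.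
      assert (0 < k ^ (2 * n)) by (apply pow_lt; lra). pose proof (pos_INR n).
      rewrite Rabs_right.
      * field. lra.
      * apply Rle_ge, Rdiv_le_0_compat; [| apply Rmult_lt_0_compat; lra].
        apply Rmult_le_pos; [apply Rmult_le_pos |]; lra.
    + replace (k ^ 2) with (k ^ 2 * (1 + 2 * 0)) at 1 by ring.
      apply (is_lim_seq_scal_l _ (k ^ 2) (1 + 2 * 0)).
      apply is_lim_seq_plus'; [apply is_lim_seq_const |].
      apply (is_lim_seq_scal_l _ 2 0).
      apply is_lim_seq_le_le with (fun _ => 0) (fun n => 1 * / (INR n + 1)).
      * intros n. pose proof (pos_INR n). split.
        -- left. apply Rinv_0_lt_compat. lra.
        -- rewrite Rmult_1_l. apply Rinv_le_contravar; lra.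
      * apply is_lim_seq_const.
      * apply is_lim_seq_inv_succ.
Qed.

Lemma sinh_pos (x : R) : 0 < x -> 0 < sinh x.
Proof. intros Hx. unfold sinh. pose proof (exp_increasing (- x) x ltac:(lra)). lra. Qed.

(** With exp (- x) = q^s, this rewrites the ratio q^s / (1 - q^(2s)) of the eigenvalue formulas in
    the form delivered by the Fourier coefficients. *)
Lemma exp_div_one_minus (x : R) : 0 < x -> exp (- x) / (1 - exp (- (2 * x))) = / (2 * sinh x).
Proof.
  intros Hx. pose proof (sinh_pos x Hx) as Hs.
  assert (E : 1 - exp (- (2 * x)) = exp (- x) * (2 * sinh x)).
  { unfold sinh. replace (exp (- x) * (2 * ((exp x - exp (- x)) / 2)))
      with (exp (- x) * exp x - exp (- x) * exp (- x)) by field.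
    rewrite <- !exp_plus. replace (- x + x) with 0 by ring. rewrite exp_0.
    f_equal. f_equal. ring. }
  rewrite E. pose proof (exp_pos (- x)). field. lra.
Qed.

Lemma cosh_increasing (x y : R) : 0 <= x -> x < y -> cosh x < cosh y.
Proof.
  intros Hx Hy. assert (H1 : exp x < exp y) by now apply exp_increasing.
  assert (H2 : exp (- x + - y) < 1) by (rewrite <- exp_0; apply exp_increasing; lra).
  assert (E : cosh y - cosh x = (exp y - exp x) * (1 - exp (- x + - y)) / 2).
  { unfold cosh. rewrite exp_plus, !exp_Ropp.
    pose proof (exp_pos x). pose proof (exp_pos y). field. lra. }
  assert (0 < (exp y - exp x) * (1 - exp (- x + - y))) by (apply Rmult_lt_0_compat; lra). lra.
Qed.

(** sinh x / x is increasing: the chords of sinh over [0, x] and [x, y] have slopes cosh c1 and cosh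
    c2 with c1 < c2. For [nu_f2] and [nu_g1], whose frequency stands in the numerator, this gives
    the descending order. *)
Lemma mult_sinh_lt (x y : R) : 0 < x -> x < y -> y * sinh x < x * sinh y.
Proof.
  intros Hx Hy.
  destruct (MVT_cor2 sinh cosh 0 x Hx) as [c1 [E1 H1]].
  { intros c _. apply derivable_pt_lim_sinh. }
  destruct (MVT_cor2 sinh cosh x y Hy) as [c2 [E2 H2]].
  { intros c _. apply derivable_pt_lim_sinh. }
  rewrite sinh_0 in E1.
  pose proof (cosh_increasing c1 c2 ltac:(lra) ltac:(lra)) as Hc.
  assert (0 < (y - x) * (x * (cosh c2 - cosh c1))) by (repeat apply Rmult_lt_0_compat; lra).
  nra.
Qed.

Lemma sinh_lt (x y : R) : x < y -> sinh x < sinh y.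
Proof.
  intros H. unfold sinh. pose proof (exp_increasing x y H).
  pose proof (exp_increasing (- y) (- x) ltac:(lra)). lra.
Qed.

Section SpectralData.

Variable k : R.
Hypothesis hk : 0 < k < 1.

Let K : R := ellK k.

Lemma ellK'_pos : 0 < ellK' k.
Proof. apply ellK_pos, compl_modulus_bounds; auto. Qed.

Lemma sinh_freq_pos (l : R) : 0 < l -> 0 < sinh (l * ellK' k).
Proof. intros Hl. apply sinh_pos, Rmult_lt_0_compat; auto. apply ellK'_pos. Qed.

(** * Sine functions with cos (l K) = 0 and the polynomials f_n *)

Section Sine.

Variable l : R.
Hypothesis hl : 0 < l.
Hypothesis Hl : cos (l * K) = 0.

Let C0 (y : R) : R := sin (l * ellF k y).
Let C0' (y : R) : R := l * cos (l * ellF k y).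

Lemma is_derive_sine (y : R) : is_derive C0 y (C0' y / dn k y).
Proof. now apply is_derive_sin_ellF. Qed.

Lemma is_derive_sine' (y : R) : is_derive C0' y (- l ^ 2 * C0 y / dn k y).
Proof.
  evar_last; [apply is_derive_scal; now apply is_derive_cos_ellF |].
  unfold C0, Rdiv. ring.
Qed.

Lemma sine'_PI2 : C0' (PI / 2) = 0.
Proof. unfold C0'. rewrite ellF_PI2. fold K. rewrite Hl. ring. Qed.

Lemma sn_moment : moment k C0 1 = PI / (2 * k * sinh (l * ellK' k)).
Proof.
  pose proof (sn_fourier_coefficient k l hk hl Hl) as E.
  pose proof (sinh_freq_pos l hl) as Hs.
  rewrite <- E. unfold moment.
  rewrite (RInt_ext_all _ (fun y => sn_weight k l y * sin y)).
  - rfield. split; lra.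
  - intros y. unfold sn_weight, C0. ring.
Qed.

Lemma f_moment (n : nat) :
  moment k C0 (2 * n + 1) * k ^ (2 * n) * INR (fact (2 * n))
  = sc_f k n (- l ^ 2) * (PI / (2 * k * sinh (l * ellK' k))).
Proof.
  rewrite <- sn_moment.
  pose proof (moment_formula k l 1 (fun n => sc_f k n (- l ^ 2)) C0 C0' hk ltac:(auto)
    (sc_gen_f k (- l ^ 2)) is_derive_sine is_derive_sine' sine'_PI2) as E.
  replace (2 * n)%nat with (2 * n + 1 - 1)%nat at 3 by lia. apply E.
  - intros _. unfold C0. rewrite ellF_0, Rmult_0_r. apply sin_0.
  - discriminate.
Qed.

Lemma sc_f_bound : exists B, 0 <= B /\
  forall n, Rabs (sc_f k n (- l ^ 2)) <= B * k ^ (2 * n) * INR (fact (2 * n + 1 - 1)).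
Proof.
  apply (sc_bound k l 1 (fun n => sc_f k n (- l ^ 2)) C0 C0' hk ltac:(auto)
    (sc_gen_f k (- l ^ 2)) is_derive_sine is_derive_sine' sine'_PI2).
  - intros _. unfold C0. rewrite ellF_0, Rmult_0_r. apply sin_0.
  - discriminate.
  - intros y. apply Rabs_le, SIN_bound.
  - rewrite sn_moment. pose proof (sinh_freq_pos l hl). pose proof PI_RGT_0.
    apply Rgt_not_eq, Rdiv_lt_0_compat; [lra |]. apply Rmult_lt_0_compat; lra.
Qed.

Lemma f_series (y : R) : 0 <= y ->
  is_series (fun n => sc_f k n (- l ^ 2) / INR (fact (2 * n + 1)) * sin y ^ (2 * n + 1))
    (sin (l * ellF k y) / l) /\
  is_series (fun n => sc_f k n (- l ^ 2) / INR (fact (2 * n + 1 - 1)) * sin y ^ (2 * n + 1 - 1)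
                      * cos y * dn k y) (cos (l * ellF k y)).
Proof.
  intros Hy. destruct sc_f_bound as [B [HB0 HB]].
  assert (D1 : forall y, is_derive (fun y => sin (l * ellF k y) / l) y (cos (l * ellF k y) / dn k y)).
  { intros x. pose proof (dn_neq_0 k hk x). auto_derive; [eexists; now apply is_derive_ellF |].
    subst_Derive (is_derive_ellF k hk x). field. split; auto; lra. }
  assert (D2 : forall y, is_derive (fun y => cos (l * ellF k y)) y
     ((- l ^ 2 * (sin (l * ellF k y) / l) + (INR 1 - 1)) / dn k y)).
  { intros x. pose proof (dn_neq_0 k hk x). evar_last; [now apply is_derive_cos_ellF |].
    simpl INR. field. split; auto; lra. }
  assert (Y0 : sin (l * ellF k 0) / l = 0).
  { rewrite ellF_0, Rmult_0_r, sin_0. field. lra. }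
  assert (Y1 : cos (l * ellF k 0) = 2 - INR 1).
  { rewrite ellF_0, Rmult_0_r, cos_0. simpl. ring. }
  split.
  - apply (sc_series k l 1 (fun n => sc_f k n (- l ^ 2)) _ _ B hk hl ltac:(auto)
      (sc_gen_f k (- l ^ 2)) HB0 HB D1 D2 Y0 Y1 y Hy).
  - apply (sc_series_derive k l 1 (fun n => sc_f k n (- l ^ 2)) _ _ B hk hl ltac:(auto)
      (sc_gen_f k (- l ^ 2)) HB0 HB D1 D2 Y0 Y1 y Hy).
Qed.

(** One integration by parts, with boundary term killed by cos (l K) = 0, reduces the cosine
    integrals of the matrix f'' to the sine moments of f'. This is why both matrices lead to the
    same polynomials. *)
Lemma cn_dn_moment (n : nat) :
  (2 * INR n + 1) * RInt (fun y => sin y ^ (2 * n) * cos y * cos (l * ellF k y)) 0 (PI / 2)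
  = l * moment k C0 (2 * n + 1).
Proof.
  rewrite <- RInt_scal_all by (intros y; cont1).
  rewrite (RInt_ext_all _ (fun y => (INR (2 * n + 1) * sin y ^ (2 * n + 1 - 1) * cos y)
      * cos (l * ellF k y))).
  2:{ intros y. replace (2 * n + 1 - 1)%nat with (2 * n)%nat by lia.
      rewrite plus_INR, mult_INR. simpl INR. ring. }
  rewrite (RInt_by_parts_all (fun y => sin y ^ (2 * n + 1)) (fun y => cos (l * ellF k y)) _
    (fun y => - l * sin (l * ellF k y) / dn k y)).
  - rewrite (RInt_ext_all (fun y => _ * (- l * _ / _))
      (fun y => - l * (C0 y / dn k y * sin y ^ (2 * n + 1)))).
    + rewrite RInt_scal_all by (intros y; unfold C0; cont1). fold (moment k C0 (2 * n + 1)).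
      rewrite ellF_PI2. fold K. rewrite Hl, sin_0, pow_i by lia. rring.
    + intros y. unfold C0, Rdiv. ring.
  - intros y. apply is_derive_sin_pow. lia.
  - intros y. now apply is_derive_cos_ellF.
  - intros y. cont1.
  - intros y. cont1.
Qed.

End Sine.

(** * Cosine functions with sin (l K) = 0 and the polynomials g_n *)

Section Cosine.

Variable l : R.
Hypothesis hl : 0 < l.
Hypothesis Hl : sin (l * K) = 0.

Let C0 (y : R) : R := cos (l * ellF k y).
Let C0' (y : R) : R := - l * sin (l * ellF k y).

Lemma is_derive_cosine (y : R) : is_derive C0 y (C0' y / dn k y).
Proof. now apply is_derive_cos_ellF. Qed.

Lemma is_derive_cosine' (y : R) : is_derive C0' y (- l ^ 2 * C0 y / dn k y).
Proof.
  evar_last; [apply is_derive_scal; now apply is_derive_sin_ellF |].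
  unfold C0, Rdiv. ring.
Qed.

Lemma cosine'_PI2 : C0' (PI / 2) = 0.
Proof. unfold C0'. rewrite ellF_PI2. fold K. rewrite Hl. ring. Qed.

Lemma cosine_int : RInt (fun y => C0 y / dn k y) 0 (PI / 2) = 0.
Proof.
  transitivity (sin (l * K) / l).
  - apply (RInt_cn_weight k l hk hl).
  - rewrite Hl. onR. field. lra.
Qed.

Lemma sn_sqr_moment : moment k C0 2 = - (PI * l) / (2 * k ^ 2 * sinh (l * ellK' k)).
Proof.
  pose proof (sn_sqr_fourier_coefficient k l hk hl Hl) as E.
  pose proof (sinh_freq_pos l hl) as Hs.
  replace (- (PI * l)) with (- PI * l) by ring.
  rewrite <- E. unfold moment.
  rewrite (RInt_ext_all _ (fun y => cn_weight k l y * sin y ^ 2)).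
  - rfield. split; lra.
  - intros y. unfold cn_weight, C0. ring.
Qed.

Lemma g_moment (n : nat) :
  moment k C0 (2 * n + 2) * k ^ (2 * n) * INR (fact (2 * n + 1))
  = sc_g k n (- l ^ 2) * (- (PI * l) / (2 * k ^ 2 * sinh (l * ellK' k))).
Proof.
  rewrite <- sn_sqr_moment.
  pose proof (moment_formula k l 2 (fun n => sc_g k n (- l ^ 2)) C0 C0' hk ltac:(auto)
    (sc_gen_g k (- l ^ 2)) is_derive_cosine is_derive_cosine' cosine'_PI2) as E.
  replace (2 * n + 1)%nat with (2 * n + 2 - 1)%nat by lia. apply E.
  - discriminate.
  - intros _. apply cosine_int.
Qed.

Lemma sc_g_bound : exists B, 0 <= B /\
  forall n, Rabs (sc_g k n (- l ^ 2)) <= B * k ^ (2 * n) * INR (fact (2 * n + 2 - 1)).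
Proof.
  apply (sc_bound k l 2 (fun n => sc_g k n (- l ^ 2)) C0 C0' hk ltac:(auto)
    (sc_gen_g k (- l ^ 2)) is_derive_cosine is_derive_cosine' cosine'_PI2).
  - discriminate.
  - intros _. apply cosine_int.
  - intros y. apply Rabs_le, COS_bound.
  - rewrite sn_sqr_moment. pose proof (sinh_freq_pos l hl). pose proof PI_RGT_0.
    assert (0 < PI * l / (2 * k ^ 2 * sinh (l * ellK' k))); [| lra].
    apply Rdiv_lt_0_compat; [now apply Rmult_lt_0_compat |].
    assert (0 < k ^ 2) by nra. apply Rmult_lt_0_compat; lra.
Qed.

(** The termwise derivative of the expansion of (1 - cos (l u)) / l^2 in even powers of sn. *)
Lemma g_series (y : R) : 0 <= y ->
  is_series (fun n => sc_g k n (- l ^ 2) / INR (fact (2 * n + 2 - 1)) * sin y ^ (2 * n + 2 - 1)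
                      * cos y * dn k y) (sin (l * ellF k y) / l).
Proof.
  intros Hy. destruct sc_g_bound as [B [HB0 HB]].
  assert (D1 : forall y, is_derive (fun y => (1 - cos (l * ellF k y)) / l ^ 2) y
     (sin (l * ellF k y) / l / dn k y)).
  { intros x. pose proof (dn_neq_0 k hk x). auto_derive; [eexists; now apply is_derive_ellF |].
    subst_Derive (is_derive_ellF k hk x). field. split; auto; lra. }
  assert (D2 : forall y, is_derive (fun y => sin (l * ellF k y) / l) y
     ((- l ^ 2 * ((1 - cos (l * ellF k y)) / l ^ 2) + (INR 2 - 1)) / dn k y)).
  { intros x. pose proof (dn_neq_0 k hk x). auto_derive; [eexists; now apply is_derive_ellF |].
    subst_Derive (is_derive_ellF k hk x). simpl INR. field. split; auto; lra. }
  apply (sc_series_derive k l 2 (fun n => sc_g k n (- l ^ 2)) _ _ B hk hl ltac:(auto)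
      (sc_gen_g k (- l ^ 2)) HB0 HB D1 D2); auto.
  - rewrite ellF_0, Rmult_0_r, cos_0. field. lra.
  - rewrite ellF_0, Rmult_0_r, sin_0. simpl. field. lra.
Qed.

(** The sign -l produced by the integration by parts cancels the negative sign of the Fourier
    coefficient of sn^2, so the eigenvalues come out positive. *)
Lemma sn_cn_dn_moment (n : nat) :
  (2 * INR n + 2) * RInt (fun y => sin y ^ (2 * n + 1) * cos y * sin (l * ellF k y)) 0 (PI / 2)
  = - l * moment k C0 (2 * n + 2).
Proof.
  rewrite <- RInt_scal_all by (intros y; cont1).
  rewrite (RInt_ext_all _ (fun y => (INR (2 * n + 2) * sin y ^ (2 * n + 2 - 1) * cos y)
      * sin (l * ellF k y))).
  2:{ intros y. replace (2 * n + 2 - 1)%nat with (2 * n + 1)%nat by lia.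
      rewrite plus_INR, mult_INR. simpl INR. ring. }
  rewrite (RInt_by_parts_all (fun y => sin y ^ (2 * n + 2)) (fun y => sin (l * ellF k y)) _
    (fun y => l * cos (l * ellF k y) / dn k y)).
  - rewrite (RInt_ext_all (fun y => _ * (l * _ / _))
      (fun y => l * (C0 y / dn k y * sin y ^ (2 * n + 2)))).
    + rewrite RInt_scal_all by (intros y; unfold C0; cont1). fold (moment k C0 (2 * n + 2)).
      rewrite ellF_PI2. fold K. rewrite Hl, sin_0, pow_i by lia. rring.
    + intros y. unfold C0, Rdiv. ring.
  - intros y. apply is_derive_sin_pow. lia.
  - intros y. now apply is_derive_sin_ellF.
  - intros y. cont1.
  - intros y. cont1.
Qed.

End Cosine.

End SpectralData.

Lemma cos_half_odd_PI (m : nat) : cos (INR m * PI + PI / 2) = 0.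
Proof. apply cos_eq_0_1. exists (Z.of_nat m). now rewrite <- INR_IZR_INZ. Qed.

Lemma sin_nat_PI (m : nat) : sin (INR m * PI) = 0.
Proof. apply sin_eq_0_1. exists (Z.of_nat m). now rewrite <- INR_IZR_INZ. Qed.

Lemma sin_three_term (a b : R) : sin (a + b) = 2 * cos b * sin a - sin (a - b).
Proof. rewrite sin_plus, sin_minus. ring. Qed.

Lemma cos_three_term (a b : R) : cos (a + b) = 2 * cos b * cos a - cos (a - b).
Proof. rewrite cos_plus, cos_minus. ring. Qed.

Lemma Rabs_mult_le_1 (x y : R) : Rabs x <= 1 -> Rabs y <= 1 -> Rabs (x * y) <= 1.
Proof.
  intros Hx Hy. rewrite Rabs_mult. pose proof (Rabs_pos x). pose proof (Rabs_pos y). nra.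
Qed.

Lemma Rabs_cos_le (y : R) : Rabs (cos y) <= 1.
Proof. apply Rabs_le, COS_bound. Qed.

Lemma sqrt_sqr_pos (x : R) : 0 < x -> 0 < sqrt x /\ sqrt x * sqrt x = x.
Proof. intros Hx. split; [now apply sqrt_lt_R0 | apply sqrt_sqrt; lra]. Qed.

Lemma Rpower_PI_3_2 : Rpower PI (3 / 2) = PI * sqrt PI.
Proof.
  pose proof PI_RGT_0. rewrite <- (Rpower_1 PI) at 2 by auto.
  rewrite <- Rpower_sqrt, <- Rpower_plus by auto. f_equal. field.
Qed.

(** * The frequencies, the eigenvalues, and completeness at these frequencies *)

Section Assembly.

Variable k : R.
Hypothesis hk : 0 < k < 1.

Definition freq_f (m : nat) : R := PI * (2 * INR m + 1) / (2 * ellK k).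
(** Shifted by one: [freq_g m] belongs to [nu_g1 k (S m)] and [Psi_g k (S m)], whose enumeration
    starts at index 1. *)
Definition freq_g (m : nat) : R := PI * INR (S m) / ellK k.

Lemma freq_f_pos (m : nat) : 0 < freq_f m.
Proof.
  pose proof (ellK_pos k hk). pose proof PI_RGT_0. pose proof (pos_INR m).
  apply Rdiv_lt_0_compat; [apply Rmult_lt_0_compat |]; lra.
Qed.

Lemma freq_g_pos (m : nat) : 0 < freq_g m.
Proof.
  pose proof (ellK_pos k hk). pose proof PI_RGT_0.
  apply Rdiv_lt_0_compat; [apply Rmult_lt_0_compat |]; auto. apply lt_0_INR. lia.
Qed.

Lemma freq_f_cos (m : nat) : cos (freq_f m * ellK k) = 0.
Proof.
  pose proof (ellK_pos k hk). replace (freq_f m * ellK k) with (INR m * PI + PI / 2).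
  - apply cos_half_odd_PI.
  - unfold freq_f. field. lra.
Qed.

Lemma freq_g_sin (m : nat) : sin (freq_g m * ellK k) = 0.
Proof.
  pose proof (ellK_pos k hk). replace (freq_g m * ellK k) with (INR (S m) * PI).
  - apply sin_nat_PI.
  - unfold freq_g. field. lra.
Qed.

Lemma Psi_f_eq (m n : nat) : Psi_f k m n
  = sc_f k n (- freq_f m ^ 2) / (k ^ n * INR (fact (2 * n)) * sqrt (2 * INR n + 1)).
Proof.
  pose proof (ellK_pos k hk). unfold Psi_f.
  replace (- (PI ^ 2 * (2 * INR m + 1) ^ 2 / (4 * ellK k ^ 2))) with (- freq_f m ^ 2)
    by (unfold freq_f; field; lra).
  unfold Rdiv. ring.
Qed.

Lemma Psi_g_eq (m n : nat) : Psi_g k (S m) n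
  = sc_g k n (- freq_g m ^ 2) / (k ^ n * INR (fact (2 * n + 1)) * sqrt (INR n + 1)).
Proof.
  pose proof (ellK_pos k hk). unfold Psi_g.
  replace (- (PI ^ 2 * INR (S m) ^ 2 / ellK k ^ 2)) with (- freq_g m ^ 2)
    by (unfold freq_g; field; lra).
  unfold Rdiv. ring.
Qed.

Lemma nome_pow (n : nat) : nome k ^ n = exp (- (INR n * (PI * ellK' k / ellK k))).
Proof.
  pose proof (ellK_pos k hk). unfold nome. rewrite <- Rpower_pow by apply exp_pos.
  unfold Rpower. rewrite ln_exp. f_equal. field. lra.
Qed.

Lemma nome_f_ratio (m : nat) :
  Rpower (nome k) (INR m + 1 / 2) / (1 - nome k ^ (2 * m + 1)) = / (2 * sinh (freq_f m * ellK' k)).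
Proof.
  pose proof (ellK_pos k hk). rewrite <- exp_div_one_minus.
  2:{ apply Rmult_lt_0_compat; [apply freq_f_pos | now apply ellK'_pos]. }
  rewrite nome_pow. unfold nome, Rpower. rewrite ln_exp. unfold freq_f.
  rewrite plus_INR, mult_INR. simpl INR. f_equal; [| f_equal; f_equal]; f_equal; field; lra.
Qed.

Lemma nome_g_ratio (m : nat) :
  nome k ^ S m / (1 - nome k ^ (2 * S m)) = / (2 * sinh (freq_g m * ellK' k)).
Proof.
  pose proof (ellK_pos k hk). rewrite <- exp_div_one_minus.
  2:{ apply Rmult_lt_0_compat; [apply freq_g_pos | now apply ellK'_pos]. }
  rewrite !nome_pow. unfold freq_g. rewrite mult_INR.
  f_equal; [| f_equal; f_equal]; f_equal; [| change (INR 2) with 2]; field; lra.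
Qed.

Lemma nu_f1_eq (m : nat) : nu_f1 k m = PI / (sqrt PI * k * (freq_f m * sinh (freq_f m * ellK' k))).
Proof.
  pose proof (ellK_pos k hk). pose proof PI_RGT_0. pose proof (sqrt_sqr_pos PI PI_RGT_0) as [Hs Es].
  pose proof (sinh_freq_pos k hk (freq_f m) (freq_f_pos m)) as Hsh.
  pose proof (pos_INR m). unfold nu_f1.
  replace (Rpower (nome k) (INR m + 1 / 2) / ((2 * INR m + 1) * (1 - nome k ^ (2 * m + 1))))
    with (Rpower (nome k) (INR m + 1 / 2) / (1 - nome k ^ (2 * m + 1)) / (2 * INR m + 1))
    by (unfold Rdiv; rewrite Rinv_mult; ring).
  rewrite nome_f_ratio. unfold freq_f at 2. field. repeat split; lra.
Qed.

Lemma nu_f2_eq (m : nat) : nu_f2 k m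
  = 4 / sqrt PI * (PI / (2 * k)) * (freq_f m / sinh (freq_f m * ellK' k)).
Proof.
  pose proof (ellK_pos k hk). pose proof PI_RGT_0. pose proof (sqrt_sqr_pos PI PI_RGT_0) as [Hs Es].
  pose proof (sinh_freq_pos k hk (freq_f m) (freq_f_pos m)) as Hsh.
  unfold nu_f2.
  replace ((2 * INR m + 1) * Rpower (nome k) (INR m + 1 / 2) / (1 - nome k ^ (2 * m + 1)))
    with ((2 * INR m + 1) * (Rpower (nome k) (INR m + 1 / 2) / (1 - nome k ^ (2 * m + 1))))
    by (unfold Rdiv; ring).
  rewrite nome_f_ratio, Rpower_PI_3_2. unfold freq_f at 2.
  transitivity (PI * (sqrt PI * sqrt PI) * (2 * INR m + 1)
     / (sqrt PI * k * ellK k * sinh (freq_f m * ellK' k))).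
  - field. repeat split; lra.
  - rewrite Es. field. repeat split; lra.
Qed.

Lemma nu_g1_eq (m : nat) : nu_g1 k (S m)
  = PI / (sqrt PI * k ^ 2) * (freq_g m / sinh (freq_g m * ellK' k)).
Proof.
  pose proof (ellK_pos k hk). pose proof PI_RGT_0. pose proof (sqrt_sqr_pos PI PI_RGT_0) as [Hs Es].
  pose proof (sinh_freq_pos k hk (freq_g m) (freq_g_pos m)) as Hsh.
  unfold nu_g1.
  replace (INR (S m) * nome k ^ S m / (1 - nome k ^ (2 * S m)))
    with (INR (S m) * (nome k ^ S m / (1 - nome k ^ (2 * S m)))) by (unfold Rdiv; ring).
  rewrite nome_g_ratio, Rpower_PI_3_2. unfold freq_g at 2.
  transitivity (PI * (sqrt PI * sqrt PI) * INR (S m)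
     / (sqrt PI * k ^ 2 * ellK k * sinh (freq_g m * ellK' k))).
  - field. repeat split; lra.
  - rewrite Es. field. repeat split; lra.
Qed.

Lemma freq_f_lt (m : nat) : freq_f m < freq_f (m + 1).
Proof.
  pose proof (ellK_pos k hk). pose proof PI_RGT_0. unfold freq_f. rewrite plus_INR. simpl (INR 1).
  apply Rmult_lt_compat_r; [apply Rinv_0_lt_compat; lra |]. nra.
Qed.

Lemma freq_g_lt (m : nat) : freq_g m < freq_g (m + 1).
Proof.
  pose proof (ellK_pos k hk). pose proof PI_RGT_0. unfold freq_g. rewrite Nat.add_1_r, (S_INR (S m)).
  apply Rmult_lt_compat_r; [apply Rinv_0_lt_compat; lra |]. nra.
Qed.

Lemma ratio_sinh_decr (a b t : R) : 0 < a -> a < b -> 0 < t ->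
  b / sinh (b * t) < a / sinh (a * t).
Proof.
  intros Ha Hab Ht.
  assert (Hat : 0 < a * t) by now apply Rmult_lt_0_compat.
  assert (Habt : a * t < b * t) by (apply Rmult_lt_compat_r; lra).
  pose proof (sinh_pos (a * t) Hat). pose proof (sinh_pos (b * t) ltac:(lra)).
  pose proof (mult_sinh_lt (a * t) (b * t) Hat Habt) as E.
  apply Rmult_lt_reg_r with (sinh (a * t) * sinh (b * t) * t).
  { apply Rmult_lt_0_compat; [now apply Rmult_lt_0_compat | auto]. }
  replace (b / sinh (b * t) * (sinh (a * t) * sinh (b * t) * t)) with (b * t * sinh (a * t))
    by (field; lra).
  replace (a / sinh (a * t) * (sinh (a * t) * sinh (b * t) * t)) with (a * t * sinh (b * t))
    by (field; lra). exact E.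
Qed.

Lemma nu_f1_pos_decr (m : nat) : 0 < nu_f1 k m /\ nu_f1 k (m + 1) < nu_f1 k m.
Proof.
  rewrite !nu_f1_eq. pose proof PI_RGT_0. pose proof (sqrt_sqr_pos PI PI_RGT_0) as [Hs _].
  pose proof (sinh_freq_pos k hk _ (freq_f_pos m)) as Hm.
  pose proof (sinh_freq_pos k hk _ (freq_f_pos (m + 1))) as Hm1.
  pose proof (freq_f_pos m). pose proof (freq_f_lt m). pose proof (ellK'_pos k hk).
  assert (Hk : 0 < sqrt PI * k) by (apply Rmult_lt_0_compat; lra).
  assert (P1 : 0 < freq_f m * sinh (freq_f m * ellK' k)) by now apply Rmult_lt_0_compat.
  assert (P2 : freq_f m * sinh (freq_f m * ellK' k) < freq_f (m + 1) * sinh (freq_f (m + 1) * ellK' k)).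
  { apply Rmult_le_0_lt_compat; try lra. apply sinh_lt, Rmult_lt_compat_r; auto. }
  split.
  - apply Rdiv_lt_0_compat; auto. now apply Rmult_lt_0_compat.
  - apply Rmult_lt_compat_l; auto. apply Rinv_lt_contravar.
    + apply Rmult_lt_0_compat; apply Rmult_lt_0_compat; auto; lra.
    + now apply Rmult_lt_compat_l.
Qed.

Lemma nu_f2_pos_decr (m : nat) : 0 < nu_f2 k m /\ nu_f2 k (m + 1) < nu_f2 k m.
Proof.
  rewrite !nu_f2_eq. pose proof PI_RGT_0. pose proof (sqrt_sqr_pos PI PI_RGT_0) as [Hs _].
  pose proof (sinh_freq_pos k hk _ (freq_f_pos m)) as Hm.
  assert (Hc : 0 < 4 / sqrt PI * (PI / (2 * k))).
  { apply Rmult_lt_0_compat; apply Rdiv_lt_0_compat; lra. }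
  split.
  - apply Rmult_lt_0_compat; auto. apply Rdiv_lt_0_compat; auto. apply freq_f_pos.
  - apply Rmult_lt_compat_l; auto.
    apply ratio_sinh_decr; [apply freq_f_pos | apply freq_f_lt | now apply ellK'_pos].
Qed.

Lemma nu_g1_pos_decr (m : nat) : 0 < nu_g1 k (S m) /\ nu_g1 k (S (m + 1)) < nu_g1 k (S m).
Proof.
  rewrite !nu_g1_eq. pose proof PI_RGT_0. pose proof (sqrt_sqr_pos PI PI_RGT_0) as [Hs _].
  pose proof (sinh_freq_pos k hk _ (freq_g_pos m)) as Hm.
  assert (Hc : 0 < PI / (sqrt PI * k ^ 2)).
  { apply Rdiv_lt_0_compat; auto. apply Rmult_lt_0_compat; [auto | nra]. }
  split.
  - apply Rmult_lt_0_compat; auto. apply Rdiv_lt_0_compat; auto. apply freq_g_pos.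
  - apply Rmult_lt_compat_l; auto.
    apply ratio_sinh_decr; [apply freq_g_pos | apply freq_g_lt | now apply ellK'_pos].
Qed.

(** Both frequency sequences advance in steps of PI / K, so this is their Chebyshev variable; it
    decreases from 1 to -1 on the interval. *)
Let z (y : R) : R := cos (PI / ellK k * ellF k y).

Lemma z_cont (y : R) : continuous z y.
Proof. unfold z. cont1. Qed.

Lemma z_decr (x y : R) : 0 <= x -> x < y -> y <= PI / 2 -> z y < z x.
Proof.
  intros Hx Hxy Hy. pose proof (ellK_pos k hk). pose proof PI_RGT_0.
  pose proof (ellF_bounds k hk x ltac:(lra)). pose proof (ellF_bounds k hk y ltac:(lra)).
  pose proof (ellF_increasing k hk x y Hxy).
  assert (Hc : 0 < PI / ellK k) by now apply Rdiv_lt_0_compat.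
  assert (E : PI = PI / ellK k * ellK k) by (field; lra).
  apply cos_decreasing_1.
  - apply Rmult_le_pos; lra.
  - rewrite E at 2. apply Rmult_le_compat_l; lra.
  - apply Rmult_le_pos; lra.
  - rewrite E at 2. apply Rmult_le_compat_l; lra.
  - apply Rmult_lt_compat_l; lra.
Qed.

Lemma amplitude_angle_bounds (y : R) : 0 < y < PI / 2 -> 0 < PI / (2 * ellK k) * ellF k y < PI / 2.
Proof.
  intros Hy. pose proof (ellK_pos k hk). pose proof PI_RGT_0.
  pose proof (ellF_increasing k hk 0 y ltac:(lra)) as H1. rewrite ellF_0 in H1.
  pose proof (ellF_increasing k hk y (PI / 2) ltac:(lra)) as H2. rewrite ellF_PI2 in H2.
  assert (Hc : 0 < PI / (2 * ellK k)) by (apply Rdiv_lt_0_compat; lra).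
  split; [now apply Rmult_lt_0_compat |].
  replace (PI / 2) with (PI / (2 * ellK k) * ellK k) by (field; lra).
  now apply Rmult_lt_compat_l.
Qed.

(** The constant [c] records where the sequence starts. From half a step, sin 3x = (2 cos 2x + 1)
    sin x and cos 3x = (2 cos 2x - 1) cos x give 1 and -1; from a full step, sin 2x = 2 cos x sin x
    gives 0. *)
Lemma trig_complete (S : nat -> R -> R) (a : nat -> R) (c : R) (V : R -> R) :
  (forall m x, continuous (S m) x) -> (forall m, a m <> 0) ->
  (forall x, S 1%nat x = (2 * z x + c) * S 0%nat x) ->
  (forall m x, S (m + 2)%nat x = 2 * z x * S (m + 1)%nat x - S m x) ->
  (forall x, 0 < x < PI / 2 -> S 0%nat x <> 0) -> (forall x, continuous V x) ->
  (forall m, RInt (fun y => V y * (S m y / a m) / dn k y) 0 (PI / 2) = 0) ->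
  forall y, 0 <= y <= PI / 2 -> V y = 0.
Proof.
  intros cS Ha H1 HS H0 cV Hm.
  apply (chebyshev_complete V z (fun y => / dn k y) S c); auto.
  - apply PI2_RGT_0.
  - apply z_cont.
  - apply z_decr.
  - intros x. apply Rabs_cos_le.
  - intros x Hx. apply Rmult_integral_contrapositive_currified; auto.
    now apply Rinv_neq_0_compat, dn_neq_0.
  - intros m. rewrite (RInt_ext_all _ (fun y => a m * (V y * (S m y / a m) / dn k y))).
    + rewrite RInt_scal_all by (intros y; unfold Rdiv at 2; cont1). rewrite Hm. rring.
    + intros y. pose proof (dn_neq_0 k hk y). specialize (Ha m). field. auto.
Qed.

Lemma freq_f_step (m : nat) (y : R) :
  freq_f (m + 1) * ellF k y = freq_f m * ellF k y + PI / ellK k * ellF k y.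
Proof. pose proof (ellK_pos k hk). unfold freq_f. rewrite plus_INR. simpl. field. lra. Qed.

Lemma freq_g_step (m : nat) (y : R) :
  freq_g (m + 1) * ellF k y = freq_g m * ellF k y + PI / ellK k * ellF k y.
Proof. pose proof (ellK_pos k hk). unfold freq_g. rewrite !S_INR, plus_INR. simpl. field. lra. Qed.

Lemma freq_f_0 (y : R) : freq_f 0 * ellF k y = PI / (2 * ellK k) * ellF k y /\
  freq_f 0 * ellF k y - PI / ellK k * ellF k y = - (freq_f 0 * ellF k y).
Proof. pose proof (ellK_pos k hk). unfold freq_f. simpl. split; field; lra. Qed.

Lemma sine_f_complete (V : R -> R) : (forall x, continuous V x) ->
  (forall m, RInt (fun y => V y * (sin (freq_f m * ellF k y) / freq_f m) / dn k y) 0 (PI / 2) = 0) ->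
  forall y, 0 <= y <= PI / 2 -> V y = 0.
Proof.
  apply (trig_complete (fun m y => sin (freq_f m * ellF k y)) freq_f 1).
  - intros m x. cont1.
  - intros m. pose proof (freq_f_pos m). lra.
  - intros x. rewrite (freq_f_step 0), sin_three_term, (proj2 (freq_f_0 x)), sin_neg.
    unfold z. ring.
  - intros m x. replace (m + 2)%nat with (m + 1 + 1)%nat by lia.
    rewrite (freq_f_step (m + 1)), sin_three_term, freq_f_step. f_equal. f_equal. ring.
  - intros x Hx. rewrite (proj1 (freq_f_0 x)). pose proof (amplitude_angle_bounds x Hx).
    apply Rgt_not_eq, sin_gt_0; lra.
Qed.

Lemma cosine_f_complete (V : R -> R) : (forall x, continuous V x) ->
  (forall m, RInt (fun y => V y * (cos (freq_f m * ellF k y) / 1) / dn k y) 0 (PI / 2) = 0) ->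
  forall y, 0 <= y <= PI / 2 -> V y = 0.
Proof.
  apply (trig_complete (fun m y => cos (freq_f m * ellF k y)) (fun _ => 1) (-1)).
  - intros m x. cont1.
  - intros m. lra.
  - intros x. rewrite (freq_f_step 0), cos_three_term, (proj2 (freq_f_0 x)), cos_neg.
    unfold z. ring.
  - intros m x. replace (m + 2)%nat with (m + 1 + 1)%nat by lia.
    rewrite (freq_f_step (m + 1)), cos_three_term, freq_f_step. f_equal. f_equal. ring.
  - intros x Hx. rewrite (proj1 (freq_f_0 x)). pose proof (amplitude_angle_bounds x Hx).
    apply Rgt_not_eq, cos_gt_0; lra.
Qed.

Lemma sine_g_complete (V : R -> R) : (forall x, continuous V x) ->
  (forall m, RInt (fun y => V y * (sin (freq_g m * ellF k y) / freq_g m) / dn k y) 0 (PI / 2) = 0) ->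
  forall y, 0 <= y <= PI / 2 -> V y = 0.
Proof.
  pose proof (ellK_pos k hk).
  assert (E0 : forall x, freq_g 0 * ellF k x = PI / ellK k * ellF k x).
  { intros x. unfold freq_g. simpl. field. lra. }
  apply (trig_complete (fun m y => sin (freq_g m * ellF k y)) freq_g 0).
  - intros m x. cont1.
  - intros m. pose proof (freq_g_pos m). lra.
  - intros x. rewrite (freq_g_step 0), sin_three_term, E0, Rminus_diag, sin_0. unfold z. ring.
  - intros m x. replace (m + 2)%nat with (m + 1 + 1)%nat by lia.
    rewrite (freq_g_step (m + 1)), sin_three_term, freq_g_step. f_equal. f_equal. ring.
  - intros x Hx. pose proof (amplitude_angle_bounds x Hx).
    rewrite E0. replace (PI / ellK k * ellF k x) with (2 * (PI / (2 * ellK k) * ellF k x))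
      by (field; lra).
    apply Rgt_not_eq, sin_gt_0; lra.
Qed.

Lemma Rabs_sin_div_le (l x : R) : 0 < l -> Rabs (sin x / l) <= / l.
Proof.
  intros Hl. pose proof (Rinv_0_lt_compat l Hl). unfold Rdiv. rewrite Rabs_mult, (Rabs_right (/ l)) by lra.
  rewrite <- (Rmult_1_l (/ l)) at 2. apply Rmult_le_compat_r; [lra |]. apply Rabs_le, SIN_bound.
Qed.

Lemma pow_double (n : nat) : k ^ (2 * n) = k ^ n * k ^ n.
Proof. rewrite <- pow_add. f_equal. lia. Qed.

Lemma ex_series_pow_double : ex_series (fun n => k ^ (2 * n)).
Proof.
  apply ex_series_ext with (fun n => (k ^ 2) ^ n).
  - intros n. now rewrite pow_mult.
  - apply ex_series_geom. rewrite Rabs_right; nra.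
Qed.

Lemma Psi_f_nonzero (m : nat) : exists n, Psi_f k m n <> 0.
Proof.
  exists 0%nat. rewrite Psi_f_eq. simpl. rewrite Rmult_0_r, Rplus_0_l, sqrt_1.
  apply Rgt_not_eq. lra.
Qed.

Lemma Psi_g_nonzero (m : nat) : exists n, Psi_g k (S m) n <> 0.
Proof.
  exists 0%nat. rewrite Psi_g_eq. simpl. rewrite Rplus_0_l, sqrt_1.
  apply Rgt_not_eq. lra.
Qed.

End Assembly.

(** * The three weighted Hankel matrices *)

Section SpectralTheorems.

Variable k : R.
Hypothesis hk : 0 < k < 1.

Lemma sqrt_odd (n : nat) :
  0 < sqrt (2 * INR n + 1) /\ sqrt (2 * INR n + 1) * sqrt (2 * INR n + 1) = 2 * INR n + 1.
Proof. apply sqrt_sqr_pos. pose proof (pos_INR n). lra. Qed.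

Lemma sqrt_succ (n : nat) :
  0 < sqrt (INR n + 1) /\ sqrt (INR n + 1) * sqrt (INR n + 1) = INR n + 1.
Proof. apply sqrt_sqr_pos. pose proof (pos_INR n). lra. Qed.

Lemma k_pow_pos (n : nat) : 0 < k ^ n.
Proof. apply pow_lt. lra. Qed.

(** The common frame: the functions are e_n = c_n sn^(2n) h with weight c0 / dn, where h is sn, cn
    dn or sn cn dn. Since |sn| and |h| are at most 1, the sequence [c] itself is the square-summable
    majorant. *)
Lemma weighted_hankel_spectrum (c : nat -> R) (c0 : R) (h : R -> R) (H Psi : nat -> nat -> R)
    (nu CS : nat -> R) (S : nat -> R -> R) :
  (forall n, 0 < c n) -> rell2 c -> 0 < c0 ->
  (forall y, continuous h y) -> (forall y, Rabs (h y) <= 1) ->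
  (forall y, 0 < y < PI / 2 -> h y <> 0) ->
  (forall m n, H m n = c m * c n * c0
     * RInt (fun y => sin y ^ (2 * (m + n)) * h y ^ 2 / dn k y) 0 (PI / 2)) ->
  (forall m, 0 < nu m /\ nu (m + 1)%nat < nu m) ->
  (forall m y, continuous (S m) y) -> (forall m y, Rabs (S m y) <= CS m) ->
  (forall m y, 0 <= y -> is_series (fun n => Psi m n * (c n * sin y ^ (2 * n) * h y)) (S m y)) ->
  (forall m n, c n * c0 * RInt (fun y => sin y ^ (2 * n) * h y * S m y / dn k y) 0 (PI / 2)
     = nu m * Psi m n) ->
  (forall V : R -> R, (forall x, continuous V x) ->
     (forall m, RInt (fun y => V y * S m y / dn k y) 0 (PI / 2) = 0) ->
     forall y, 0 <= y <= PI / 2 -> V y = 0) ->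
  (forall m, exists n, Psi m n <> 0) ->
  exists T : operator,
    represents H T /\ positive_op T /\ trace_class T
    /\ (forall lambda : C, eigenvalue T lambda -> simple_eigenvalue T lambda)
    /\ eigenvalues_enumerated T nu
    /\ (forall m : nat, eigenvector T (RtoC (nu m)) (fun n => RtoC (Psi m n))).
Proof.
  intros Hc c_l2 Hc0 ch Hh Hh0 HH Hnu cS HS Hser Hcoef Hcomp HPsi.
  assert (Rc : forall n, Rabs (c n) = c n) by (intros n; apply Rabs_right, Rle_ge, Rlt_le, Hc).
  apply (gram_spectral_theorem (fun n y => c n * sin y ^ (2 * n) * h y) c
    (fun y => c0 / dn k y) 0 (PI / 2) (c0 * / sqrt (1 - k ^ 2)) H PI2_RGT_0)
    with (S := S) (CS := CS); auto.
  - intros n y. cont1.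
  - intros y. cont1.
  - intros n y. rewrite Rmult_assoc, Rabs_mult, Rc. specialize (Hc n).
    pose proof (Rabs_mult_le_1 _ _ (Rabs_sin_pow_le (2 * n) y) (Hh y)).
    rewrite <- (Rmult_1_r (c n)) at 2. apply Rmult_le_compat_l; lra.
  - intros y. pose proof (inv_dn_bounds k hk y) as Hd. unfold Rdiv. split.
    + apply Rmult_le_pos; lra.
    + apply Rmult_le_compat_l; [lra | apply Hd].
  - intros m n. rewrite HH, <- RInt_scal_all by (intros y; unfold Rdiv; cont1).
    apply RInt_ext_all. intros y.
    replace (sin y ^ (2 * (m + n))) with (sin y ^ (2 * m) * sin y ^ (2 * n))
      by (rewrite <- pow_add; f_equal; lia).
    unfold Rdiv. ring.
  - intros m. apply Hnu.
  - intros m. apply Hnu.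
  - intros m y [Hy _]. now apply Hser.
  - intros m n. rewrite <- Hcoef, <- RInt_scal_all by (intros y; unfold Rdiv; cont1).
    apply RInt_ext_all. intros y. unfold Rdiv. ring.
  - intros V cV H0. apply Hcomp; auto. intros m. apply Rmult_eq_reg_l with c0; [| lra].
    rewrite <- RInt_scal_all, Rmult_0_r by (intros y; unfold Rdiv; cont1).
    etransitivity; [| exact (H0 m)]. apply RInt_ext_all. intros y. unfold Rdiv. ring.
  - intros v Hv. apply (synth_independent _ c c h); auto.
    + intros n. specialize (Hc n). lra.
    + intros n. rewrite Rc. lra.
    + apply ex_series_ext with (2 := ex_series_abs_mult v c Hv c_l2). intros n. now rewrite Rc.
Qed.

Lemma spectral_f1 : exists T : operator,
  represents (H_f1 k) T /\ positive_op T /\ trace_class T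
  /\ (forall lambda : C, eigenvalue T lambda -> simple_eigenvalue T lambda)
  /\ eigenvalues_enumerated T (nu_f1 k)
  /\ (forall m : nat, eigenvector T (RtoC (nu_f1 k m)) (fun n => RtoC (Psi_f k m n))).
Proof.
  pose proof PI_RGT_0 as Hpi. pose proof (sqrt_sqr_pos PI Hpi) as [HsPI EsPI].
  apply (weighted_hankel_spectrum (fun n => k ^ n / sqrt (2 * INR n + 1)) (2 / sqrt PI) sin)
    with (S := fun m y => sin (freq_f k m * ellF k y) / freq_f k m) (CS := fun m => / freq_f k m).
  - intros n. apply Rdiv_lt_0_compat; [apply k_pow_pos | apply sqrt_odd].
  - apply ex_series_le_R with (2 := ex_series_pow_double k hk). intros n.
    destruct (sqrt_odd n) as [Hr Er]. rewrite Rabs_right by (apply Rle_ge, pow2_ge_0).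
    pose proof (k_pow_pos (2 * n)). pose proof (pos_INR n).
    replace ((k ^ n / sqrt (2 * INR n + 1)) ^ 2) with (k ^ (2 * n) / (2 * INR n + 1)).
    2:{ rewrite pow_double, <- Er at 1. field. lra. }
    apply Rmult_le_reg_r with (2 * INR n + 1); [lra |].
    unfold Rdiv. rewrite Rmult_assoc, Rinv_l by lra. nra.
  - apply Rdiv_lt_0_compat; lra.
  - apply continuous_sin.
  - intros y. apply Rabs_le, SIN_bound.
  - intros y Hy. apply Rgt_not_eq, sin_gt_0; lra.
  - intros m n. rewrite H_f1_RInt by auto.
    rewrite (RInt_ext_all (fun y => sin y ^ (2 * (m + n)) * sin y ^ 2 / dn k y)
      (fun y => sin y ^ (2 * (m + n + 1)) / dn k y)).
    2:{ intros y. rewrite <- pow_add. do 2 f_equal. lia. }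
    f_equal. pose proof (pos_INR m). pose proof (pos_INR n).
    rewrite (Rmult_assoc PI), (sqrt_mult PI), (sqrt_mult (2 * INR m + 1)), pow_add by nra.
    destruct (sqrt_odd m). destruct (sqrt_odd n). field. repeat split; lra.
  - now apply nu_f1_pos_decr.
  - intros m y. cont1.
  - intros m y. apply Rabs_sin_div_le. now apply freq_f_pos.
  - intros m y Hy.
    apply is_series_ext with (2 := proj1 (f_series k hk (freq_f k m) (freq_f_pos k hk m)
      (freq_f_cos k hk m) y Hy)).
    intros n. rewrite Psi_f_eq by auto. destruct (sqrt_odd n) as [Hr Er]. pose proof (k_pow_pos n).
    pose proof (INR_fact_neq_0 (2 * n)). pose proof (pos_INR n).
    replace (2 * n + 1)%nat with (S (2 * n)) at 1 by lia.
    rewrite fact_simpl, mult_INR, S_INR, mult_INR, pow_add. change (INR 2) with 2.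
    rewrite <- Er at 1. onR. field. repeat split; auto; lra.
  - intros m n. pose proof (freq_f_pos k hk m) as Hl.
    pose proof (f_moment k hk (freq_f k m) Hl (freq_f_cos k hk m) n) as E. cbv beta in E.
    set (M := moment k (fun y => sin (freq_f k m * ellF k y)) (2 * n + 1)) in *.
    rewrite (RInt_ext_all _ (fun y => / freq_f k m
      * (sin (freq_f k m * ellF k y) / dn k y * sin y ^ (2 * n + 1)))).
    2:{ intros y. rewrite pow_add. unfold Rdiv. ring. }
    rewrite RInt_scal_all by (intros y; cont1).
    fold (moment k (fun y => sin (freq_f k m * ellF k y)) (2 * n + 1)). fold M.
    rewrite nu_f1_eq, Psi_f_eq by auto.
    destruct (sqrt_odd n) as [Hr Er]. pose proof (k_pow_pos n).
    pose proof (INR_fact_neq_0 (2 * n)) as Hf.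
    pose proof (sinh_freq_pos k hk (freq_f k m) Hl) as Hsh.
    rewrite pow_double in E.
    replace M with (sc_f k n (- freq_f k m ^ 2) * (PI / (2 * k * sinh (freq_f k m * ellK' k)))
                    / (k ^ n * k ^ n * INR (fact (2 * n)))).
    2:{ rewrite <- E. field. repeat split; auto; lra. }
    onR. field. repeat split; auto; lra.
  - now apply sine_f_complete.
  - now apply Psi_f_nonzero.
Qed.

(** The functions k^n sqrt (2n + 1) sn^(2n) cn dn are the u-derivatives of those used for [H_f1].
    The same vectors [Psi_f] therefore sum them to the derivative cos (l u) of sin (l u) / l. *)
Lemma spectral_f2 : exists T : operator,
  represents (H_f2 k) T /\ positive_op T /\ trace_class T
  /\ (forall lambda : C, eigenvalue T lambda -> simple_eigenvalue T lambda)
  /\ eigenvalues_enumerated T (nu_f2 k)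
  /\ (forall m : nat, eigenvector T (RtoC (nu_f2 k m)) (fun n => RtoC (Psi_f k m n))).
Proof.
  pose proof PI_RGT_0 as Hpi. pose proof (sqrt_sqr_pos PI Hpi) as [HsPI EsPI].
  (* Dividing the cosine by 1 matches the normalised form [S m y / a m] of the completeness
     statement. *)
  apply (weighted_hankel_spectrum (fun n => k ^ n * sqrt (2 * INR n + 1)) (4 / sqrt PI)
           (fun y => cos y * dn k y))
    with (S := fun m y => cos (freq_f k m * ellF k y) / 1) (CS := fun m => 1).
  - intros n. apply Rmult_lt_0_compat; [apply k_pow_pos | apply sqrt_odd].
  - apply ex_series_ext with (2 := ex_series_pow_linear k hk). intros n.
    destruct (sqrt_odd n) as [Hr Er]. onR. rewrite pow_double.
    transitivity (k ^ n * k ^ n * (sqrt (2 * INR n + 1) * sqrt (2 * INR n + 1)));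
      [now rewrite Er | ring].
  - apply Rdiv_lt_0_compat; lra.
  - intros y. cont1.
  - intros y. apply Rabs_mult_le_1; [apply Rabs_cos_le | now apply Rabs_dn_le_1].
  - intros y Hy. apply Rgt_not_eq, Rmult_lt_0_compat; [apply cos_gt_0; lra | now apply dn_pos].
  - intros m n. rewrite H_f2_RInt by auto.
    rewrite (RInt_ext_all (fun y => sin y ^ (2 * (m + n)) * (cos y * dn k y) ^ 2 / dn k y)
      (fun y => sin y ^ (2 * (m + n)) * cos y ^ 2 * dn k y)).
    2:{ intros y. pose proof (dn_neq_0 k hk y). field. lra. }
    f_equal. pose proof (pos_INR m). pose proof (pos_INR n).
    rewrite (sqrt_mult (2 * INR m + 1)), pow_add by lra. field. lra.
  - now apply nu_f2_pos_decr.
  - intros m y. cont1.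
  - intros m y. rewrite Rdiv_1_r. apply Rabs_cos_le.
  - intros m y Hy. rewrite Rdiv_1_r.
    apply is_series_ext with (2 := proj2 (f_series k hk (freq_f k m) (freq_f_pos k hk m)
      (freq_f_cos k hk m) y Hy)).
    intros n. rewrite Psi_f_eq by auto. destruct (sqrt_odd n) as [Hr Er]. pose proof (k_pow_pos n).
    pose proof (INR_fact_neq_0 (2 * n)).
    replace (2 * n + 1 - 1)%nat with (2 * n)%nat by lia.
    onR. field. repeat split; auto; lra.
  - intros m n. pose proof (freq_f_pos k hk m) as Hl.
    pose proof (f_moment k hk (freq_f k m) Hl (freq_f_cos k hk m) n) as E. cbv beta in E.
    pose proof (cn_dn_moment k hk (freq_f k m) (freq_f_cos k hk m) n) as E1. cbv beta in E1.
    set (M := moment k (fun y => sin (freq_f k m * ellF k y)) (2 * n + 1)) in *.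
    rewrite (RInt_ext_all _ (fun y => sin y ^ (2 * n) * cos y * cos (freq_f k m * ellF k y))).
    2:{ intros y. pose proof (dn_neq_0 k hk y). field. lra. }
    set (I := RInt _ _ _ : R) in *.
    rewrite nu_f2_eq, Psi_f_eq by auto.
    destruct (sqrt_odd n) as [Hr Er]. pose proof (k_pow_pos n).
    pose proof (INR_fact_neq_0 (2 * n)) as Hf. pose proof (pos_INR n) as Hn.
    pose proof (sinh_freq_pos k hk (freq_f k m) Hl) as Hsh.
    rewrite pow_double in E.
    replace I with (freq_f k m / (sqrt (2 * INR n + 1) * sqrt (2 * INR n + 1)) *
        (sc_f k n (- freq_f k m ^ 2) * (PI / (2 * k * sinh (freq_f k m * ellK' k)))
                    / (k ^ n * k ^ n * INR (fact (2 * n))))).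
    2:{ rewrite <- E, Er. apply Rmult_eq_reg_l with (2 * INR n + 1); [| lra].
        rewrite E1. field. repeat split; auto; lra. }
    onR. field. repeat split; auto; lra.
  - now apply cosine_f_complete.
  - now apply Psi_f_nonzero.
Qed.

(** Here k^n sqrt (n + 1) sn^(2n+1) cn dn is the u-derivative of k^n sn^(2n+2) / (2 sqrt (n + 1)),
    so [Psi_g] sums these functions to sin (l u) / l, the derivative of (1 - cos (l u)) / l^2. *)
Lemma spectral_g1 : exists T : operator,
  represents (H_g1 k) T /\ positive_op T /\ trace_class T
  /\ (forall lambda : C, eigenvalue T lambda -> simple_eigenvalue T lambda)
  /\ eigenvalues_enumerated T (fun m => nu_g1 k (S m))
  /\ (forall m : nat, eigenvector T (RtoC (nu_g1 k (S m))) (fun n => RtoC (Psi_g k (S m) n))).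
Proof.
  pose proof PI_RGT_0 as Hpi. pose proof (sqrt_sqr_pos PI Hpi) as [HsPI EsPI].
  apply (weighted_hankel_spectrum (fun n => k ^ n * sqrt (INR n + 1)) (4 / sqrt PI)
           (fun y => sin y * cos y * dn k y))
    with (nu := fun m => nu_g1 k (S m)) (Psi := fun m => Psi_g k (S m))
         (S := fun m y => sin (freq_g k m * ellF k y) / freq_g k m) (CS := fun m => / freq_g k m).
  - intros n. apply Rmult_lt_0_compat; [apply k_pow_pos | apply sqrt_succ].
  - apply ex_series_le_R with (2 := ex_series_pow_linear k hk). intros n.
    destruct (sqrt_succ n) as [Hr Er]. rewrite Rabs_right by (apply Rle_ge, pow2_ge_0).
    pose proof (k_pow_pos (2 * n)). pose proof (pos_INR n).
    replace ((k ^ n * sqrt (INR n + 1)) ^ 2) with (k ^ (2 * n) * (INR n + 1))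
      by (rewrite pow_double, <- Er at 1; ring).
    apply Rmult_le_compat_l; lra.
  - apply Rdiv_lt_0_compat; lra.
  - intros y. cont1.
  - intros y. apply Rabs_mult_le_1; [apply Rabs_mult_le_1 | now apply Rabs_dn_le_1].
    + apply Rabs_le, SIN_bound.
    + apply Rabs_cos_le.
  - intros y Hy. apply Rgt_not_eq. repeat apply Rmult_lt_0_compat;
      [apply sin_gt_0; lra | apply cos_gt_0; lra | now apply dn_pos].
  - intros m n. rewrite H_g1_RInt by auto.
    rewrite (RInt_ext_all (fun y => sin y ^ (2 * (m + n)) * (sin y * cos y * dn k y) ^ 2 / dn k y)
      (fun y => sin y ^ (2 * (m + n + 1)) * cos y ^ 2 * dn k y)).
    2:{ intros y. pose proof (dn_neq_0 k hk y). rewrite (Nat.mul_add_distr_l 2 (m + n) 1), pow_add.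
        simpl (2 * 1)%nat. field. lra. }
    f_equal. pose proof (pos_INR m). pose proof (pos_INR n).
    rewrite (sqrt_mult (INR m + 1)), pow_add by lra. field. lra.
  - now apply nu_g1_pos_decr.
  - intros m y. cont1.
  - intros m y. apply Rabs_sin_div_le. now apply freq_g_pos.
  - intros m y Hy.
    apply is_series_ext with (2 := g_series k hk (freq_g k m) (freq_g_pos k hk m)
      (freq_g_sin k hk m) y Hy).
    intros n. rewrite Psi_g_eq by auto. destruct (sqrt_succ n) as [Hr Er]. pose proof (k_pow_pos n).
    pose proof (INR_fact_neq_0 (2 * n + 1)).
    replace (2 * n + 2 - 1)%nat with (2 * n + 1)%nat by lia.
    rewrite (pow_add (sin y) (2 * n)), pow_1.
    onR. field. repeat split; auto; lra.
  - intros m n. pose proof (freq_g_pos k hk m) as Hl.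
    pose proof (g_moment k hk (freq_g k m) Hl (freq_g_sin k hk m) n) as E. cbv beta in E.
    pose proof (sn_cn_dn_moment k hk (freq_g k m) (freq_g_sin k hk m) n) as E1. cbv beta in E1.
    set (M := moment k (fun y => cos (freq_g k m * ellF k y)) (2 * n + 2)) in *.
    rewrite (RInt_ext_all _ (fun y => / freq_g k m
      * (sin y ^ (2 * n + 1) * cos y * sin (freq_g k m * ellF k y)))).
    2:{ intros y. pose proof (dn_neq_0 k hk y).
        rewrite (pow_add (sin y) (2 * n)), pow_1. field. split; lra. }
    rewrite RInt_scal_all by (intros y; cont1).
    set (I := RInt _ _ _ : R) in *.
    rewrite nu_g1_eq, Psi_g_eq by auto.
    destruct (sqrt_succ n) as [Hr Er]. pose proof (k_pow_pos n). pose proof (pos_INR n) as Hn.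
    pose proof (INR_fact_neq_0 (2 * n + 1)) as Hf.
    pose proof (sinh_freq_pos k hk (freq_g k m) Hl) as Hsh.
    rewrite pow_double in E.
    replace I with (- freq_g k m / (2 * (sqrt (INR n + 1) * sqrt (INR n + 1))) *
        (sc_g k n (- freq_g k m ^ 2)
           * (- (PI * freq_g k m) / (2 * k ^ 2 * sinh (freq_g k m * ellK' k)))
                    / (k ^ n * k ^ n * INR (fact (2 * n + 1))))).
    2:{ rewrite <- E, Er. apply Rmult_eq_reg_l with (2 * INR n + 2); [| lra].
        rewrite E1. field. repeat split; auto; lra. }
    onR. field. repeat split; auto; lra.
  - now apply sine_g_complete.
  - now apply Psi_g_nonzero.
Qed.

End SpectralTheorems.

Theorem theorem18 (k : R) (hk : 0 < k < 1) :
  (forall m n : nat,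
     ex_RInt_gen
       (fun x : R => x ^ (2 * m + 2 * n + 2)
                     / sqrt ((1 - x ^ 2) * (1 - k ^ 2 * x ^ 2)))
       (at_point 0) (at_left 1)
     /\ H_f1 k m n
        = 2 * k ^ (m + n) / sqrt (PI * (2 * INR m + 1) * (2 * INR n + 1))
          * RInt_gen
              (fun x : R => x ^ (2 * m + 2 * n + 2)
                            / sqrt ((1 - x ^ 2) * (1 - k ^ 2 * x ^ 2)))
              (at_point 0) (at_left 1))
  /\ (forall m n : nat,
     H_f2 k m n
     = 4 * k ^ (m + n) * sqrt ((2 * INR m + 1) * (2 * INR n + 1)) / sqrt PI
       * RInt (fun x : R => x ^ (2 * m + 2 * n)
                            * sqrt ((1 - x ^ 2) * (1 - k ^ 2 * x ^ 2))) 0 1)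
  /\ (forall m n : nat,
     H_g1 k m n
     = 4 * k ^ (m + n) * sqrt ((INR m + 1) * (INR n + 1)) / sqrt PI
       * RInt (fun x : R => x ^ (2 * m + 2 * n + 2)
                            * sqrt ((1 - x ^ 2) * (1 - k ^ 2 * x ^ 2))) 0 1)
  /\ (exists T : operator,
        represents (H_f1 k) T /\ positive_op T /\ trace_class T
        /\ (forall lambda : C, eigenvalue T lambda -> simple_eigenvalue T lambda)
        /\ eigenvalues_enumerated T (nu_f1 k)
        /\ (forall m : nat,
              eigenvector T (RtoC (nu_f1 k m)) (fun n => RtoC (Psi_f k m n))))
  /\ (exists T : operator,
        represents (H_f2 k) T /\ positive_op T /\ trace_class T
        /\ (forall lambda : C, eigenvalue T lambda -> simple_eigenvalue T lambda)
        /\ eigenvalues_enumerated T (nu_f2 k)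
        /\ (forall m : nat,
              eigenvector T (RtoC (nu_f2 k m)) (fun n => RtoC (Psi_f k m n))))
  /\ (exists T : operator,
        represents (H_g1 k) T /\ positive_op T /\ trace_class T
        /\ (forall lambda : C, eigenvalue T lambda -> simple_eigenvalue T lambda)
        /\ eigenvalues_enumerated T (fun m => nu_g1 k (S m))
        /\ (forall m : nat, (1 <= m)%nat ->
              eigenvector T (RtoC (nu_g1 k m)) (fun n => RtoC (Psi_g k m n)))).
Proof.
  repeat match goal with |- _ /\ _ => split end.
  - intros m n. replace (2 * m + 2 * n + 2)%nat with (2 * (m + n + 1))%nat by lia.
    pose proof (elliptic_RInt_gen k hk (m + n)) as E. split.
    + eexists. exact E.
    + rewrite (is_RInt_gen_unique _ _ E). now apply H_f1_RInt.
  - intros m n. replace (2 * m + 2 * n)%nat with (2 * (m + n))%nat by lia.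
    rewrite elliptic_RInt_sqrt by auto. now apply H_f2_RInt.
  - intros m n. replace (2 * m + 2 * n + 2)%nat with (2 * (m + n + 1))%nat by lia.
    rewrite elliptic_RInt_sqrt by auto. now apply H_g1_RInt.
  - now apply spectral_f1.
  - now apply spectral_f2.
  - destruct (spectral_g1 k hk) as [T [H1 [H2 [H3 [H4 [H5 H6]]]]]].
    exists T. repeat (split; [assumption |]). intros [|m] Hm; [lia | apply H6].
Qed.
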